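(* Let $R$ be a commutative Noetherian local ring. Then the function $\mathrm{dist}_R$ is a metric on the set $\mathfrak{S}(R)$ of shift-isomorphism classes of semidualizing $R$-complexes.
   Context: Let $(R,\mathfrak m,k)$ be a commutative Noetherian local ring and $\mathcal D(R)$ its derived category; $R$-complexes are indexed homologically, $(\Sigma^nX)_i=X_{i-n}$ denotes the $n$th shift, $\simeq$ denotes isomorphism in $\mathcal D(R)$, and $X\sim Y$ means $X\simeq\Sigma^nY$ for some $n\in\mathbb Z$ (''shift-isomorphic''). A complex is homologically finite if its total homology $\mathrm H(X)$ is a finitely generated $R$-module. A homologically finite complex $K$ is semidualizing if the natural homothety morphism $R\to\mathbf R\mathrm{Hom}_R(K,K)$ is an isomorphism in $\mathcal D(R)$. If $K$ is semidualizing, a homologically finite complex $X$ is $K$-reflexive if $\mathbf R\mathrm{Hom}_R(X,K)$ is homologically bounded and the natural biduality morphism $X\to\mathbf R\mathrm{Hom}_R(\mathbf R\mathrm{Hom}_R(X,K),K)$ is an isomorphism. $\mathfrak S(R)$ is the set of shift-isomorphism classes $[K]$ of semidualizing $R$-complexes $K$. Write $[K]\trianglelefteq[L]$ if $L$ is $K$-reflexive (independent of representatives); always $[K]\trianglelefteq[R]$. For a homologically finite complex $X$, $\beta^R_i(X)=\mathrm{rank}_k\,\mathrm H_{-i}(\mathbf R\mathrm{Hom}_R(X,k))$, and the curvature is $\mathrm{curv}_R(X)=\limsup_{n\to\infty}\sqrt[n]{\beta^R_n(X)}$. When $[K]\trianglelefteq[L]$, set $\sigma_R([K],[L])=\mathrm{curv}_R(\mathbf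 R\mathrm{Hom}_R(L,K))$. A route $\gamma$ from $[K]$ to $[L]$ consists of an integer $n\ge1$ and elements $[K_0]=[K],[K_1],\dots,[K_n]=[L]$ and $[L_0],\dots,[L_{n-1}]$ of $\mathfrak S(R)$ such that $[K_j]\trianglelefteq[L_j]$ and $[K_{j+1}]\trianglelefteq[L_j]$ for $j=0,\dots,n-1$. Its length is $\mathrm{length}_R(\gamma)=\sum_{j=0}^{n-1}\bigl(\sigma_R([K_j],[L_j])+\sigma_R([K_{j+1}],[L_j])\bigr)$. Finally, $\mathrm{dist}_R([K],[L])=\inf\{\mathrm{length}_R(\gamma)\mid\gamma\text{ is a route from }[K]\text{ to }[L]\}$. *)

(* Defs.v *)
From HB Require Import structures.
From mathcomp Require Import all_boot all_order all_algebra.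
From mathcomp Require Import all_classical all_reals all_analysis.
From Stdlib Require Import Relation_Operators.

Set Implicit Arguments.
Unset Strict Implicit.
Unset Printing Implicit Defensive.

Import Order.TTheory GRing.Theory Num.Theory.
Local Open Scope classical_set_scope.
Local Open Scope ring_scope.

(* Noetherian local rings *)

Definition noetherian (R : comUnitRingType) : Prop :=
  forall I : R -> Prop, I 0 -> (forall x y, I x -> I y -> I (x + y)) ->
    (forall a x, I x -> I (a * x)) ->
  exists (n : nat) (g : 'I_n -> R),
    forall x, I x <-> exists c : 'I_n -> R, x = \sum_(s < n) c s * g s.

Definition local_ring (R : comUnitRingType) : Prop :=
  forall x y : R, x \isn't a GRing.unit -> y \isn't a GRing.unit ->
    x + y \isn't a GRing.unit.

(* The residue field enters as a surjection of the local ring [R] onto a field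
   [k] whose kernel is the maximal ideal, i.e. the set of nonunits. *)
Definition residue_map (R : comUnitRingType) (k : fieldType)
    (pi : {rmorphism R -> k}) : Prop :=
  (forall y : k, exists x : R, pi x = y) /\
  (forall x : R, pi x = 0 <-> x \isn't a GRing.unit).

(* Complexes *)

(* [diff X i j] is meaningful for [i = j + 1] only, and is zero otherwise; this
   avoids transport along equalities of indices. *)
Record complex (R : comUnitRingType) := Complex {
  obj :> int -> lmodType R;
  diff : forall i j, {linear obj i -> obj j};
  diff_shape : forall i j x, i != j + 1 -> diff i j x = 0;
  diff_diff : forall i j l x, diff j l (diff i j x) = 0 }.

Record chain_map (R : comUnitRingType) (X Y : complex R) := ChainMap {
  cmap :> forall i, {linear X i -> Y i};
  cmap_diff : forall i j x, cmap j (diff X i j x) = diff Y i j (cmap i x) }.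

Section Construction.
Context {R : comUnitRingType}.
Implicit Types X Y Z : complex R.

Lemma id_diff X i j (x : X i) : diff X i j x = diff X i j x.
Proof. by []. Qed.

Definition id_map X : chain_map X X :=
  @ChainMap R X X (fun=> idfun : {linear _ -> _}) (@id_diff X).

Lemma comp_diff X Y Z (g : chain_map Y Z) (f : chain_map X Y) i j (x : X i) :
  (g j \o f j) (diff X i j x) = diff Z i j ((g i \o f i) x).
Proof. by rewrite /= !cmap_diff. Qed.

Definition comp_map X Y Z (g : chain_map Y Z) (f : chain_map X Y) :
    chain_map X Z :=
  @ChainMap R X Z (fun i => g i \o f i : {linear _ -> _}) (comp_diff g f).

Definition sign (n : int) : R := (-1) ^ n.

Lemma sign_unit : (-1 : R) \is a GRing.unit.
Proof. by rewrite unitrN1. Qed.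

Lemma signD m n : sign (m + n) = sign m * sign n.
Proof. by rewrite /sign exprzDr ?sign_unit. Qed.

Lemma sign1 : sign 1 = -1.
Proof. by rewrite /sign expr1z. Qed.

Lemma signN1 : sign (-1) = -1.
Proof. by rewrite /sign exprN1 invrN1. Qed.

Lemma sign_sqr n : sign n * sign n = 1.
Proof.
by rewrite -signD /sign -mulr2n -mulr_natl -exprz_exp -exprnP sqrrN expr1n exp1rz.
Qed.

Definition lin_of (U V : lmodType R) (f : U -> V) (fL : linear f) :
    {linear U -> V} := HB.pack f (GRing.isLinear.Build R U V *:%R f fL).

(* Shift: (Sigma^n X)_i = X_(i - n), with differential (-1)^n d^X. *)

Section Shift.
Variables (X : complex R) (n : int).

Lemma shift_shape i j (x : X (i - n)) : i != j + 1 ->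
  (sign n \*: diff X (i - n) (j - n)) x = 0.
Proof.
move=> ij; rewrite /= diff_shape ?scaler0 //.
by apply: contraNneq ij => e; rewrite -(subrK n i) e addrAC subrK.
Qed.

Lemma shift_diff i j l (x : X (i - n)) :
  (sign n \*: diff X (j - n) (l - n))
    ((sign n \*: diff X (i - n) (j - n)) x) = 0.
Proof. by rewrite /= linearZ /= diff_diff !scaler0. Qed.

Definition shift : complex R :=
  @Complex R (fun i => X (i - n))
    (fun i j => sign n \*: diff X (i - n) (j - n) : {linear _ -> _})
    shift_shape shift_diff.
End Shift.

(* A module as a complex concentrated in degree 0. *)

Section Stalk.
Variable M : lmodType R.

Definition stalk_obj (i : int) : lmodType R :=
  if i is Posz 0 then M else 'rV[R]_0.

Lemma stalk_shape i j (x : stalk_obj i) : i != j + 1 ->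
  (\0 : {linear stalk_obj i -> stalk_obj j}) x = 0.
Proof. by []. Qed.

Lemma stalk_diff i j l (x : stalk_obj i) :
  (\0 : {linear stalk_obj j -> stalk_obj l})
    ((\0 : {linear stalk_obj i -> stalk_obj j}) x) = 0.
Proof. by []. Qed.

Definition stalk : complex R := Complex stalk_shape stalk_diff.
End Stalk.

(* Hom_R(X, Y)_n is the product over [i] of Hom_R(X_i, Y_(i + n)); it is encoded
   as families with two indices that vanish off the line [j = i + n]. *)

Record hom X Y (n : int) := HomElt {
  hcomp :> forall i j, {linear X i -> Y j};
  hom_shape : forall i j x, j != i + n -> hcomp i j x = 0 }.

Lemma linear_ext (U V : lmodType R) (f g : {linear U -> V}) :
  f =1 g -> f = g.
Proof.
case: f g => f [[[f0 fD]] [fZ]] [g [[[g0 gD]] [gZ]]] /= /funext e.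
case: _ / e g0 gD gZ => g0 gD gZ.
by rewrite (Prop_irrelevance f0 g0) (Prop_irrelevance fD gD) (Prop_irrelevance fZ gZ).
Qed.

Lemma hom_ext X Y n (f g : hom X Y n) :
  (forall i j x, f i j x = g i j x) -> f = g.
Proof.
case: f g => f fs [g gs] /= e.
have {}e : f = g.
  by apply: functional_extensionality_dep => i;
     apply: functional_extensionality_dep => j; apply: linear_ext; apply: e.
by case: _ / e gs => gs; rewrite (Prop_irrelevance fs gs).
Qed.

Section HomModule.
Variables (X Y : complex R) (n : int).
Implicit Types f g : hom X Y n.

HB.instance Definition _ := gen_eqMixin (hom X Y n).
HB.instance Definition _ := gen_choiceMixin (hom X Y n).

Definition hom_zero : hom X Y n :=
  @HomElt X Y n (fun i j => \0 : {linear X i -> Y j}) (fun _ _ _ _ => erefl).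

Lemma hom_opp_shape f i j (x : X i) : j != i + n -> (\- f i j) x = 0.
Proof. by move=> ij; rewrite /= hom_shape // oppr0. Qed.
Definition hom_opp f : hom X Y n :=
  @HomElt X Y n (fun i j => \- f i j : {linear _ -> _}) (hom_opp_shape f).

Lemma hom_add_shape f g i j (x : X i) : j != i + n -> (f i j \+ g i j) x = 0.
Proof. by move=> ij; rewrite /= !hom_shape // addr0. Qed.
Definition hom_add f g : hom X Y n :=
  @HomElt X Y n (fun i j => f i j \+ g i j : {linear _ -> _})
    (hom_add_shape f g).

Lemma hom_scale_shape a f i j (x : X i) : j != i + n -> (a \*: f i j) x = 0.
Proof. by move=> ij; rewrite /= hom_shape // scaler0. Qed.
Definition hom_scale a f : hom X Y n :=
  @HomElt X Y n (fun i j => a \*: f i j : {linear _ -> _})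
    (hom_scale_shape a f).

Lemma hom_addA : associative hom_add.
Proof. by move=> f g h; apply: hom_ext => i j x /=; rewrite addrA. Qed.
Lemma hom_addC : commutative hom_add.
Proof. by move=> f g; apply: hom_ext => i j x /=; rewrite addrC. Qed.
Lemma hom_add0 : left_id hom_zero hom_add.
Proof. by move=> f; apply: hom_ext => i j x /=; rewrite add0r. Qed.
Lemma hom_addN : left_inverse hom_zero hom_opp hom_add.
Proof. by move=> f; apply: hom_ext => i j x /=; rewrite addNr. Qed.

HB.instance Definition _ := GRing.isZmodule.Build (hom X Y n)
  hom_addA hom_addC hom_add0 hom_addN.

Lemma hom_scaleA a b f : hom_scale a (hom_scale b f) = hom_scale (a * b) f.
Proof. by apply: hom_ext => i j x /=; rewrite scalerA. Qed.
Lemma hom_scale1 : left_id 1 hom_scale.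
Proof. by move=> f; apply: hom_ext => i j x /=; rewrite scale1r. Qed.
Lemma hom_scaleDr : right_distributive hom_scale +%R.
Proof. by move=> a f g; apply: hom_ext => i j x /=; rewrite scalerDr. Qed.
Lemma hom_scaleDl f : {morph hom_scale^~ f : a b / a + b}.
Proof. by move=> a b; apply: hom_ext => i j x /=; rewrite scalerDl. Qed.

HB.instance Definition _ := GRing.Zmodule_isLmodule.Build R (hom X Y n)
  hom_scaleA hom_scale1 hom_scaleDr hom_scaleDl.

Lemma hom_addE f g i j (x : X i) : (f + g) i j x = f i j x + g i j x.
Proof. by []. Qed.
Lemma hom_scaleE a f i j (x : X i) : (a *: f) i j x = a *: f i j x.
Proof. by []. Qed.
End HomModule.

(* The differential of Hom_R(X, Y): d(f) = d^Y f - (-1)^n f d^X for f of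
   degree n. *)

Section HomComplex.
Variables X Y : complex R.

Definition hom_diff_fun n m (f : hom X Y n) i j (x : X i) : Y j :=
  if n == m + 1 then
    diff Y (j + 1) j (f i (j + 1) x)
    - sign n *: f (i - 1) j (diff X i (i - 1) x)
  else 0.

Lemma hom_diff_linear n m (f : hom X Y n) i j :
  linear (@hom_diff_fun n m f i j).
Proof.
move=> a x y; rewrite /hom_diff_fun; case: ifP => _; last by rewrite scaler0 addr0.
by rewrite !linearP /= addrACA -scalerDr.
Qed.

Lemma hom_diff_shape n m (f : hom X Y n) i j (x : X i) :
  j != i + m -> lin_of (@hom_diff_linear n m f i j) x = 0.
Proof.
move=> jim; rewrite /= /hom_diff_fun; case: eqP => // e; subst n.
have j1 : j + 1 != i + (m + 1) by rewrite addrA (inj_eq (addIr _)).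
have j2 : j != i - 1 + (m + 1) by rewrite [m + 1]addrC addrA subrK.
by rewrite (hom_shape f _ j1) (hom_shape f _ j2) linear0 scaler0 subr0.
Qed.

Definition hom_diff_elt n m (f : hom X Y n) : hom X Y m :=
  HomElt (@hom_diff_shape n m f).

Lemma hom_diff_elt_linear n m : linear (@hom_diff_elt n m).
Proof.
move=> a f g; apply: hom_ext => i j x /=; rewrite /hom_diff_fun.
case: ifP => _; last by rewrite scaler0 addr0.
by rewrite hom_addE hom_scaleE !linearP /= addrACA -scalerDr.
Qed.

Definition hom_diff n m : {linear hom X Y n -> hom X Y m} :=
  lin_of (@hom_diff_elt_linear n m).

Lemma hom_diff_off n m (f : hom X Y n) : n != m + 1 -> hom_diff n m f = 0.
Proof.
by move=> nm; apply: hom_ext => i j x /=; rewrite /hom_diff_fun (negPf nm).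
Qed.

Lemma hom_diff_diff n m l (f : hom X Y n) : hom_diff m l (hom_diff n m f) = 0.
Proof.
apply: hom_ext => i j x /=; rewrite /hom_diff_fun.
case: eqP => // e; subst m; rewrite /= /hom_diff_fun.
case: eqP => [e|_]; last by rewrite linear0 scaler0 subr0.
subst n.
rewrite raddfB /= linearZ /= !diff_diff linear0 scaler0 subr0 sub0r.
by rewrite [sign (_ + 1)]signD sign1 mulrN1 scaleNr opprK subrr.
Qed.

Definition Hom : complex R := Complex hom_diff_off hom_diff_diff.
End HomComplex.

(* A chain map as an element of Hom_R(X, Y)_0; the cast is along [i = j]. *)

Section Hom0.
Variables (X Y : complex R) (f : chain_map X Y).

Definition hom0_fun i j (x : X i) : Y j :=
  if i =P j is ReflectT e then ecast l (Y l) e (f i x) else 0.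

Lemma hom0_linear i j : linear (@hom0_fun i j).
Proof.
move=> a x y; rewrite /hom0_fun; case: eqP => [e|_]; last by rewrite scaler0 addr0.
by case: _ / e; rewrite linearP.
Qed.

Lemma hom0_shape i j (x : X i) :
  j != i + 0 -> lin_of (@hom0_linear i j) x = 0.
Proof.
by rewrite addr0 /= /hom0_fun; case: eqP => // e; case: _ / e; rewrite eqxx.
Qed.

Definition hom0 : hom X Y 0 := HomElt hom0_shape.

Lemma hom0_cycle n : hom_diff X Y 0 n hom0 = 0.
Proof.
apply: hom_ext => i j x /=; rewrite /hom_diff_fun; case: eqP => // _.
rewrite /sign expr0z scale1r /= /hom0_fun.
have H l (e : l = j) (y : X i) :
    ecast l (Y l) e (f l (diff X i l y)) = diff Y i j (f i y).
  by case: _ / e; rewrite cmap_diff.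
case: (i =P j + 1) => [e|ij].
  case: eqP => [e'|ne]; last by case: ne; rewrite e addrK.
  by rewrite H; case: _ / e; rewrite subrr.
rewrite linear0 sub0r; case: eqP => [e'|_]; last by rewrite oppr0.
by case: ij; rewrite -e' subrK.
Qed.
End Hom0.

(* The biduality chain map X -> Hom(Hom(X, K), K), which sends x to
   phi |-> (-1)^(|x||phi|) phi(x). *)

Section Biduality.
Variables X K : complex R.

Lemma bidual_linear i (x : X i) a b :
  linear (fun phi : hom X K a => sign (i * a) *: phi i b x).
Proof.
move=> c f g /=; rewrite scalerDr; congr (_ + _).
by rewrite !scalerA [sign _ * c]mulrC.
Qed.

Lemma bidual_shape i (x : X i) a b (phi : Hom X K a) :
  b != a + i -> lin_of (@bidual_linear i x a b) phi = 0.
Proof. by move=> bai; rewrite /= hom_shape ?scaler0 // addrC. Qed.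

Definition bidual_elt i (x : X i) : hom (Hom X K) K i :=
  HomElt (@bidual_shape i x).

Lemma bidual_elt_linear i : linear (@bidual_elt i).
Proof.
move=> c x y; apply: hom_ext => a b phi.
by rewrite hom_addE hom_scaleE /= linearP scalerDr !scalerA [sign _ * c]mulrC.
Qed.

Lemma bidual_diff i j (x : X i) :
  lin_of (@bidual_elt_linear j) (diff X i j x) =
  diff (Hom (Hom X K) K) i j (lin_of (@bidual_elt_linear i) x).
Proof.
apply: hom_ext => a b phi /=; rewrite /hom_diff_fun.
case: eqP => [e|/eqP ij]; last by rewrite diff_shape // linear0 scaler0.
have H l : l = j -> phi l b (diff X i l x) = phi j b (diff X i j x).
  by move=> ->.
rewrite /= /hom_diff_fun subrK eqxx H; last by rewrite e addrK.
rewrite linearZ /= !scalerBr !scalerA -!signD.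
have -> : i + i * (a - 1) = i * a by rewrite mulrBr mulr1 addrC subrK.
rewrite subKr; congr (_ *: _).
by rewrite e mulrDl mul1r -addrA [sign (_ + (_ + _))]signD [sign (a + a)]signD sign_sqr mulr1.
Qed.

Definition bidual : chain_map X (Hom (Hom X K) K) :=
  @ChainMap R X (Hom (Hom X K) K) (fun i => lin_of (@bidual_elt_linear i))
    bidual_diff.
End Biduality.

Section Precomposition.
Variables (X X' Y : complex R) (f : chain_map X X').

Lemma hom_pre_shape n (phi : hom X' Y n) i j (x : X i) :
  j != i + n -> (phi i j \o f i) x = 0.
Proof. by move=> ij; rewrite /= hom_shape. Qed.

Definition hom_pre_elt n (phi : hom X' Y n) : hom X Y n :=
  @HomElt X Y n (fun i j => phi i j \o f i : {linear _ -> _})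
    (@hom_pre_shape n phi).

Lemma hom_pre_linear n : linear (@hom_pre_elt n).
Proof. by move=> a phi psi; apply: hom_ext. Qed.

Lemma hom_pre_diff n m (phi : Hom X' Y n) :
  lin_of (@hom_pre_linear m) (diff (Hom X' Y) n m phi) =
  diff (Hom X Y) n m (lin_of (@hom_pre_linear n) phi).
Proof.
by apply: hom_ext => i j x /=; rewrite /hom_diff_fun; case: ifP => //= _;
  rewrite cmap_diff.
Qed.

Definition hom_pre : chain_map (Hom X' Y) (Hom X Y) :=
  @ChainMap R (Hom X' Y) (Hom X Y) (fun n => lin_of (@hom_pre_linear n))
    hom_pre_diff.
End Precomposition.

(* r |-> r f, for a chain map f, as a chain map R -> Hom_R(X, Y). *)

Section ScalarMap.
Variables (X Y : complex R) (f : chain_map X Y).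

Definition scalar_fun (i : int) : stalk R^o i -> Hom X Y i :=
  match i return stalk R^o i -> Hom X Y i with
  | Posz 0 => fun r => (r : R) *: hom0 f
  | _ => fun=> 0
  end.

Lemma scalar_linear i : linear (@scalar_fun i).
Proof.
case: i => [[|n]|n] a x y /=; rewrite ?scaler0 ?addr0 //.
by rewrite scalerDl scalerA.
Qed.

Lemma scalar_diff i j (x : stalk R^o i) :
  lin_of (@scalar_linear j) (diff (stalk R^o) i j x) =
  diff (Hom X Y) i j (lin_of (@scalar_linear i) x).
Proof.
rewrite [LHS]linear0; case: i x => [[|n]|n] x; rewrite [lin_of _ _]/=.
- by rewrite linearZ /= [X in _ *: X]hom0_cycle scaler0.
- by rewrite linear0.
- by rewrite linear0.
Qed.

Definition scalar_map : chain_map (stalk R^o) (Hom X Y) :=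
  @ChainMap R (stalk R^o) (Hom X Y) (fun i => lin_of (@scalar_linear i))
    scalar_diff.
End ScalarMap.

(* Homology. The module H_i(X) is cycles modulo boundaries. *)

Definition cycle X i (x : X i) : Prop := diff X i (i - 1) x = 0.

Definition boundary X i (x : X i) : Prop :=
  exists y : X (i + 1), diff X (i + 1) i y = x.

Definition quasi_iso X Y (f : chain_map X Y) : Prop :=
  forall i,
    (forall x : X i, cycle x -> boundary (f i x) -> boundary x) /\
    (forall y : Y i, cycle y -> exists x : X i, cycle x /\ boundary (f i x - y)).

Definition acyclic X : Prop := forall i (x : X i), cycle x -> boundary x.

Definition hbounded X : Prop :=
  exists N : nat, forall i (x : X i), (N < `|i|)%N -> cycle x -> boundary x.

(* A representative of an element of the direct sum of all H_i(X). *)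
Definition total_cycle X (x : forall i, X i) : Prop :=
  (forall i, cycle (x i)) /\
  exists N : nat, forall i, (N < `|i|)%N -> x i = 0.

(* The total homology H(X) is a finitely generated R-module. *)
Definition hfinite X : Prop :=
  exists (n : nat) (z : 'I_n -> forall i, X i),
    (forall s, total_cycle (z s)) /\
    forall x, total_cycle x ->
      exists c : 'I_n -> R, forall i, boundary (x i - \sum_(s < n) c s *: z s i).

(* The derived category. Objects are isomorphic in D(R) when they are joined by
   a zigzag of quasi-isomorphisms; a morphism of D(R) represented by a chain map
   is an isomorphism when that chain map is a quasi-isomorphism. *)

Definition D_iso : complex R -> complex R -> Prop :=
  clos_refl_sym_trans (complex R)
    (fun X Y => exists f : chain_map X Y, quasi_iso f).

Definition shift_iso X Y : Prop := exists n : int, D_iso X (shift Y n).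

(* K-projective complexes in the sense of Spaltenstein; here the letter K is
   unrelated to semidualizing complexes. *)
Definition K_projective P : Prop :=
  forall N, acyclic N -> acyclic (Hom P N).

Definition is_resolution X (r : {P : complex R & chain_map P X}) : Prop :=
  K_projective (projT1 r) /\ quasi_iso (projT2 r).

(* Every complex has a K-projective resolution, so that the default value is
   never used; it makes the definition independent of that theorem. *)
Definition resolution X : {P : complex R & chain_map P X} :=
  if pselect (exists r, @is_resolution X r) is left h then projT1 (cid h)
  else existT _ X (id_map X).

Definition res_obj X : complex R := projT1 (resolution X).
Definition res_map X : chain_map (res_obj X) X := projT2 (resolution X).

Definition RHom X Y : complex R := Hom (res_obj X) Y.

(* Under the quasi-isomorphism Hom(P, P) -> Hom(P, K), with P the resolution
   of K, the homothety r |-> r id_P corresponds to r |-> r (res_map K). *)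
Definition homothety K : chain_map (stalk R^o) (RHom K K) :=
  scalar_map (res_map K).

(* The natural morphism X -> RHom(RHom(X, K), K) is the fraction of this chain
   map by the quasi-isomorphism res_map X. *)
Definition biduality X K : chain_map (res_obj X) (RHom (RHom X K) K) :=
  comp_map (hom_pre K (res_map (RHom X K))) (bidual (res_obj X) K).

Definition semidualizing K : Prop := hfinite K /\ quasi_iso (homothety K).

Definition reflexive K X : Prop :=
  [/\ hfinite X, hbounded (RHom X K) & quasi_iso (biduality X K)].

Definition shift_class K : complex R -> Prop := fun X => shift_iso X K.
End Construction.

Definition SD (R : comUnitRingType) : Type :=
  {C : complex R -> Prop | exists2 K, semidualizing K & C = shift_class K}.

Definition SD_repr (R : comUnitRingType) (C : SD R) : complex R :=
  s2val (cid2 (svalP C)).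

(* The relation [K] <| [L]; it does not depend on the representatives. *)
Definition SD_le (R : comUnitRingType) (C D : SD R) : Prop :=
  reflexive (SD_repr C) (SD_repr D).

(* The field k as an R-module *)

Definition residue_module (R : comUnitRingType) (k : fieldType)
  (pi : {rmorphism R -> k}) : Type := k.

Section ResidueModule.
Variables (R : comUnitRingType) (k : fieldType) (pi : {rmorphism R -> k}).

HB.instance Definition _ :=
  GRing.Zmodule.copy (residue_module pi) k.

Definition residue_scale (r : R) (x : residue_module pi) : residue_module pi :=
  (pi r * (x : k) : k).

Lemma residue_scaleA a b x :
  residue_scale a (residue_scale b x) = residue_scale (a * b) x.
Proof. by rewrite /residue_scale rmorphM mulrA. Qed.
Lemma residue_scale1 : left_id 1 residue_scale.
Proof. by move=> x; rewrite /residue_scale rmorph1 mul1r. Qed.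
Lemma residue_scaleDr : right_distributive residue_scale +%R.
Proof. by move=> a x y; apply: mulrDr. Qed.
Lemma residue_scaleDl x : {morph residue_scale^~ x : a b / a + b}.
Proof. by move=> a b; rewrite /residue_scale rmorphD; apply: mulrDl. Qed.

HB.instance Definition _ := GRing.Zmodule_isLmodule.Build R (residue_module pi)
  residue_scaleA residue_scale1 residue_scaleDr residue_scaleDl.
End ResidueModule.

Section Distance.
Variables (RR : realType) (R : comUnitRingType) (k : fieldType).
Variable pi : {rmorphism R -> k}.

(* [v] represents a k-basis of H_i(X), for an H_i(X) killed by the maximal
   ideal; scalars of k are lifted to R along [pi]. *)
Definition homology_basis (X : complex R) i n (v : 'I_n -> X i) : Prop :=
  [/\ forall s, cycle (v s),
      forall x, cycle x ->
        exists c : 'I_n -> R, boundary (x - \sum_(s < n) c s *: v s) &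
      forall c : 'I_n -> R,
        boundary (\sum_(s < n) c s *: v s) -> forall s, pi (c s) = 0].

Definition homology_rank (X : complex R) (i : int) : nat :=
  xget 0%N [set n | exists v : 'I_n -> X i, homology_basis v].

Definition betti (X : complex R) (i : int) : nat :=
  homology_rank (RHom X (stalk (residue_module pi))) (- i).

Definition curv (X : complex R) : \bar RR :=
  limn_esup (fun n : nat => ((betti X n%:Z)%:R `^ n%:R^-1)%:E).

Definition sigma (C D : SD R) : \bar RR := curv (RHom (SD_repr D) (SD_repr C)).

(* Only the entries [Kr 0, ..., Kr n] and [Lr 0, ..., Lr (n - 1)] matter. *)
Record route (A B : SD R) := Route {
  rlen : nat;
  Kr : nat -> SD R;
  Lr : nat -> SD R;
  route_pos : (0 < rlen)%N;
  route_start : Kr 0 = A;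
  route_end : Kr rlen = B;
  route_le : forall j, (j < rlen)%N ->
    SD_le (Kr j) (Lr j) /\ SD_le (Kr j.+1) (Lr j) }.

Definition route_length A B (g : route A B) : \bar RR :=
  (\sum_(j < rlen g)
    (sigma (Kr g j) (Lr g j) + sigma (Kr g j.+1) (Lr g j)))%E.

Definition dist (A B : SD R) : \bar RR :=
  ereal_inf [set l | exists g : route A B, route_length g = l].
End Distance.

(* In particular [d] takes finite values only. *)
Definition is_metric (RR : realType) (T : Type) (d : T -> T -> \bar RR) : Prop :=
  exists m : T -> T -> RR,
    (forall x y, d x y = (m x y)%:E) /\
    [/\ forall x y, 0 <= m x y,
        forall x y, m x y = 0 <-> x = y,
        forall x y, m x y = m y x &
        forall x y z, m x z <= m x y + m y z].

(* Main.v *)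
Require Import Defs.
From HB Require Import structures.
From mathcomp Require Import all_boot all_order all_algebra.
From mathcomp Require Import all_classical all_reals all_analysis.
From mathcomp Require Import zify ring.
From Stdlib Require Import Relation_Operators.
Import Defs.

Set Implicit Arguments.
Unset Strict Implicit.
Unset Printing Implicit Defensive.

Import Order.TTheory GRing.Theory Num.Theory.
Local Open Scope classical_set_scope.
Local Open Scope ring_scope.

(** The function [dist] is symmetric and satisfies the triangle inequality
    because routes can be reversed and concatenated, and it is nonnegative
    because curvatures are. What needs homological algebra is that it vanishes
    on the diagonal, that it is finite, and that it separates points. All three
    rest on minimal free resolutions by finite free modules
    ([minimal_resolution]), on the invariance of derived Hom under the choice
    of K-projective resolutions ([RHom_qiso]) and on the resulting
    identification of Betti numbers with ranks ([betti_minimal]).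

    Diagonal. A semidualizing complex K is reflexive with respect to itself
    ([semidualizing_reflexive]), and RHom(K, K) is the ring, whose positive
    Betti numbers are zero.

    Finiteness. Every pair of classes is joined by a route through the class of
    the ring, so that it suffices to bound the curvature of a semidualizing
    complex K ([rank_growth]). Take iterated cones of multiplications on K by
    generators of the maximal ideal. The result N has homology of finite length
    and is not acyclic, while RHom(K, N) is built from finitely many shifts of
    RHom(K, K), hence has no homology in sufficiently negative degrees. Let F be
    the minimal resolution of K, let t be the top degree of the homology of N
    and w a socle element of H_t(N). A row of coefficients on the basis of F_m
    gives a map from F_m to the line of w, which extends to a cycle of Hom(F, N)
    because F is minimal and N has no homology above t. For large m this cycle
    is a boundary, and a primitive of it is determined, up to what does not
    change the row, by elements of the homology of N indexed by the bases of the
    F_i with i < m. Counting generators bounds the rank of F_m by a constant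
    times the sum of the ranks of the F_i with i < m ([rank_bound]), so that
    these ranks grow at most exponentially.

    Separation. Let K and L be semidualizing, let L be reflexive with respect to
    K, and let the curvature of RHom(L, K) be less than one. Since Betti numbers
    are integers, those of RHom(L, K) vanish in high degrees, and its minimal
    resolution G is a bounded complex. Biduality gives L = RHom(G, K), hence
      R = RHom(L, L) = RHom(L, RHom(G, K)) = RHom(G, RHom(L, K)) = Hom(G, G).
    An elementary map from the top to the bottom degree of the minimal complex G
    is a cycle and not a boundary, so that the homology of Hom(G, G) lies in
    degree zero only if G lies in a single degree, and then it is cyclic only if
    G has rank one ([endo_sphere]). So G is a shift of R and L is a shift of K
    ([separation]).
    A route of length less than one consists of such pairs, hence is constant. *)

(** * Finitely generated modules *)

Section Generation.
Context {R : comUnitRingType}.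
Implicit Types V W : lmodType R.

Definition submodule V (S : V -> Prop) : Prop :=
  S 0 /\ forall a x y, S x -> S y -> S (a *: x + y).

Lemma submoduleD V (S : V -> Prop) x y :
  submodule S -> S x -> S y -> S (x + y).
Proof. by move=> [_ h] Sx Sy; rewrite -[x]scale1r; apply: h. Qed.

Lemma submoduleI V (S T : V -> Prop) :
  submodule S -> submodule T -> submodule (fun x => S x /\ T x).
Proof.
move=> [S0 SL] [T0 TL]; split=> // a x y [Sx Tx] [Sy Ty].
by split; [apply: SL|apply: TL].
Qed.

Lemma submoduleZ V (S : V -> Prop) a x : submodule S -> S x -> S (a *: x).
Proof. by move=> [S0 h] Sx; rewrite -[_ *: _]addr0; apply: h. Qed.

Lemma submoduleN V (S : V -> Prop) x : submodule S -> S x -> S (- x).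
Proof. by move=> h Sx; rewrite -scaleN1r; apply: submoduleZ. Qed.

Lemma submoduleB V (S : V -> Prop) x y :
  submodule S -> S x -> S y -> S (x - y).
Proof. by move=> h Sx Sy; apply: submoduleD => //; apply: submoduleN. Qed.

Lemma submodule_sum V (S : V -> Prop) (I : Type) (r : seq I) (F : I -> V) :
  submodule S -> (forall i, S (F i)) -> S (\sum_(i <- r) F i).
Proof.
by move=> h SF; apply: big_ind => //; [case: h | move=> x y; apply: submoduleD].
Qed.

Lemma submodule_comb V (S : V -> Prop) n (c : 'I_n -> R) (g : 'I_n -> V) :
  submodule S -> (forall s, S (g s)) -> S (\sum_s c s *: g s).
Proof. by move=> h Sg; apply: submodule_sum => // s; apply: submoduleZ. Qed.

(** [S] need not contain [U]: only the image of [S] modulo [U] matters. *)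
Definition ngen V (n : nat) (S U : V -> Prop) : Prop :=
  exists g : 'I_n -> V, (forall s, S (g s)) /\
    forall x, S x -> exists c : 'I_n -> R, U (x - \sum_s c s *: g s).

Definition fgmod V (S U : V -> Prop) : Prop := exists n, ngen n S U.

Lemma ngenS V n (S U : V -> Prop) : S 0 -> ngen n S U -> ngen n.+1 S U.
Proof.
move=> S0 [g [Sg gP]].
exists (fun s => if unlift ord0 s is Some t then g t else 0); split.
  by move=> s; case: unliftP => [t|] _.
move=> x /gP [c cP]; exists (fun s => if unlift ord0 s is Some t then c t else 0).
rewrite big_ord_recl unlift_none scaler0 add0r.
by under eq_bigr do rewrite liftK.
Qed.

Lemma ngen_le V n m (S U : V -> Prop) :
  S 0 -> (n <= m)%N -> ngen n S U -> ngen m S U.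
Proof.
move=> S0 /subnK <- h; elim: (m - n)%N => // d IH.
by rewrite addSn; apply: ngenS.
Qed.

(** Generators of the submodule together with lifts of generators of the quotient. *)
Lemma ngen_ext V n m (S T U : V -> Prop) : submodule S -> submodule T ->
  ngen n S T -> ngen m (fun x => S x /\ T x) U -> ngen (n + m) S U.
Proof.
move=> subS subT [g [Sg gP]] [h [STh hP]].
exists (fun s => match fintype.split s with inl i => g i | inr j => h j end); split.
  by move=> s; case: fintype.split => // j; case: (STh j).
move=> x Sx; have [c cP] := gP x Sx.
have [d dP] := hP (x - \sum_s c s *: g s)
  (conj (submoduleB subS Sx (submodule_comb c subS Sg)) cP).
exists (fun s => match fintype.split s with inl i => c i | inr j => d j end).
rewrite big_split_ord /= (eq_bigr (fun i => c i *: g i)) => [|i _]; last first.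
  by rewrite (unsplitK (inl i)).
rewrite opprD addrA (eq_bigr (fun i => d i *: h i)) // => i _.
by rewrite (unsplitK (inr i)).
Qed.

Lemma ngen_eq V n (S S' U U' : V -> Prop) :
  (forall x, S x <-> S' x) -> (forall x, U x -> U' x) ->
  ngen n S U -> ngen n S' U'.
Proof.
move=> SS UU [g [Sg gP]]; exists g; split=> [s|x /SS/gP [c cP]].
  exact/SS.
by exists c; apply: UU.
Qed.

(** Generation pulls back along a linear relation [phi] whose kernel lies in
    [U]; [phi] stands for a map defined up to choices of representatives. *)
Lemma ngen_rel V W (S U : V -> Prop) (T Z : W -> Prop)
    (phi : V -> W -> Prop) n :
  submodule S -> submodule T ->
  (forall a v v' w w', phi v w -> phi v' w' -> phi (a *: v + v') (a *: w + w')) ->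
  phi 0 0 ->
  (forall v, S v -> exists w, T w /\ phi v w) ->
  (forall v w, S v -> phi v w -> Z w -> U v) ->
  ngen n (fun w => T w /\ exists v, S v /\ phi v w) Z -> ngen n S U.
Proof.
move=> subS subT phiL phi0 ST ZU [g [gT gP]].
have /choice [v vP] s : exists v, S v /\ phi v (g s) by have [_] := gT s.
have phi_sum c : phi (\sum_s c s *: v s) (\sum_s c s *: g s).
  apply: (big_ind2 phi) => // [x x' y y' h h'|s _].
    by rewrite -[x]scale1r -[x']scale1r; apply: phiL.
  by rewrite -[c s *: v s]addr0 -[c s *: g s]addr0; apply: phiL => //; case: (vP s).
exists v; split=> [s|x Sx]; first by case: (vP s).
have [w [Tw xw]] := ST x Sx.
have [c cP] := gP w (conj Tw (ex_intro _ x (conj Sx xw))).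
exists c; apply: ZU cP.
  by apply: submoduleB => //; apply: submodule_comb => // s; case: (vP s).
by rewrite addrC [w - _]addrC -!scaleN1r; apply: phiL.
Qed.

Lemma ngen_chain V (h : nat -> nat) (S : nat -> V -> Prop) N :
  (forall i, submodule (S i)) -> (forall i x, S i.+1 x -> S i x) ->
  (forall i, (i < N)%N -> ngen (h i) (S i) (S i.+1)) ->
  ngen (\sum_(i < N) h i) (S 0) (S N).
Proof.
move=> subS decS step.
have dec i : forall x, S i x -> S 0 x.
  by elim: i => // i IH x /decS /IH.
elim: N step => [|N IH] step.
  rewrite big_ord0; exists (fun _ => 0); split=> [[]//|x Sx].
  by exists (fun _ => 0); rewrite big_ord0 subr0.
rewrite big_ord_recr /=; apply: (@ngen_ext _ _ _ _ (S N)) => //.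
  by apply: IH => i iN; apply: step; apply: ltnW.
apply: ngen_eq (step N _) => // x.
by split=> [Sx|[]//]; split=> //; apply: dec Sx.
Qed.

(** A substitute for length: it is additive along extensions, and finite for
    modules of finite length. *)
Definition bgen V (n : nat) (T U : V -> Prop) : Prop :=
  forall S, submodule S -> (forall x, S x -> T x) -> ngen n S U.

Lemma bgen_ext V n m (T T' U : V -> Prop) : submodule T' ->
  bgen n T T' -> bgen m T' U -> bgen (n + m) T U.
Proof.
move=> subT' h h' S subS ST; apply: (ngen_ext subS subT'); first exact: h.
apply: h'; last by move=> x [].
exact: submoduleI.
Qed.

Definition gspan V n (g : 'I_n -> V) (U : V -> Prop) (x : V) : Prop :=
  exists c : 'I_n -> R, U (x - \sum_s c s *: g s).

Lemma gspan_submodule V n (g : 'I_n -> V) U : submodule U -> submodule (gspan g U).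
Proof.
move=> subU; split=> [|a x y [c cP] [d dP]].
  by exists (fun=> 0); rewrite big1 ?subr0 => [|s _]; rewrite ?scale0r //; case: subU.
exists (fun s => a * c s + d s).
have -> : \sum_s (a * c s + d s) *: g s
        = a *: \sum_s c s *: g s + \sum_s d s *: g s.
  rewrite scaler_sumr -big_split /=; apply: eq_bigr => s _.
  by rewrite scalerDl scalerA.
by rewrite opprD addrACA -scalerBr; apply: subU.2.
Qed.

Section Noetherian.
Hypothesis R_noetherian : noetherian R.

(** The coefficients of the elements of [S] on the generator form an ideal;
    elements of [S] that realize generators of this ideal generate [S]. *)
Lemma fgmod_cyclic V (g : 'I_1 -> V) (S U : V -> Prop) : submodule U ->
  submodule S -> (forall x, S x -> gspan g U x) -> fgmod S U.
Proof.
move=> subU subS SU.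
pose I a := exists x, S x /\ U (x - a *: g ord0).
have I0 : I 0.
  by exists 0; rewrite scale0r subr0; split; [case: subS|case: subU].
have ID a b : I a -> I b -> I (a + b).
  move=> [x [Sx xa]] [y [Sy yb]]; exists (x + y); split; first exact: submoduleD.
  by rewrite scalerDl opprD addrACA; apply: submoduleD.
have IM a b : I b -> I (a * b).
  move=> [x [Sx xa]]; exists (a *: x); split; first exact: submoduleZ.
  by rewrite -scalerA -scalerBr; apply: submoduleZ.
have [n [c cP]] := R_noetherian I0 ID IM; exists n.
have /choice [y yP] s : exists x, S x /\ U (x - c s *: g ord0).
  apply/(cP (c s)); exists (fun t => (t == s)%:R).
  by rewrite (bigD1 s) //= eqxx mul1r big1 ?addr0 // => t /negPf ->; rewrite mul0r.
exists y; split=> [s|x Sx]; first by case: (yP s).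
have [d] := SU x Sx; rewrite big_ord1 => dP.
have [e eP] : exists e : 'I_n -> R, d ord0 = \sum_s e s * c s.
  by apply/cP; exists x.
exists e.
have -> : x - \sum_s e s *: y s
  = (x - d ord0 *: g ord0) - \sum_s e s *: (y s - c s *: g ord0).
  have -> : \sum_s e s *: (y s - c s *: g ord0)
      = \sum_s e s *: y s - d ord0 *: g ord0.
    rewrite eP scaler_suml -sumrB; apply: eq_bigr => s _.
    by rewrite scalerBr scalerA.
  by rewrite opprB addrA subrK.
by apply: submoduleB => //; apply: submodule_comb => // s; case: (yP s).
Qed.

(** Induction on the number of generators: the span of the first one is cyclic,
    and the others generate modulo it. *)
Lemma fgmod_span V n (g : 'I_n -> V) (S U : V -> Prop) : submodule U ->
  submodule S -> (forall x, S x -> gspan g U x) -> fgmod S U.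
Proof.
elim: n g S U => [|n IH] g S U subU subS SU.
  exists 0; exists (fun _ => 0); split=> [[]//|x /SU [c]].
  by rewrite big_ord0 => Ux; exists c; rewrite big_ord0.
pose g0 (_ : 'I_1) := g ord0.
pose T := gspan g0 U.
have subT : submodule T by apply: gspan_submodule.
have [p pP] : fgmod S T.
  apply: (IH (fun s => g (lift ord0 s))) => // x /SU [c cP].
  exists (fun s => c (lift ord0 s)), (fun _ => c ord0).
  by rewrite big_ord1 -addrA -opprD [X in _ - X]addrC; rewrite big_ord_recl in cP.
have [q qP] : fgmod (fun x => S x /\ T x) U.
  apply: (@fgmod_cyclic _ g0) => // [|x []//].
  exact: submoduleI.
by exists (p + q)%N; apply: ngen_ext pP qP.
Qed.

Lemma fgmod_sub V (S T U : V -> Prop) : submodule U -> submodule S ->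
  (forall x, S x -> T x) -> fgmod T U -> fgmod S U.
Proof.
move=> subU subS ST [n [g [_ gP]]].
by apply: (fgmod_span (g := g)) => // x /ST /gP.
Qed.

End Noetherian.

(** In a generating family of least size, a relation with a unit coefficient
    would allow one generator to be dropped. *)
Lemma fgmod_minimal V (S U : V -> Prop) : submodule U -> fgmod S U ->
  exists n (g : 'I_n -> V),
    [/\ forall s, S (g s),
        forall x, S x -> exists c : 'I_n -> R, U (x - \sum_s c s *: g s) &
        forall c : 'I_n -> R, U (\sum_s c s *: g s) ->
          forall s, c s \isn't a GRing.unit].
Proof.
move=> subU fg.
have ex : exists n, `[< ngen n S U >] by case: fg => n h; exists n; apply/asboolP.
have [n /asboolP [g [Sg gP]] min] := ex_minnP ex.
exists n, g; split=> // c cU s; apply/negP => us.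
case: n g Sg gP min c cU s us => [|n] g Sg gP min c cU s us; first by case: s us.
have : ngen n S U; last first.
  by move=> /asboolP /min; rewrite ltnn.
exists (fun t => g (lift s t)); split=> // x Sx; have [d dP] := gP x Sx.
pose r := d s / c s.
exists (fun t => d (lift s t) - r * c (lift s t)).
have -> : x - \sum_t (d (lift s t) - r * c (lift s t)) *: g (lift s t)
  = (x - \sum_t d t *: g t) + r *: \sum_t c t *: g t.
  rewrite (bigD1_ord s) //= [in RHS](bigD1_ord s) //= scalerDr scalerA divrK //.
  set A := d s *: g s; set B := \sum_t d _ *: _; set C := r *: _.
  rewrite [A + B]addrC opprD !addrA subrK.
  have -> : \sum_t (d (lift s t) - r * c (lift s t)) *: g (lift s t) = B - C.
    rewrite /C scaler_sumr -sumrB; apply: eq_bigr => t _.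
    by rewrite scalerBl scalerA.
  by rewrite opprB [C - B]addrC addrA.
by apply: submoduleD => //; apply: submoduleZ.
Qed.

End Generation.

(** * Homology of complexes *)

Section Homology.
Context {R : comUnitRingType}.
Implicit Types X Y Z : complex R.

Lemma signN (n : int) : sign (- n) = sign n :> R.
Proof.
by rewrite -[LHS]mulr1 -(sign_sqr n) mulrA -signD addNr /sign expr0z mul1r.
Qed.

Lemma stalk_eq0 (M : lmodType R) i (x : stalk M i) : i != 0 -> x = 0.
Proof. by case: i x => [[|i]|i] // x _; apply/rowP => -[]. Qed.

(** With all target degrees allowed, degrees such as [i + 1 - 1] and [i] need
    not be identified. *)
Lemma cycleP X i (x : X i) : cycle x <-> forall j, diff X i j x = 0.
Proof.
split=> [cx j|]; last exact.
have [e|] := eqVneq i (j + 1); last exact: diff_shape.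
by have <- : i - 1 = j by rewrite e addrK.
Qed.

Lemma boundaryP X i (x : X i) :
  boundary x <-> exists j (y : X j), diff X j i y = x.
Proof.
split=> [[y]|[j [y yx]]]; first by exists (i + 1), y.
have [e|ne] := eqVneq j (i + 1); first by subst j; exists y.
by exists 0; rewrite linear0 -yx diff_shape.
Qed.

Lemma cycle_submodule X i : submodule (@cycle R X i).
Proof.
split=> [|a x y]; first exact: linear0.
by rewrite /cycle linearP => -> ->; rewrite scaler0 addr0.
Qed.

Lemma boundary_submodule X i : submodule (@boundary R X i).
Proof.
split=> [|a x y [x' <-] [y' <-]]; first by exists 0; apply: linear0.
by exists (a *: x' + y'); rewrite linearP.
Qed.

Lemma boundary0 X i : boundary (0 : X i).
Proof. by have [] := @boundary_submodule X i. Qed.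

Lemma boundary_cycle X i (x : X i) : boundary x -> cycle x.
Proof. by move=> [y <-]; apply: diff_diff. Qed.

Lemma boundary_diff X i j (x : X i) : boundary (diff X i j x).
Proof. by apply/boundaryP; exists i, x. Qed.

Lemma cycle_diff X i j (x : X i) : cycle (diff X i j x).
Proof. exact: diff_diff. Qed.

Lemma boundaryD X i (x y : X i) : boundary x -> boundary y -> boundary (x + y).
Proof. by apply: submoduleD; apply: boundary_submodule. Qed.

Lemma boundaryN X i (x : X i) : boundary x -> boundary (- x).
Proof. by apply: submoduleN; apply: boundary_submodule. Qed.

Lemma boundaryB X i (x y : X i) : boundary x -> boundary y -> boundary (x - y).
Proof. by apply: submoduleB; apply: boundary_submodule. Qed.

Lemma boundaryBC X i (x y : X i) : boundary (x - y) -> boundary (y - x).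
Proof. by move=> /boundaryN; rewrite opprB. Qed.

Lemma boundary_trans X i (x y z : X i) :
  boundary (x - y) -> boundary (y - z) -> boundary (x - z).
Proof. by move=> h /(boundaryD h); rewrite addrA subrK. Qed.

Lemma boundary_eq X i (x y : X i) : boundary (x - y) -> boundary y -> boundary x.
Proof. by move=> h /(boundaryD h); rewrite subrK. Qed.

Lemma cycleB X i (x y : X i) : cycle x -> cycle y -> cycle (x - y).
Proof. by apply: submoduleB; apply: cycle_submodule. Qed.

Lemma cmap_cycle X Y (f : chain_map X Y) i (x : X i) : cycle x -> cycle (f i x).
Proof. by rewrite /cycle -cmap_diff => ->; rewrite linear0. Qed.

Lemma cmap_boundary X Y (f : chain_map X Y) i (x : X i) :
  boundary x -> boundary (f i x).
Proof. by move=> [y <-]; rewrite cmap_diff; apply: boundary_diff. Qed.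

Definition hvan X i : Prop := forall x : X i, cycle x -> boundary x.

Definition hfg X i : Prop := fgmod (@cycle R X i) (@boundary R X i).

(** The two degrees are unrelated, so that shifts and evaluation maps need no
    transport along equalities of integers. *)
Definition hisoat X Y i j (f : {linear X i -> Y j}) : Prop :=
  [/\ forall x, cycle x -> cycle (f x),
      forall x, boundary x -> boundary (f x),
      forall x, cycle x -> boundary (f x) -> boundary x &
      forall y, cycle y -> exists x, cycle x /\ boundary (f x - y)].

Lemma quasi_isoP X Y (f : chain_map X Y) :
  quasi_iso f <-> forall i, hisoat (f i).
Proof.
split=> h i; last by case: (h i).
by split; [exact: cmap_cycle|exact: cmap_boundary|case: (h i)..].
Qed.

Lemma hisoat_comp X Y Z i j l (f : {linear X i -> Y j}) (g : {linear Y j -> Z l}) :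
  hisoat f -> hisoat g -> hisoat (g \o f : {linear _ -> _}).
Proof.
move=> [fc fb fi fs] [gc gb gi gs]; split=> /=.
- by move=> x /fc /gc.
- by move=> x /fb /gb.
- by move=> x cx /gi /(fi _ cx); apply; apply: fc.
- move=> z /gs [y [cy yz]]; have [x [cx xy]] := fs y cy; exists x; split=> //.
  by apply: boundary_trans yz; rewrite -linearB; apply: gb.
Qed.

Lemma hisoat_cancel_l X Y Z i j l (f : {linear X i -> Y j})
    (g : {linear Y j -> Z l}) :
  (forall y, cycle y -> cycle (g y)) -> (forall y, boundary y -> boundary (g y)) ->
  hisoat f -> hisoat (g \o f : {linear _ -> _}) -> hisoat g.
Proof.
move=> gc gb [fc fb fi fs] [_ _ hi hs]; split=> //.
- move=> y cy by_; have [x [cx xy]] := fs y cy.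
  apply: (boundary_eq (boundaryBC xy)); apply: fb; apply: hi => //=.
  by apply: boundary_eq by_; rewrite -linearB; apply: gb.
- move=> z /hs [x [cx xz]]; exists (f x); split=> //; exact: fc.
Qed.

Lemma hisoat_cancel_r X Y Z i j l (f : {linear X i -> Y j})
    (g : {linear Y j -> Z l}) :
  (forall y, cycle y -> cycle (f y)) -> (forall y, boundary y -> boundary (f y)) ->
  hisoat g -> hisoat (g \o f : {linear _ -> _}) -> hisoat f.
Proof.
move=> fc fb [gc gb gi gs] [_ _ hi hs]; split=> //.
- by move=> x cx bx; apply: hi => //=; apply: gb.
- move=> y cy; have [x [cx xz]] := hs (g y) (gc _ cy); exists x; split=> //.
  apply: gi; last by rewrite linearB.
  by apply: cycleB => //; apply: fc.
Qed.

Lemma hisoat_eq X Y i j (f g : {linear X i -> Y j}) :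
  (forall x, cycle x -> boundary (f x - g x)) ->
  (forall x, cycle x -> cycle (g x)) -> hisoat f -> hisoat g.
Proof.
move=> fg gc [fc fb fi fs]; split=> //.
- move=> x bx; apply: (boundary_eq (boundaryBC (fg _ (boundary_cycle bx)))).
  exact: fb.
- by move=> x cx bx; apply: fi => //; apply: boundary_eq (fg _ cx) bx.
- move=> y /fs [x [cx xy]]; exists x; split=> //.
  exact: boundary_trans (boundaryBC (fg _ cx)) xy.
Qed.

Lemma hisoat_van X Y i j (f : {linear X i -> Y j}) :
  hisoat f -> hvan X i <-> hvan Y j.
Proof.
move=> [fc fb fi fs]; split=> van; last by move=> x cx; apply: fi => //; apply/van/fc.
move=> y /fs [x [cx xy]]; apply: boundary_eq (boundaryBC xy) _.
exact/fb/van.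
Qed.

Lemma hisoat_ngen X Y i j (f : {linear X i -> Y j}) n : hisoat f ->
  ngen n (@cycle R X i) (@boundary R X i) <->
  ngen n (@cycle R Y j) (@boundary R Y j).
Proof.
move=> [fc fb fi fs]; split=> [[g [gc gP]]|[g [gc gP]]].
  exists (f \o g); split=> [s|y /fs [x [/gP [c cP] xy]]]; first exact/fc.
  exists c; rewrite /=; under eq_bigr do rewrite -linearZ.
  rewrite -linear_sum; apply: boundary_trans (boundaryBC xy) _.
  by rewrite -linearB; apply: fb.
have /choice [h hP] s := fs _ (gc s).
exists h; split=> [s|x cx]; first by case: (hP s).
have [c cP] := gP _ (fc _ cx); exists c; apply: fi.
  apply: cycleB => //; apply: submodule_comb; first exact: cycle_submodule.
  by move=> s; case: (hP s).
rewrite linearB linear_sum; apply: boundary_trans cP _; rewrite -sumrB.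
apply: submodule_sum => [|s]; first exact: boundary_submodule.
rewrite linearZ -scalerBr; apply: submoduleZ; first exact: boundary_submodule.
by apply: boundaryBC; case: (hP s).
Qed.

Lemma hisoat_fg X Y i j (f : {linear X i -> Y j}) :
  hisoat f -> hfg X i <-> hfg Y j.
Proof. by move=> h; split=> -[n /(hisoat_ngen n h)]; exists n. Qed.

Lemma hisoat_sign X Y i j (f g : {linear X i -> Y j}) (m : int) :
  (forall x, g x = sign m *: f x) -> hisoat f -> hisoat g.
Proof.
move=> gE [fc fb fi fs].
have zc (x : Y j) : cycle x -> cycle (sign m *: x).
  by apply: submoduleZ; apply: cycle_submodule.
have zb (x : Y j) : boundary x -> boundary (sign m *: x).
  by apply: submoduleZ; apply: boundary_submodule.
split=> [x cx|x bx|x cx|y cy]; rewrite ?gE.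
- exact/zc/fc.
- exact/zb/fb.
- by move=> /zb; rewrite scalerA sign_sqr scale1r; apply: fi.
have [x [cx xy]] := fs _ (zc _ cy); exists x; split=> //.
by rewrite gE -[y]scale1r -(sign_sqr m) -scalerA -scalerBr; apply: zb.
Qed.

Lemma qiso_comp X Y Z (g : chain_map Y Z) (f : chain_map X Y) :
  quasi_iso f -> quasi_iso g -> quasi_iso (comp_map g f).
Proof.
move=> /quasi_isoP hf /quasi_isoP hg; apply/quasi_isoP => i.
exact: hisoat_comp.
Qed.

Lemma qiso_cancel_l X Y Z (g : chain_map Y Z) (f : chain_map X Y) :
  quasi_iso f -> quasi_iso (comp_map g f) -> quasi_iso g.
Proof.
move=> /quasi_isoP hf /quasi_isoP hg; apply/quasi_isoP => i.
apply: hisoat_cancel_l (hf i) (hg i); [exact: cmap_cycle|exact: cmap_boundary].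
Qed.

Lemma qiso_cancel_r X Y Z (g : chain_map Y Z) (f : chain_map X Y) :
  quasi_iso g -> quasi_iso (comp_map g f) -> quasi_iso f.
Proof.
move=> /quasi_isoP hf /quasi_isoP hg; apply/quasi_isoP => i.
apply: hisoat_cancel_r (hf i) (hg i); [exact: cmap_cycle|exact: cmap_boundary].
Qed.

Lemma qiso_heq X Y (f g : chain_map X Y) :
  (forall i (x : X i), cycle x -> boundary (f i x - g i x)) ->
  quasi_iso f -> quasi_iso g.
Proof.
move=> h /quasi_isoP hf; apply/quasi_isoP => i; apply: hisoat_eq (hf i) => x.
  exact: h.
exact: cmap_cycle.
Qed.

Lemma id_qiso X : quasi_iso (id_map X).
Proof.
move=> i; split=> // y cy; exists y; split=> //=.
by rewrite subrr; apply: boundary0.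
Qed.

Lemma bij_qiso X Y (f : chain_map X Y) :
  (forall i (x : X i), f i x = 0 -> x = 0) ->
  (forall i (y : Y i), exists x, f i x = y) -> quasi_iso f.
Proof.
move=> inj surj i; split=> [x cx [y yx]|y cy].
  have [z zy] := surj _ y; exists z; apply/eqP; rewrite -subr_eq0; apply/eqP.
  by apply: inj; rewrite linearB cmap_diff zy yx subrr.
have [x xy] := surj _ y; exists x; split; last by rewrite xy subrr; apply: boundary0.
by apply: inj; rewrite cmap_diff xy.
Qed.

(** Transport between equal degrees. It is locked so that simplification does
    not expose the underlying cast. *)
Definition tr X i j : {linear X i -> X j} :=
  locked (hom0 (id_map X) i j : {linear X i -> X j}).

Lemma hom0_id X Y (f : chain_map X Y) i (x : X i) : hom0 f i i x = f i x.
Proof.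
by rewrite /hom0 /= /hom0_fun; case: eqP => // e; rewrite (eq_axiomK e).
Qed.

Lemma hom0_ne X Y (f : chain_map X Y) i j (x : X i) : j != i -> hom0 f i j x = 0.
Proof. by move=> ij; rewrite hom_shape // addr0. Qed.

Lemma tr_id X i (x : X i) : tr X i i x = x.
Proof. by rewrite /tr -lock hom0_id. Qed.

Lemma tr_ne X i j (x : X i) : i != j -> tr X i j x = 0.
Proof. by move=> ij; rewrite /tr -lock hom0_ne // eq_sym. Qed.

Lemma tr_inj X i j (x : X i) : i = j -> tr X i j x = 0 -> x = 0.
Proof. by move=> e; subst j; rewrite tr_id. Qed.

Lemma hom0_tr X Y (f : chain_map X Y) i j (x : X i) :
  hom0 f i j x = tr Y i j (f i x).
Proof.
have [e|ne] := eqVneq i j; first by subst j; rewrite hom0_id tr_id.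
by rewrite tr_ne // hom0_ne // eq_sym.
Qed.

Lemma tr_cmap X Y (f : chain_map X Y) i j (x : X i) :
  tr Y i j (f i x) = f j (tr X i j x).
Proof.
have [e|ne] := eqVneq i j; first by subst j; rewrite !tr_id.
by rewrite !tr_ne // linear0.
Qed.

Lemma tr_tr X i j l (x : X i) : i = j -> tr X j l (tr X i j x) = tr X i l x.
Proof. by move=> e; subst j; rewrite tr_id. Qed.

Lemma tr_diff X i j l (x : X i) : j = l -> tr X j l (diff X i j x) = diff X i l x.
Proof. by move=> e; subst l; rewrite tr_id. Qed.

Lemma diff_tr X i j l (x : X i) : i = j -> diff X j l (tr X i j x) = diff X i l x.
Proof. by move=> e; subst j; rewrite tr_id. Qed.

Lemma tr_cycle X i j (x : X i) : cycle x -> cycle (tr X i j x).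
Proof.
have [e|ne] := eqVneq i j; first by subst j; rewrite tr_id.
by rewrite tr_ne // => _; apply: linear0.
Qed.

Lemma tr_hisoat X i j : i = j -> hisoat (tr X i j).
Proof.
move=> e; subst j; split=> x; rewrite ?tr_id //.
by exists x; split=> //; rewrite tr_id subrr; apply: boundary0.
Qed.

Section HomAt.
Variables (X Y : complex R) (n i0 j0 : int) (e : j0 = i0 + n).
Variable f : {linear X i0 -> Y j0}.

Lemma homat_shape i j (x : X i) : j != i + n ->
  (tr Y j0 j \o f \o tr X i i0) x = 0.
Proof.
move=> ij; have [ii|ne] := eqVneq i i0; last by rewrite /comp [tr X _ _ _]tr_ne // !linear0.
by rewrite /comp tr_ne // e -ii eq_sym.
Qed.

Definition homat : hom X Y n := HomElt homat_shape.

Lemma homatE i j (x : X i) : homat i j x = tr Y j0 j (f (tr X i i0 x)).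
Proof. by []. Qed.

Lemma homat_id x : homat i0 j0 x = f x.
Proof. by rewrite homatE !tr_id. Qed.

Lemma homat_ne i j (x : X i) : i != i0 -> homat i j x = 0.
Proof. by move=> ij; rewrite homatE [tr X _ _ _]tr_ne // !linear0. Qed.
End HomAt.

(** The map from the shifted ring that sends the unit to [z] is a
    quasi-isomorphism; this is expressed without a choice of such a map. *)
Definition hgen X (a : int) (z : X a) : Prop :=
  [/\ cycle z, forall i, i != a -> hvan X i,
      forall r : R, boundary (r *: z) -> r = 0 &
      forall x : X a, cycle x -> exists r : R, boundary (r *: z - x)].

Lemma hgen_eq X a (z z' : X a) : boundary (z - z') -> cycle z' -> hgen z -> hgen z'.
Proof.
move=> zz cz' [cz van free gen]; split=> // [r rz|x /gen [r rx]].
  apply: free; apply: boundary_eq rz; rewrite -scalerBr.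
  by apply: submoduleZ => //; apply: boundary_submodule.
exists r; apply: boundary_trans rx; rewrite -scalerBr.
by apply: submoduleZ; [apply: boundary_submodule|apply: boundaryBC].
Qed.

Lemma hgen_hisoat X Y a b (f : {linear X a -> Y b}) (z : X a) :
  (forall i, i != a -> hvan X i <-> hvan Y (i - a + b)) ->
  hisoat f -> cycle z -> hgen z <-> hgen (f z).
Proof.
move=> vanXY hf cz; have [fc fb fi fs] := hf; split=> -[_ van free gen].
  split=> [|j jb|r rz|y /fs [x [cx xy]]]; first exact: fc.
  - have -> : j = j - b + a - a + b by rewrite addrK subrK.
    have ne : j - b + a != a by apply: contraNneq jb => h; apply/eqP; lia.
    exact/vanXY/van.
  - apply: free; apply: fi; last by rewrite linearZ.
    by apply: submoduleZ => //; apply: cycle_submodule.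
  - have [r rx] := gen x cx; exists r.
    by apply: boundary_trans xy; rewrite -linearZ -linearB; apply: fb.
split=> // [i ia|r rz|x cx].
- have /van : i - a + b != b by apply: contraNneq ia => h; apply/eqP; lia.
  by move/vanXY; apply.
- by apply: free; rewrite -linearZ; apply: fb.
- have [r rx] := gen _ (fc _ cx); exists r; apply: fi; last by rewrite linearB linearZ.
  by apply: cycleB => //; apply: submoduleZ => //; apply: cycle_submodule.
Qed.

Lemma hgen_qiso X Y (f : chain_map X Y) a (z : X a) : quasi_iso f -> cycle z ->
  hgen z <-> hgen (f a z).
Proof.
move=> /quasi_isoP hf cz; apply: hgen_hisoat => // i _.
by rewrite subrK; apply: hisoat_van (hf i).
Qed.

(** On homology the map sends a basis of a free module of rank one to a
    basis. *)
Lemma hgen_to_qiso X Y (f : chain_map X Y) a (z : X a) :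
  hgen z -> hgen (f a z) -> quasi_iso f.
Proof.
move=> [cz van free gen] [cz' van' free' gen'] i; have [ia|ia] := eqVneq i a.
  subst i; split=> [x cx bx|y /gen' [r ry]]; last first.
    exists (r *: z); split; last by rewrite linearZ.
    by apply: submoduleZ => //; apply: cycle_submodule.
  have [r rx] := gen x cx; suff r0 : r = 0.
    by have := boundaryN rx; rewrite r0 scale0r sub0r opprK.
  apply: free'; rewrite -linearZ; apply: boundary_eq bx; rewrite -linearB.
  exact: cmap_boundary.
split=> [x cx _|y cy]; first exact: van.
exists 0; split; first exact: linear0.
by rewrite linear0 sub0r; apply/boundaryN/van'.
Qed.

End Homology.

(** * Hom complexes, homotopies and mapping cones *)

Section HomFacts.
Context {R : comUnitRingType}.
Implicit Types X Y Z : complex R.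

Lemma Hom_diffE X Y n m (phi : Hom X Y n) i j (x : X i) : n = m + 1 ->
  (diff (Hom X Y) n m phi : hom X Y m) i j x =
  diff Y (j + 1) j (phi i (j + 1) x) - sign n *: phi (i - 1) j (diff X i (i - 1) x).
Proof. by move=> e; rewrite [LHS]/= /hom_diff_fun; case: eqP. Qed.

Lemma Hom_cycleP X Y n (phi : Hom X Y n) : cycle phi <->
  forall i j (x : X i), diff Y (j + 1) j (phi i (j + 1) x)
    = sign n *: phi (i - 1) j (diff X i (i - 1) x).
Proof.
split=> [c i j x|h].
  have : (diff (Hom X Y) n (n - 1) phi : hom X Y _) i j x = 0 by rewrite c.
  by rewrite Hom_diffE ?subrK // => /eqP; rewrite subr_eq0 => /eqP.
by apply: hom_ext => i j x; rewrite Hom_diffE ?subrK // h subrr.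
Qed.

Lemma Hom_ne X Y n (phi : hom X Y n) i j (x : X i) : j != i + n -> phi i j x = 0.
Proof. exact: hom_shape. Qed.

Definition homotopic X Y (f g : chain_map X Y) : Prop :=
  boundary (hom0 f - hom0 g : Hom X Y 0).

Lemma homotopic_heq X Y (f g : chain_map X Y) i (x : X i) :
  homotopic f g -> cycle x -> boundary (f i x - g i x).
Proof.
move=> [s ds] cx.
have : (diff (Hom X Y) (0 + 1) 0 s : hom X Y 0) i i x = f i x - g i x.
  by rewrite ds -!hom0_id.
rewrite Hom_diffE // cx linear0 scaler0 subr0 => <-; exact: boundary_diff.
Qed.

Lemma homotopic_sym X Y (f g : chain_map X Y) : homotopic f g -> homotopic g f.
Proof. exact: boundaryBC. Qed.

Lemma homotopic_qiso X Y (f g : chain_map X Y) :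
  homotopic f g -> quasi_iso f -> quasi_iso g.
Proof. by move=> h; apply: qiso_heq => i x; apply: homotopic_heq. Qed.

(** If [s] is a homotopy between [f] and [g], the composite of [phi] and [s] is,
    up to sign, a primitive of the difference. *)
Lemma hom_pre_homotopic X X' Y (f g : chain_map X X') n (phi : Hom X' Y n) :
  homotopic f g -> cycle phi ->
  boundary (hom_pre Y f n phi - hom_pre Y g n phi).
Proof.
move=> [s ds] /Hom_cycleP cphi.
have shape i j (x : X i) : j != i + (n + 1) ->
    (sign n \*: (phi (i + 1) j \o s i (i + 1))) x = 0.
  by move=> ij; rewrite /= Hom_ne ?scaler0 // -addrA [1 + n]addrC.
exists (HomElt shape); apply: hom_ext => i j x.
rewrite Hom_diffE //= linearZ /= cphi.
have -> : (phi (i + 1 - 1) j (diff X' (i + 1) (i + 1 - 1) (s i (i + 1) x)))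
        = phi i j (diff X' (i + 1) i (s i (i + 1) x)) by rewrite addrK.
have -> : phi (i - 1 + 1) j (s (i - 1) (i - 1 + 1) (diff X i (i - 1) x))
        = phi i j (s (i - 1) i (diff X i (i - 1) x)) by rewrite subrK.
have : (diff (Hom X X') (0 + 1) 0 s : hom X X' 0) i i x = f i x - g i x.
  by rewrite ds -!hom0_id.
rewrite Hom_diffE // [sign (0 + 1)]sign1 scaleN1r opprK => e.
rewrite !scalerA signD sign1 mulrN1 mulNr scaleNr opprK sign_sqr !scale1r.
by rewrite -linearD e linearB.
Qed.

Section Post.
Variables (X Y Z : complex R) (f : chain_map Y Z).

Lemma hom_post_shape n (phi : hom X Y n) i j (x : X i) :
  j != i + n -> (f j \o phi i j) x = 0.
Proof. by move=> ij; rewrite /= hom_shape // linear0. Qed.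

Definition hom_post_elt n (phi : hom X Y n) : hom X Z n :=
  @HomElt R X Z n (fun i j => f j \o phi i j : {linear _ -> _})
    (@hom_post_shape n phi).

Lemma hom_post_linear n : linear (@hom_post_elt n).
Proof. by move=> a phi psi; apply: hom_ext => i j x; rewrite /= linearP. Qed.

Lemma hom_post_diff n m (phi : Hom X Y n) :
  lin_of (@hom_post_linear m) (diff (Hom X Y) n m phi) =
  diff (Hom X Z) n m (lin_of (@hom_post_linear n) phi).
Proof.
apply: hom_ext => i j x /=; rewrite /hom_diff_fun; case: ifP => /= _.
  by rewrite linearB linearZ /= cmap_diff.
by rewrite linear0.
Qed.

Definition hom_post : chain_map (Hom X Y) (Hom X Z) :=
  @ChainMap R (Hom X Y) (Hom X Z) (fun n => lin_of (@hom_post_linear n))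
    hom_post_diff.
End Post.

Section ChainOf.
Variables (X Y : complex R) (h : Hom X Y 0) (ch : cycle h).

Lemma chain_of_diff i j (x : X i) :
  h j j (diff X i j x) = diff Y i j (h i i x).
Proof.
have [e|ne] := eqVneq i (j + 1); last by rewrite !diff_shape ?linear0.
subst i; have /Hom_cycleP /(_ (j + 1) j x) := ch.
by rewrite /sign expr0z scale1r addrK.
Qed.

Definition chain_of : chain_map X Y :=
  @ChainMap R X Y (fun i => h i i) chain_of_diff.

End ChainOf.

Lemma hom0_cycle' X Y (f : chain_map X Y) : cycle (hom0 f : Hom X Y 0).
Proof. exact: hom0_cycle. Qed.

Section Cone.
Variables (Y Z : complex R) (f : chain_map Y Z).

Definition cone_obj (i : int) : lmodType R := (Z i * Y (i - 1))%type.

Definition cone_fun i j (u : cone_obj i) : cone_obj j :=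
  (diff Z i j u.1 + tr Z (i - 1) j (f (i - 1) u.2),
   - diff Y (i - 1) (j - 1) u.2).

Lemma cone_linear i j : linear (@cone_fun i j).
Proof.
move=> a [z y] [z' y']; rewrite /cone_fun /=; congr pair => /=.
  by rewrite !linearP /= addrACA -scalerDr.
by rewrite linearP /= opprD scalerN.
Qed.

Lemma cone_shape i j (u : cone_obj i) : i != j + 1 ->
  lin_of (@cone_linear i j) u = 0.
Proof.
move=> ij; rewrite /= /cone_fun diff_shape // tr_ne; last first.
  by apply: contraNneq ij => <-; rewrite subrK.
rewrite diff_shape ?addr0 ?oppr0 //.
by apply: contraNneq ij => e; rewrite -(subrK 1 i) e !subrK.
Qed.

Lemma cone_diff i j l (u : cone_obj i) :
  lin_of (@cone_linear j l) (lin_of (@cone_linear i j) u) = 0.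
Proof.
rewrite /= /cone_fun /=; congr pair => /=; last by rewrite linearN diff_diff !oppr0.
rewrite linearD diff_diff add0r !linearN /=.
have [e|ne] := eqVneq i (j + 1).
  have e' : i - 1 = j by rewrite e addrK.
  rewrite diff_tr // cmap_diff.
  have [e2|ne2] := eqVneq (j - 1) l; first by rewrite tr_diff // subrr.
  rewrite tr_ne // subr0 diff_shape // e'.
  by apply: contraNneq ne2 => ->; rewrite addrK.
rewrite tr_ne ?linear0 ?sub0r; last by apply: contraNneq ne => <-; rewrite subrK.
rewrite diff_shape ?linear0 ?oppr0 //.
by apply: contraNneq ne => e; rewrite -(subrK 1 i) e subrK.
Qed.

Definition cone : complex R := Complex cone_shape cone_diff.

Lemma cone_diffE i j (z : Z i) (y : Y (i - 1)) :
  diff cone i j (z, y) =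
  (diff Z i j z + tr Z (i - 1) j (f (i - 1) y), - diff Y (i - 1) (j - 1) y).
Proof. by []. Qed.

Lemma cone_diffE1 i (z : Z i) (y : Y (i - 1)) :
  diff cone i (i - 1) (z, y) =
  (diff Z i (i - 1) z + f (i - 1) y, - diff Y (i - 1) (i - 1 - 1) y).
Proof. by rewrite cone_diffE tr_id. Qed.

Lemma cone_diffS i (z : Z (i + 1)) (y : Y i) :
  diff cone (i + 1) i (z, tr Y i (i + 1 - 1) y) =
  (diff Z (i + 1) i z + f i y, - diff Y i (i - 1) y).
Proof. by rewrite cone_diffE -tr_cmap tr_tr ?addrK // tr_id diff_tr ?addrK. Qed.

Lemma cone_cycleP i (z : Z i) (y : Y (i - 1)) :
  cycle ((z, y) : cone i) <-> cycle y /\ diff Z i (i - 1) z = - f (i - 1) y.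
Proof.
rewrite /cycle cone_diffE1; split=> [[e1 e2]|[cy e]].
  split; first by apply/eqP; rewrite -oppr_eq0 e2.
  by apply/eqP; rewrite -subr_eq0 opprK e1.
by rewrite e addNr cy oppr0.
Qed.

Lemma cone_inl_boundary i (z : Z i) : boundary z -> boundary ((z, 0) : cone i).
Proof.
move=> [z' <-]; exists (z', 0); rewrite cone_diffE.
by rewrite !linear0 addr0 ?oppr0.
Qed.

(** If [y'] is a primitive of the second component, subtracting the boundary
    of [(0, y')] leaves an element of the subcomplex [Z]. *)
Lemma cone_reduce i (u : cone i) : cycle u -> boundary u.2 ->
  exists z, cycle z /\ boundary (u - ((z, 0) : cone i)).
Proof.
case: u => z y /cone_cycleP [_ e] [y' yy'].
have yy : diff Y i (i - 1) (tr Y (i - 1 + 1) i y') = y by rewrite diff_tr ?subrK.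
set y0 := tr Y (i - 1 + 1) i y' in yy.
exists (z + f i y0); split; first by rewrite /cycle linearD -cmap_diff yy e addNr.
have -> : ((z, y) : cone i) - (z + f i y0, 0) = - ((f i y0, - y) : cone i).
  congr pair => /=; first by rewrite opprD addrA subrr sub0r.
  by rewrite subr0 opprK.
apply: boundaryN; exists (0, tr Y i (i + 1 - 1) y0).
by rewrite cone_diffS linear0 add0r yy.
Qed.

Lemma cone_van i : hvan Z i -> hvan Y (i - 1) -> hvan cone i.
Proof.
move=> vZ vY [z y] cu; have [cy _] := proj1 (cone_cycleP _ _) cu.
have [z' [cz' b]] := cone_reduce cu (vY _ cy).
exact: boundary_eq b (cone_inl_boundary (vZ _ cz')).
Qed.

Lemma cone_acyclic : quasi_iso f -> acyclic cone.
Proof.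
move=> hf i [z y] cu; have [cy e] := proj1 (cone_cycleP _ _) cu.
have by_ : boundary y.
  apply: (proj1 (hf _)) => //; rewrite -[f _ y]opprK -e; apply: boundaryN.
  exact: boundary_diff.
have [z' [cz' b]] := cone_reduce cu by_.
have [w [cw bw]] := proj2 (hf i) _ cz'; apply: boundary_eq b _.
have -> : ((z', 0) : cone i) = (f i w, 0) - (f i w - z', 0).
  by congr pair => /=; rewrite ?subKr ?subr0.
apply: boundaryB; last exact: cone_inl_boundary.
exists (0, tr Y i (i + 1 - 1) w).
by rewrite cone_diffS linear0 add0r [diff Y _ _ w]cw oppr0.
Qed.

Lemma acyclic_cone_qiso : acyclic cone -> quasi_iso f.
Proof.
move=> ac i; split=> [y cy [z zy]|z cz].
  have [_ _ inj _] := tr_hisoat Y (esym (addrK 1 i)).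
  apply: inj => //.
  have : cycle ((- z, tr Y i (i + 1 - 1) y) : cone (i + 1)).
    apply/cycleP => j; have [e|ne] := eqVneq (i + 1) (j + 1); last exact: diff_shape.
    move/addIr: e => e; subst j.
    by rewrite cone_diffS linearN zy addNr cy oppr0.
  move=> /ac [[z' y'] [_ <-]]; apply: boundaryN; exact: boundary_diff.
have : cycle ((z, 0) : cone i).
  by apply/cone_cycleP; rewrite cz linear0 oppr0; split=> //; apply: linear0.
move=> /ac [[z' y']]; rewrite cone_diffE => -[e1 e2].
have cy' : cycle y'.
  apply/cycleP => j; have [e|ne] := eqVneq j (i - 1); last first.
    by apply: diff_shape; apply: contraNneq ne => e; rewrite -[i](addrK 1) e addrK.
  by subst j; apply/eqP; rewrite -oppr_eq0 e2.
exists (tr Y (i + 1 - 1) i y'); split; first exact: tr_cycle.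
rewrite -tr_cmap -e1 opprD addrCA subrr addr0.
by apply: boundaryN; apply: boundary_diff.
Qed.
End Cone.

(** [Hom(X, -)] preserves cones, and no sign enters, because the lower degree
    of the second component compensates for its opposite differential. *)
Section HomCone.
Variables (X Y Z : complex R) (f : chain_map Y Z).
Let fX := hom_post X f.

Definition pair_fun n (u : cone fX n) i j (x : X i) : cone f j :=
  ((u.1 : hom X Z n) i j x, (u.2 : hom X Y (n - 1)) i (j - 1) x).

Lemma pair_linear n u i j : linear (@pair_fun n u i j).
Proof. by move=> a x y; rewrite /pair_fun !linearP. Qed.

Lemma pair_shape n u i j (x : X i) : j != i + n ->
  lin_of (@pair_linear n u i j) x = 0.
Proof.
move=> ij; rewrite /= /pair_fun !hom_shape // addrA.
by rewrite (inj_eq (addIr _)).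
Qed.

Definition pair_elt n (u : cone fX n) : hom X (cone f) n := HomElt (@pair_shape n u).

Lemma pair_elt_linear n : linear (@pair_elt n).
Proof. by move=> a u v; apply: hom_ext. Qed.

Lemma pair_elt_diff n m (u : cone fX n) :
  lin_of (@pair_elt_linear m) (diff (cone fX) n m u) =
  diff (Hom X (cone f)) n m (lin_of (@pair_elt_linear n) u).
Proof.
have [e|ne] := eqVneq n (m + 1); last by rewrite !diff_shape // linear0.
subst n; case: u => alpha beta; apply: hom_ext => i j x.
have trE p q (b : Hom X Z p) : p = q ->
    (tr (Hom X Z) p q b : hom X Z q) i j x = (b : hom X Z p) i j x.
  by move=> e; subst q; rewrite tr_id.
rewrite Hom_diffE //; congr pair.
  transitivity ((diff (Hom X Z) (m + 1) m alpha : hom X Z m) i j x +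
    (tr (Hom X Z) (m + 1 - 1) m (fX _ beta) : hom X Z m) i j x) => //.
  rewrite Hom_diffE // trE ?addrK //= /pair_fun /=.
  by rewrite (addrK 1 j) tr_id addrAC.
transitivity (- (diff (Hom X Y) (m + 1 - 1) (m - 1) beta : hom X Y (m - 1)) i (j - 1) x) => //.
rewrite Hom_diffE ?addrK ?subrK //= /pair_fun /=.
have -> : sign (m + 1 - 1) = sign m :> R by rewrite addrK.
rewrite (addrK 1 j) opprB signD sign1 mulrN1 scaleNr opprK.
by rewrite [LHS]addrC.
Qed.

Definition hom_cone : chain_map (cone fX) (Hom X (cone f)) :=
  @ChainMap R (cone fX) (Hom X (cone f)) (fun n => lin_of (@pair_elt_linear n))
    pair_elt_diff.

Lemma hom_cone_qiso : quasi_iso hom_cone.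
Proof.
apply: bij_qiso => n.
  case=> alpha beta e.
  have e' i j (x : X i) : (alpha : hom X Z n) i j x = 0 /\
      (beta : hom X Y (n - 1)) i (j - 1) x = 0.
    have : (hom_cone n (alpha, beta) : hom _ _ n) i j x = 0 by rewrite e.
    by case.
  congr pair; apply: hom_ext => i j x; first by case: (e' i j x).
  by rewrite -(addrK 1 j); case: (e' i (j + 1) x).
move=> psi.
have lin1 i j : linear (fun x : X i => (psi i j x).1).
  by move=> a x y; rewrite linearP.
have sh1 i j (x : X i) : j != i + n -> lin_of (lin1 i j) x = 0.
  by move=> ij; rewrite /= hom_shape.
have lin2 i j : linear (fun x : X i => tr Y (j + 1 - 1) j (psi i (j + 1) x).2).
  by move=> a x y; rewrite linearP /= linearP.
have sh2 i j (x : X i) : j != i + (n - 1) -> lin_of (lin2 i j) x = 0.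
  move=> ij; rewrite /= hom_shape ?linear0 //.
  by apply: contraNneq ij => e; rewrite addrA -e addrK.
exists (HomElt sh1, HomElt sh2); apply: hom_ext => i j x /=.
rewrite /pair_fun /= (subrK 1 j : j - 1 + 1 = j) tr_id.
by case: (psi i j x).
Qed.
End HomCone.

(** The cone of [f] is acyclic, so [Hom(X, cone f)], which is the cone of
    [Hom(X, f)], is acyclic too. *)
Lemma hom_post_qiso X Y Z (f : chain_map Y Z) :
  K_projective X -> quasi_iso f -> quasi_iso (hom_post X f).
Proof.
move=> pX qf; apply: acyclic_cone_qiso => i.
have /quasi_isoP h := hom_cone_qiso X f.
exact/(hisoat_van (h i))/(pX _ (cone_acyclic qf)).
Qed.

Lemma K_projective_lift P Y Z (f : chain_map Y Z) (g : chain_map P Z) :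
  K_projective P -> quasi_iso f -> exists h, homotopic (comp_map f h) g.
Proof.
move=> pP /(hom_post_qiso pP) qf.
have [phi [cphi b]] := proj2 (qf 0) _ (hom0_cycle' g).
exists (chain_of cphi); rewrite /homotopic.
suff -> : hom0 (comp_map f (chain_of cphi)) = hom_post P f 0 phi by [].
apply: hom_ext => i j x; have [e|ne] := eqVneq i j.
  by subst j; rewrite hom0_id /=.
by rewrite !Hom_ne // addr0 eq_sym.
Qed.

(** Precomposition respects quasi-isomorphisms of K-projectives, since these
    have a homotopy inverse. *)
Lemma hom_pre_qiso P Q Y (h : chain_map P Q) :
  K_projective P -> K_projective Q -> quasi_iso h -> quasi_iso (hom_pre Y h).
Proof.
move=> pP pQ qh.
have [h' h'P] := K_projective_lift (id_map Q) pQ qh.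
have qh' : quasi_iso h'.
  apply: (qiso_cancel_r qh); apply: homotopic_qiso (homotopic_sym h'P) _.
  exact: id_qiso.
have [h2 h2P] := K_projective_lift (id_map P) pP qh'.
have preE A B (u : chain_map A B) (v : chain_map B A) n (phi : Hom B Y n) :
    homotopic (comp_map u v) (id_map B) -> cycle phi ->
    boundary (hom_pre Y v n (hom_pre Y u n phi) - phi).
  move=> uv cphi; have := hom_pre_homotopic uv cphi.
  set a := (X in boundary (X - _)); set b := (X in boundary (_ - X)).
  have -> : b = phi by apply: hom_ext.
  by have -> : hom_pre Y v n (hom_pre Y u n phi) = a by apply: hom_ext.
move=> n; split=> [phi cphi bphi|phi cphi].
  apply: boundary_eq (boundaryBC (preE _ _ _ _ _ _ h'P cphi)) _.
  exact: cmap_boundary.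
exists (hom_pre Y h' n phi); split; first exact: cmap_cycle.
set w := hom_pre Y h n _ - phi.
have cw : cycle w by apply: cycleB => //; do 2!apply: cmap_cycle.
apply: boundary_eq (boundaryBC (preE _ _ _ _ _ _ h2P cw)) _.
apply: cmap_boundary; rewrite linearB.
by apply: preE h'P _; apply: cmap_cycle.
Qed.

Lemma quasi_iso_D X Y (f : chain_map X Y) : quasi_iso f -> D_iso X Y.
Proof. by move=> qf; apply: rst_step; exists f. Qed.

Lemma D_iso_sym X Y : D_iso X Y -> D_iso Y X.
Proof. exact: rst_sym. Qed.

Lemma D_iso_trans X Y Z : D_iso X Y -> D_iso Y Z -> D_iso X Z.
Proof. exact: rst_trans. Qed.

(** Out of a K-projective complex zigzags can be straightened: an arrow that
    points the wrong way is inverted, up to homotopy, by lifting along it. *)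
Lemma K_projective_D_iso P X Y : K_projective P -> D_iso X Y ->
  (exists f : chain_map P X, quasi_iso f) <->
  (exists f : chain_map P Y, quasi_iso f).
Proof.
move=> pP; elim=> {X Y} [X Y [g qg]|X|X Y _ IH|X Y Z _ IH1 _ IH2] //.
- split=> -[f qf]; first by exists (comp_map g f); apply: qiso_comp.
  have [h hP] := K_projective_lift f pP qg; exists h.
  by apply: (qiso_cancel_r qg); apply: homotopic_qiso (homotopic_sym hP) qf.
- by split=> /IH.
- by rewrite IH1.
Qed.

Lemma resolutionP X : (exists r, @is_resolution R X r) ->
  K_projective (res_obj X) /\ quasi_iso (res_map X).
Proof.
rewrite /res_obj /res_map /resolution; case: pselect => // h _.
by case: cid => r [].
Qed.

Lemma is_resolutionI X P (f : chain_map P X) : K_projective P -> quasi_iso f ->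
  exists r, @is_resolution R X r.
Proof. by move=> pP qf; exists (existT _ P f). Qed.

Lemma res_transfer P X Y : K_projective P -> D_iso P X -> D_iso X Y ->
  exists f : chain_map P Y, quasi_iso f.
Proof.
move=> pP PX XY; apply/(K_projective_D_iso pP (D_iso_trans PX XY)).
by exists (id_map P); apply: id_qiso.
Qed.

(** Derived Hom may be computed from any K-projective representative. *)
Lemma RHom_qiso P X Y : K_projective P -> D_iso P X ->
  exists h : chain_map P (res_obj X), quasi_iso h /\ quasi_iso (hom_pre Y h).
Proof.
move=> pP PX; have [f qf] := res_transfer pP PX (rst_refl _ _ _).
have [pr qr] := resolutionP (is_resolutionI pP qf).
have [h qh] := res_transfer pP PX (D_iso_sym (quasi_iso_D qr)).
by exists h; split=> //; apply: hom_pre_qiso.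
Qed.

Definition unshift X b n : {linear shift X b n -> X (n - b)} :=
  (idfun : {linear X (n - b) -> X (n - b)}).

(** The sign in the differential of a shift does not affect homology. *)
Lemma unshift_hisoat X b n : hisoat (unshift X b n).
Proof.
have dE i j (x : shift X b i) :
    diff (shift X b) i j x = sign b *: diff X (i - b) (j - b) x by [].
have z i (x : X i) : sign b *: x = 0 -> x = 0.
  by move=> h; rewrite -[x]scale1r -(sign_sqr b) -scalerA h scaler0.
have cyc (x : shift X b n) : cycle x <-> cycle (unshift X b n x).
  split=> /cycleP h; apply/cycleP => j; last by rewrite dE h scaler0.
  have aux l : l = j -> diff X (n - b) l (x : X (n - b)) = 0 ->
    diff X (n - b) j (unshift X b n x) = 0 by move=> e; subst l.
  apply: (aux _ (addrK b j)); apply: z; exact: h.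
have bd (x : shift X b n) : boundary x <-> boundary (unshift X b n x).
  split=> [[y yx]|/boundaryP [j [y yx]]]; apply/boundaryP.
    exists (n + 1 - b), (sign b *: (y : X (n + 1 - b))).
    by rewrite linearZ /= -yx dE.
  exists (j + b), (sign b *: tr X j (j + b - b) y : X (j + b - b)).
  rewrite dE linearZ /= scalerA sign_sqr scale1r.
  by rewrite -[LHS]/(diff X _ _ _) diff_tr ?addrK.
split=> [x /cyc|x /bd|x _ /bd|y cy] //.
by exists y; rewrite cyc subrr; split=> //; apply: boundary0.
Qed.

End HomFacts.

(** * Complexes of finite free modules *)

Section FreeModules.
Context {R : comUnitRingType}.

Section BasisMap.
Variables (V : lmodType R) (n : nat) (y : 'I_n -> V).

Lemma bmap_linear : linear (fun x : 'rV[R]_n => \sum_s x 0 s *: y s).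
Proof.
move=> a u v; rewrite scaler_sumr -big_split /=; apply: eq_bigr => s _.
by rewrite !mxE scalerDl scalerA.
Qed.

Definition bmap : {linear 'rV[R]_n -> V} := locked (lin_of bmap_linear).

Lemma bmapE x : bmap x = \sum_s x 0 s *: y s.
Proof. by rewrite /bmap -lock. Qed.

Lemma bmap_delta s : bmap (delta_mx 0 s) = y s.
Proof.
rewrite bmapE (bigD1 s) //= mxE !eqxx scale1r big1 ?addr0 // => t ts.
by rewrite mxE eqxx (negPf ts) scale0r.
Qed.
End BasisMap.

Lemma linear_basis (V : lmodType R) n (f : {linear 'rV[R]_n -> V}) x :
  f x = \sum_s x 0 s *: f (delta_mx 0 s).
Proof.
by rewrite {1}(row_sum_delta x) linear_sum; apply: eq_bigr => s _; rewrite linearZ.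
Qed.

Lemma eq_on_basis (V : lmodType R) n (f g : {linear 'rV[R]_n -> V}) :
  (forall s, f (delta_mx 0 s) = g (delta_mx 0 s)) -> f =1 g.
Proof.
by move=> fg x; rewrite !(linear_basis _ x); apply: eq_bigr => s _; rewrite fg.
Qed.

(** As in [complex], the differential is indexed by two degrees and vanishes
    unless they are consecutive. *)
Record mxcx := Mxcx {
  rk : int -> nat;
  Dmx : forall i j, 'M[R]_(rk i, rk j);
  Dmx_shape : forall i j, i != j + 1 -> Dmx i j = 0;
  Dmx_Dmx : forall i j l, Dmx i j *m Dmx j l = 0 }.

Lemma mxc_shape G i j (x : 'rV[R]_(rk G i)) : i != j + 1 ->
  mulmxr (Dmx G i j) x = 0.
Proof. by move=> ij; rewrite /= Dmx_shape // mulmx0. Qed.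

Lemma mxc_diff G i j l (x : 'rV[R]_(rk G i)) :
  mulmxr (Dmx G j l) (mulmxr (Dmx G i j) x) = 0.
Proof. by rewrite /= -mulmxA Dmx_Dmx mulmx0. Qed.

Definition mxc (G : mxcx) : complex R :=
  @Complex R (fun i => 'rV[R]_(rk G i)) (fun i j => mulmxr (Dmx G i j))
    (@mxc_shape G) (@mxc_diff G).

Definition bs (G : mxcx) i (s : 'I_(rk G i)) : mxc G i := delta_mx 0 s.

Definition bbelow (G : mxcx) (a : int) : Prop := forall i, i < a -> rk G i = 0%N.

Definition minimal (G : mxcx) : Prop :=
  forall i j s t, Dmx G i j s t \isn't a GRing.unit.

Lemma rk0 G i (x : mxc G i) : rk G i = 0%N -> x = 0.
Proof. by move=> e; apply/rowP => -[s si]; exfalso; rewrite e in si. Qed.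

Definition vanish_below X Y n (phi : @hom R X Y n) (i0 : int) : Prop :=
  forall i j (x : X i), i < i0 -> phi i j x = 0.

Lemma bbelow_vanish G a Y n (phi : hom (mxc G) Y n) :
  bbelow G a -> vanish_below phi a.
Proof. by move=> ba i j x /ba e; rewrite (rk0 x e) linear0. Qed.

(** Preimages of the values of [psi] on the basis in degree [i0] extend
    linearly to a map in that degree alone, because the module is free. *)
Lemma cell_kill G N n i0 (psi : Hom (mxc G) N n) :
  vanish_below psi i0 -> (forall s, boundary (psi i0 (i0 + n) (bs s))) ->
  exists g : Hom (mxc G) N (n + 1),
    (forall i j x, i != i0 -> (g : hom _ _ _) i j x = 0) /\
    vanish_below (psi - diff (Hom (mxc G) N) (n + 1) n g : Hom (mxc G) N n) (i0 + 1).
Proof.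
move=> van /choice [y yP].
have e : i0 + n + 1 = i0 + (n + 1) by rewrite addrA.
pose g : Hom (mxc G) N (n + 1) :=
  @homat R (mxc G) N (n + 1) i0 _ e (bmap y); exists g.
split=> [i j x|i j x]; first exact: homat_ne.
move=> ii; have {ii}[ii|ii] : i < i0 \/ i = i0 by lia.
  rewrite hom_addE van // add0r.
  transitivity (- (diff (Hom (mxc G) N) (n + 1) n g : hom _ _ _) i j x) => //.
  rewrite Hom_diffE // !homat_ne ?linear0 ?scaler0 ?oppr0 ?addr0 ?oppr0 //; lia.
subst i; have [ej|ne] := eqVneq j (i0 + n); last by rewrite Hom_ne.
subst j; rewrite hom_addE.
transitivity (psi i0 (i0 + n) x
  - (diff (Hom (mxc G) N) (n + 1) n g : hom _ _ _) i0 (i0 + n) x) => //.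
rewrite Hom_diffE // homat_id [X in _ *: X]homat_ne ?scaler0 ?subr0; last by lia.
apply/eqP; rewrite subr_eq0; apply/eqP.
apply: (eq_on_basis (f := psi i0 (i0 + n))
  (g := diff N (i0 + n + 1) (i0 + n) \o bmap y : {linear _ -> _})) => s.
by rewrite [RHS](congr1 (diff N _ _) (bmap_delta y s)) yP.
Qed.

(** Successive corrections add up, because each degree is modified only once:
    once [psi] is killed below a degree, its values there are cycles of [N],
    hence boundaries. *)
Lemma cycle_kill G N n i0 (psi : Hom (mxc G) N n) :
  cycle psi -> vanish_below psi i0 -> (forall j, i0 + n <= j -> hvan N j) ->
  exists g : Hom (mxc G) N (n + 1),
    vanish_below (g : hom _ _ _) i0 /\ diff (Hom (mxc G) N) (n + 1) n g = psi.
Proof.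
move=> cpsi van vN; set d := diff (Hom (mxc G) N) (n + 1) n.
pose good k (H : Hom (mxc G) N (n + 1)) :=
  vanish_below (H : hom _ _ _) i0 /\ vanish_below (psi - d H) (i0 + Posz k).
have /choice [next nextP] : forall p : nat * Hom (mxc G) N (n + 1),
    exists H' : Hom (mxc G) N (n + 1), good p.1 p.2 -> good p.1.+1 H' /\
      vanish_below (H' - p.2 : Hom (mxc G) N (n + 1)) (i0 + Posz p.1).
  case=> k H /=; have [[v0 v1]|ng] := pselect (good k H); last by exists 0.
  have [|g [g0 gv]] := cell_kill v1.
    move=> s; apply: vN; first by lia.
    have /Hom_cycleP c : cycle (psi - d H) by apply: cycleB => //; apply: cycle_diff.
    have := c (i0 + Posz k) (i0 + Posz k + n - 1) (bs s).
    rewrite (subrK 1 (i0 + Posz k + n) : _ - 1 + 1 = _).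
    by rewrite [X in _ *: X]v1 ?scaler0 //; lia.
  have gb : vanish_below (g : hom _ _ _) (i0 + Posz k).
    by move=> i j x ii; rewrite g0 //; lia.
  exists (H + g) => _; split.
    split=> i j x ii; first by rewrite hom_addE v0 // gb ?addr0 //; lia.
    by rewrite /d linearD opprD addrA; apply: gv; lia.
  by move=> i j x ii; rewrite [H + g]addrC addrK gb.
pose st := fix st k := if k is k'.+1 then next (k', st k') else (0 : Hom (mxc G) N (n + 1)).
have stP k : good k (st k).
  elim: k => [|k IH] /=; last by case: (nextP (k, st k) IH).
  by split=> // i j x ii; rewrite /d linear0 subr0 van //; lia.
have st_eq k i j (x : mxc G i) : i < i0 + Posz k -> st k.+1 i j x = st k i j x.
  move=> ii; have [_ h] := nextP (k, st k) (stP k).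
  by have /eqP := h i j x ii; rewrite hom_addE subr_eq0 => /eqP.
pose h i j : {linear mxc G i -> N j} :=
  if i0 <= i then st (absz (i - i0)).+1 i j else \0.
have hE k i j x : i < i0 + Posz k -> h i j x = st k i j x.
  rewrite /h; case: ifP => ii ik; last first.
    by have [v _] := stP k; rewrite v //; lia.
  have [m ->] : exists m, k = ((absz (i - i0)).+1 + m)%N.
    by exists (k - (absz (i - i0)).+1)%N; lia.
  elim: m => [|m IH]; rewrite ?addn0 // addnS IH.
  by symmetry; apply: st_eq; lia.
have hs i j x : j != i + (n + 1) -> h i j x = 0.
  move=> ij; rewrite /h; case: ifP => // _; exact: Hom_ne.
exists (HomElt hs); split=> [i j x ii|]; first by rewrite /= /h ifF //; lia.
apply: hom_ext => i j x.
pose k := (absz (i - i0)).+1; have ik : i < i0 + Posz k by lia.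
have [_ /(_ i j x ik) /eqP] := stP k; rewrite hom_addE addr_eq0 => /eqP h0.
transitivity ((d (st k) : hom _ _ _) i j x); last first.
  by symmetry; rewrite h0; apply: opprK.
rewrite !Hom_diffE //= !(hE k) //; lia.
Qed.
Lemma mxc_K_projective G a : bbelow G a -> K_projective (mxc G).
Proof.
move=> ba N acN n phi cphi.
have [g [_ <-]] := cycle_kill cphi (bbelow_vanish _ ba) (fun j _ => acN j).
exact: boundary_diff.
Qed.

(** ** Complexes with a single generator *)

(** Expressed by ranks, since the complexes that turn out to be of this form are
    not given as such. *)
Definition sphere (G : mxcx) (a : int) : Prop := forall i, rk G i = (i == a).

Definition coef n (x : 'rV[R]_n) : R := \sum_s x 0 s.

Lemma coefZ n r (x : 'rV[R]_n) : coef (r *: x) = r * coef x.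
Proof. by rewrite /coef mulr_sumr; apply: eq_bigr => s _; rewrite mxE. Qed.

Lemma coef_linear (V : lmodType R) n (y : V) :
  linear (fun x : 'rV[R]_n => coef x *: y).
Proof.
move=> a u v; rewrite scalerA -scalerDl; congr (_ *: _).
rewrite /coef mulr_sumr -big_split /=; apply: eq_bigr => s _.
by rewrite !mxE.
Qed.

Definition coef_map (V : lmodType R) n (y : V) : {linear 'rV[R]_n -> V} :=
  lin_of (coef_linear y).

Section Sphere.
Variables (G : mxcx) (a : int) (spG : sphere G a).

Definition gene : mxc G a := const_mx 1.

Lemma coef_gene : coef gene = 1.
Proof.
rewrite /coef (eq_bigr (fun=> 1)) => [|s _]; last by rewrite mxE.
by rewrite sumr_const card_ord spG eqxx.
Qed.

Lemma geneE (x : mxc G a) : x = coef x *: gene.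
Proof.
have r1 : rk G a = 1%N by rewrite spG eqxx.
apply/rowP => s; rewrite !mxE mulr1 /coef (bigD1 s) //= big1 ?addr0 // => t ts.
case/eqP: ts; apply/val_inj; have := ltn_ord t; have := ltn_ord s; rewrite /=; lia.
Qed.

Lemma sphere_eq0 i (x : mxc G i) : i != a -> x = 0.
Proof. by move=> ia; apply: rk0; rewrite spG (negPf ia). Qed.

Lemma sphere_diff i j (x : mxc G i) : diff (mxc G) i j x = 0.
Proof.
have [e|] := eqVneq i (j + 1); last exact: diff_shape.
have [ia|ia] := eqVneq i a; last by rewrite (sphere_eq0 x ia) linear0.
by apply: sphere_eq0; subst i; rewrite -ia; lia.
Qed.

Lemma sphere_bbelow : bbelow G a.
Proof. by move=> i ia; rewrite spG; case: eqP => // e; lia. Qed.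

Lemma sphere_K_projective : K_projective (mxc G).
Proof. exact: mxc_K_projective sphere_bbelow. Qed.

Lemma sphere_hgen : hgen gene.
Proof.
split=> [|i ia x _|r [x]|x _]; first exact: sphere_diff.
- by rewrite (sphere_eq0 x ia); apply: boundary0.
- rewrite sphere_diff => e.
  rewrite -[r]mulr1 -coef_gene -coefZ -e /coef.
  by rewrite big1 // => s _; rewrite mxE.
- exists (coef x); rewrite -geneE subrr; exact: boundary0.
Qed.

Section SphereMap.
Variables (X : complex R) (z : X a) (cz : cycle z).

Lemma sphere_map_diff i j (x : mxc G i) :
  coef_map (rk G j) (tr X a j z) (diff (mxc G) i j x) =
  diff X i j (coef_map (rk G i) (tr X a i z) x).
Proof.
rewrite sphere_diff linear0 /= linearZ /=.
have [e|ne] := eqVneq a i; last by rewrite tr_ne // linear0 scaler0.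
by subst i; rewrite tr_id (proj1 (cycleP z)) ?scaler0.
Qed.

Definition sphere_map : chain_map (mxc G) X :=
  @ChainMap R (mxc G) X (fun i => coef_map (rk G i) (tr X a i z)) sphere_map_diff.

Lemma sphere_map_gene : sphere_map a gene = z.
Proof. by rewrite /= tr_id coef_gene scale1r. Qed.
End SphereMap.

Lemma sphere_map_qiso (X : complex R) (z : X a) (hz : hgen z) :
  exists f : chain_map (mxc G) X, quasi_iso f /\ f a gene = z.
Proof.
have [cz _ _ _] := hz; exists (sphere_map cz); split; last exact: sphere_map_gene.
by apply: (hgen_to_qiso sphere_hgen); rewrite sphere_map_gene.
Qed.

Section SphereEval.
Variables (Y : complex R) (n j : int) (e : j = a + n).

Lemma sphere_ev_linear : linear (fun phi : Hom (mxc G) Y n => phi a j gene).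
Proof. by []. Qed.

Definition sphere_ev : {linear Hom (mxc G) Y n -> Y j} := lin_of sphere_ev_linear.

Lemma sphere_hom_ext (phi psi : Hom (mxc G) Y n) :
  phi a j gene = psi a j gene -> phi = psi.
Proof.
move=> h; apply: hom_ext => i l x.
have [ia|ia] := eqVneq i a; last by rewrite (sphere_eq0 x ia) !linear0.
subst i; have [lj|lj] := eqVneq l j; last by rewrite !Hom_ne -?e.
by subst l; rewrite (geneE x) !linearZ /= h.
Qed.

Definition sphere_hom (y : Y j) : Hom (mxc G) Y n :=
  @homat R (mxc G) Y n a j e (coef_map (rk G a) y).

Lemma sphere_homE y : sphere_ev (sphere_hom y) = y.
Proof. by rewrite [LHS]homat_id /= coef_gene scale1r. Qed.
End SphereEval.

Lemma sphere_ev_diff Y n m j l (phi : Hom (mxc G) Y n) : n = m + 1 -> j = l + 1 ->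
  sphere_ev Y m l (diff (Hom (mxc G) Y) n m phi) = diff Y j l (sphere_ev Y n j phi).
Proof.
move=> nm jl; subst j; rewrite /= -[LHS]/((diff (Hom _ _) _ _ _ : hom _ _ _) _ _ _).
by rewrite Hom_diffE // sphere_diff linear0 scaler0 subr0.
Qed.

(** Maps out of a sphere are elements of the target. *)
Lemma sphere_ev_hisoat Y n j : j = a + n -> hisoat (sphere_ev Y n j).
Proof.
move=> e.
have diffE m l (phi : Hom (mxc G) Y n) : n = m + 1 -> j = l + 1 ->
    sphere_ev Y m l (diff (Hom (mxc G) Y) n m phi) = diff Y j l (sphere_ev Y n j phi).
  exact: sphere_ev_diff.
have cyc (phi : Hom (mxc G) Y n) : cycle phi <-> cycle (sphere_ev Y n j phi).
  rewrite /cycle -(diffE (n - 1) (j - 1)) ?subrK //.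
  split=> [->|h]; first by rewrite linear0.
  by apply: (@sphere_hom_ext Y (n - 1) (j - 1)); [lia | rewrite [LHS]h].
split.
- by move=> phi /cyc.
- move=> _ [psi <-]; rewrite (@sphere_ev_diff Y _ _ (j + 1)) //.
  exact: boundary_diff.
- move=> phi _ [y yphi].
  have e' : j + 1 = a + (n + 1) by rewrite addrA e.
  exists (sphere_hom e' y).
  apply: (sphere_hom_ext e); rewrite -[LHS]/(sphere_ev Y n j _).
  by rewrite (@sphere_ev_diff Y _ _ (j + 1)) // sphere_homE.
- move=> y cy; exists (sphere_hom e y); rewrite cyc sphere_homE; split=> //.
  by rewrite subrr; apply: boundary0.
Qed.
End Sphere.

Section Sphere0.
Variable a : int.

Lemma sphere0_shape i j : i != j + 1 -> (0 : 'M[R]_((i == a), (j == a))) = 0.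
Proof. by []. Qed.

Lemma sphere0_diff i j l :
  (0 : 'M[R]_((i == a), (j == a))) *m (0 : 'M[R]_((j == a), (l == a))) = 0.
Proof. exact: mul0mx. Qed.

Definition sphere0 : mxcx := Mxcx sphere0_shape sphere0_diff.

Lemma sphere0P : sphere sphere0 a.
Proof. by []. Qed.

Lemma sphere0_minimal : minimal sphere0.
Proof. by move=> i j s t; rewrite mxE unitr0. Qed.
End Sphere0.

Section MShift.
Variables (G : mxcx) (b : int).

Lemma mshift_shape i j : i != j + 1 -> sign b *: Dmx G (i - b) (j - b) = 0.
Proof. by move=> ij; rewrite Dmx_shape ?scaler0 //; lia. Qed.

Lemma mshift_diff i j l :
  (sign b *: Dmx G (i - b) (j - b)) *m (sign b *: Dmx G (j - b) (l - b)) = 0.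
Proof. by rewrite -scalemxAl -scalemxAr Dmx_Dmx !scaler0. Qed.

Definition mshift : mxcx := Mxcx mshift_shape mshift_diff.

Lemma mshift_bbelow a : bbelow G a -> bbelow mshift (a + b).
Proof. by move=> ba i ia; apply: ba; lia. Qed.

Lemma mshift_minimal : minimal G -> minimal mshift.
Proof.
move=> mG i j s t; rewrite mxE unitrM negb_and (mG _ _ _ _) orbT //.
Qed.

Lemma mshift_diffE i j (x : mxc mshift i) :
  diff (mxc mshift) i j x = sign b *: diff (mxc G) (i - b) (j - b) x.
Proof. by rewrite /= -scalemxAr. Qed.

Lemma mshift_map_diff i j (x : mxc mshift i) :
  (idfun : {linear 'rV[R]_(rk G (j - b)) -> _}) (diff (mxc mshift) i j x)
  = diff (shift (mxc G) b) i j x.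
Proof. exact: mshift_diffE. Qed.

Definition mshift_map : chain_map (mxc mshift) (shift (mxc G) b) :=
  @ChainMap R (mxc mshift) (shift (mxc G) b)
    (fun i => idfun : {linear 'rV[R]_(rk G (i - b)) -> 'rV[R]_(rk G (i - b))})
    mshift_map_diff.

Lemma mshift_map_qiso : quasi_iso mshift_map.
Proof. by apply: bij_qiso => // i y; exists y. Qed.

Section Reindex.
Variables (Y : complex R) (n m : int) (e : n = m + b).

Lemma unshift_hom_shape (phi : Hom (mxc G) Y n) i j (x : mxc mshift i) :
  j != i + m -> phi (i - b) j x = 0.
Proof. by move=> ij; apply: Hom_ne; lia. Qed.

Definition unshift_hom_elt (phi : Hom (mxc G) Y n) : Hom (mxc mshift) Y m :=
  @HomElt R (mxc mshift) Y m (fun i j => phi (i - b) j) (unshift_hom_shape phi).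

Lemma unshift_hom_linear : linear unshift_hom_elt.
Proof. by move=> c phi psi; apply: hom_ext. Qed.

Definition unshift_hom : {linear Hom (mxc G) Y n -> Hom (mxc mshift) Y m} :=
  lin_of unshift_hom_linear.

Lemma unshift_hom_inj phi psi : unshift_hom phi = unshift_hom psi -> phi = psi.
Proof.
move=> h; apply: hom_ext => i j x; rewrite -(addrK b i) in x *.
by have : (unshift_hom phi : hom _ _ _) (i + b) j x = (unshift_hom psi : hom _ _ _) (i + b) j x
  by rewrite h.
Qed.

Lemma unshift_hom_surj psi : exists phi, unshift_hom phi = psi.
Proof.
pose f i j : {linear mxc G i -> Y j} :=
  ((psi : hom _ _ _) (i + b) j : {linear mxc G (i + b - b) -> Y j})
    \o tr (mxc G) i (i + b - b).
have fs i j x : j != i + n -> f i j x = 0.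
  by move=> ij; rewrite /f /= Hom_ne //; lia.
exists (HomElt fs); apply: hom_ext => i j x; rewrite /= /f /=.
have H l : l = i -> (psi : hom _ _ _) l j (tr (mxc G) (i - b) (l - b) x) =
    (psi : hom _ _ _) i j x by move=> el; subst l; rewrite tr_id.
exact/H/subrK.
Qed.
End Reindex.

Lemma unshift_hom_diff Y n m n' m' (e : n = m + b) (e' : n' = m' + b)
    (phi : Hom (mxc G) Y n) :
  diff (Hom (mxc mshift) Y) m m' (unshift_hom Y e phi) =
  unshift_hom Y e' (diff (Hom (mxc G) Y) n n' phi).
Proof.
have [mm|ne] := eqVneq m (m' + 1); last first.
  by rewrite diff_shape // diff_shape ?linear0 //; lia.
apply: hom_ext => i j x; rewrite Hom_diffE //.
rewrite -[RHS]/((diff (Hom (mxc G) Y) n n' phi : hom _ _ _) (i - b) j x).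
rewrite Hom_diffE; last by lia.
congr (_ - _); rewrite mshift_diffE -[(unshift_hom Y e phi : hom _ _ _) _ _]/(phi (i - 1 - b) j).
by rewrite linearZ /= scalerA -signD -e [in RHS]addrAC.
Qed.

(** The comparison commutes strictly with differentials: the sign in the
    differential of the shift accounts for the change of degree in that of the
    Hom complex. *)
Lemma unshift_hom_hisoat Y n m (e : n = m + b) : hisoat (unshift_hom Y e).
Proof.
have cyc (phi : Hom (mxc G) Y n) : cycle (unshift_hom Y e phi) <-> cycle phi.
  have e' : n - 1 = m - 1 + b by lia.
  rewrite /cycle (unshift_hom_diff e e'); split=> [h|->]; last by rewrite linear0.
  by apply: (unshift_hom_inj (e := e')); rewrite h linear0.
have e' : n + 1 = m + 1 + b by lia.
split.
- by move=> phi /cyc.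
- by move=> _ [psi <-]; rewrite -(unshift_hom_diff e'); apply: boundary_diff.
- move=> phi _ [psi']; have [psi <-] := unshift_hom_surj e' psi'.
  rewrite (unshift_hom_diff e' e) => h; exists psi; exact: unshift_hom_inj h.
- move=> psi cpsi; have [phi phiE] := unshift_hom_surj e psi; exists phi.
  by rewrite -cyc phiE subrr; split=> //; apply: boundary0.
Qed.
End MShift.

End FreeModules.

(** * Minimal free resolutions *)

Section MinimalResolution.
Context {R : comUnitRingType}.
Hypothesis R_noetherian : noetherian R.
Variable X : complex R.
Hypothesis X_fg : forall i, hfg X i.
Variable a : int.
Hypothesis X_below : forall i, i <= a -> hvan X i.

(** The part of the resolution that the construction of the next degree
    uses: the last differential and the images of the last basis in [X]. The
    images are given in all degrees, which avoids a dependency on the degree. *)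
Record stage := Stage {
  srk' : nat;
  srk : nat;
  sD : 'M[R]_(srk, srk');
  sf : 'I_srk -> forall i, X i }.

Definition sfm (s : stage) i : {linear 'rV[R]_(srk s) -> X i} :=
  bmap (fun t => @sf s t i).

Definition extension (s : stage) : Type :=
  {n : nat & ('M[R]_(n, srk s) * ('I_n -> forall i, X i))%type}.

Definition extend (s : stage) (o : extension s) : stage :=
  @Stage (srk s) (projT1 o) (projT2 o).1 (projT2 o).2.

(** The second condition is the minimality of the last basis, in the form that
    makes the next differential vanish modulo the maximal ideal. *)
Definition good (i : int) (s : stage) : Prop :=
  (forall x : X i, cycle x -> exists c, c *m sD s = 0 /\ boundary (sfm s i c - x)) /\
  (forall c, c *m sD s = 0 -> boundary (sfm s i c) ->
     forall t, c 0 t \isn't a GRing.unit).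

Definition good_step (i : int) (s : stage) (o : extension s) : Prop :=
  let D := (projT2 o).1 in
  [/\ D *m sD s = 0,
      forall c, diff X (i + 1) i (sfm (extend o) (i + 1) c) = sfm s i (c *m D),
      forall c, c *m sD s = 0 -> boundary (sfm s i c) -> exists c', c = c' *m D,
      forall t u, D t u \isn't a GRing.unit &
      good (i + 1) (extend o)].

(** The new basis is a minimal generating family of the module of pairs
    [(c, x)] of a cycle [c] of the resolution and an element [x] of [X] with
    boundary the image of [c], modulo the pairs [(0, boundary)]. This is the
    homology of the cone of the map constructed so far; such a family kills the
    kernel on homology in degree [i] and covers the homology of [X] in degree
    [i + 1] at the same time. *)
Lemma good_step_exists i s : good i s -> exists o : extension s, good_step i o.
Proof.
move=> [surj min].
pose V : lmodType R := ('rV[R]_(srk s) * X (i + 1)%R)%type.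
pose W (u : V) := u.1 *m sD s = 0 /\ diff X (i + 1) i u.2 = sfm s i u.1.
pose U (u : V) := u.1 = 0 /\ boundary u.2.
have subW : submodule W.
  split=> [|b u v [u1 u2] [v1 v2]]; first by split; rewrite ?mul0mx ?linear0.
  split; first by rewrite mulmxDl -scalemxAl u1 v1 scaler0 addr0.
  by rewrite !linearP /= u2 v2.
have subU : submodule U.
  split=> [|b u v [u1 u2] [v1 v2]]; first by split=> //; apply: boundary0.
  split=> /=; first by rewrite u1 v1 scaler0 addr0.
  by case: (boundary_submodule X (i + 1)) => _; apply.
have subT : submodule (fun u : V => u.1 = 0).
  by split=> // b u v u1 v1; rewrite /= u1 v1 scaler0 addr0.
have [n1 gen1] : fgmod W (fun u : V => u.1 = 0).
  apply: (@fgmod_sub _ R_noetherian _ _ (fun=> True)) => //.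
  exists (srk s), (fun t => (delta_mx 0 t, 0) : V); split=> // u _.
  exists (fun t => u.1 0 t); rewrite /= raddf_sum /=.
  by rewrite {1}(row_sum_delta u.1) subrr.
have [n2 gen2] : fgmod (fun u : V => W u /\ u.1 = 0) U.
  have [n2 [g [gc gP]]] := X_fg (i + 1).
  exists n2, (fun t => (0, g t) : V); split=> [t|u [[_ u2] u1]].
    split=> //; split; first exact: mul0mx.
    by rewrite /= linear0; apply: (proj1 (cycleP _)).
  have cu : cycle u.2.
    apply/cycleP => j; have [e|ne] := eqVneq j i; last first.
      by apply: diff_shape; apply: contraNneq ne => /addIr ->.
    by subst j; rewrite u2 u1 linear0.
  have [c cP] := gP _ cu; exists c; split.
    by rewrite /= raddf_sum u1 sub0r big1 ?oppr0 // => t _; rewrite /= scaler0.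
  by rewrite /= raddf_sum.
have fgW : fgmod W U by exists (n1 + n2)%N; apply: ngen_ext gen1 gen2.
have [n [g [Wg gP gmin]]] := fgmod_minimal subU fgW.
pose D : 'M[R]_(n, srk s) := \matrix_(t, u) (g t).1 0 u.
pose f (t : 'I_n) j : X j := tr X (i + 1) j (g t).2.
pose o : extension s := existT _ n (D, f).
have DE c : c *m D = \sum_t c 0 t *: (g t).1.
  apply/rowP => u; rewrite !mxE summxE; apply: eq_bigr => t _.
  by rewrite !mxE.
have fE c : sfm (extend o) (i + 1) c = \sum_t c 0 t *: (g t).2.
  by rewrite bmapE; apply: eq_bigr => t _; rewrite /= /f tr_id.
have combE (c : 'I_n -> R) :
    \sum_t c t *: g t = (\sum_t c t *: (g t).1, \sum_t c t *: (g t).2).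
  by rewrite [LHS]surjective_pairing !raddf_sum.
have oD : (projT2 o).1 = D by [].
exists o; split; rewrite ?oD.
- apply/row_matrixP => t; rewrite row_mul row0.
  have [h _] := Wg t; rewrite -[RHS]h; congr (_ *m _).
  by apply/rowP => u; rewrite !mxE.
- move=> c; rewrite fE DE !linear_sum; apply: eq_bigr => t _.
  by have [_ h] := Wg t; rewrite !linearZ /= h.
- move=> c cD /boundaryP [j [x xc]].
  have [e|ne] := eqVneq j (i + 1); last first.
    have W0 : W (c, 0) by split=> //=; rewrite linear0 -xc diff_shape.
    have [d [+ _]] := gP _ W0; rewrite combE /= => /eqP; rewrite subr_eq0 => /eqP ->.
    by exists (\row_t d t); rewrite DE; apply: eq_bigr => t _; rewrite mxE.
  subst j; have Wx : W (c, x) by split.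
  have [d [+ _]] := gP _ Wx; rewrite combE /= => /eqP; rewrite subr_eq0 => /eqP ->.
  by exists (\row_t d t); rewrite DE; apply: eq_bigr => t _; rewrite mxE.
- move=> t u; rewrite mxE; have [h1 h2] := Wg t.
  by apply: min h1 _ u; rewrite -h2; apply: boundary_diff.
- split=> [x cx|c cD bc t].
    have Wx : W (0, x).
      split=> /=; first exact: mul0mx.
      by rewrite linear0; apply: (proj1 (cycleP _)).
    have [d] := gP _ Wx; rewrite combE => -[/= e1 e2].
    exists (\row_t d t); split.
      rewrite -[LHS]/((\row_t d t) *m D) DE; apply/eqP; rewrite -oppr_eq0 -[X in X == _]sub0r -[X in _ == X]e1; apply/eqP.
      by congr (_ - _); apply: eq_bigr => t _; rewrite mxE.
    rewrite fE; apply: boundaryBC; under eq_bigr do rewrite mxE; exact: e2.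
  apply: (gmin (fun t => c 0 t)); rewrite combE; split=> /=; first by rewrite -DE.
  by rewrite -fE.
Qed.

Definition next_ext i s : extension s :=
  if pselect (exists o : extension s, good_step i o) is left h then projT1 (cid h)
  else existT _ 0%N (0, fun=> fun=> 0).

Lemma next_extP i s : good i s -> good_step i (next_ext i s).
Proof.
move=> /good_step_exists ex; rewrite /next_ext; case: pselect => // h.
by case: cid.
Qed.

Fixpoint stages (k : nat) : stage :=
  if k is k'.+1 then extend (next_ext (a + Posz k') (stages k'))
  else @Stage 0 0 0 (fun=> fun=> 0).

Lemma stages_good k : good (a + Posz k) (stages k).
Proof.
elim: k => [|k IH]; last first.
  have [_ _ _ _] := next_extP IH.
  by have -> : a + Posz k + 1 = a + Posz k.+1 by lia.
rewrite addr0; split=> [x cx|c _ _ []//].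
exists 0; rewrite mul0mx linear0 sub0r; split=> //.
by apply: boundaryN; apply: X_below cx.
Qed.

Lemma stages_step k : good_step (a + Posz k) (next_ext (a + Posz k) (stages k)).
Proof. exact/next_extP/stages_good. Qed.

Definition rkn k := srk (stages k).
Definition Dn k : 'M[R]_(rkn k.+1, rkn k) := sD (stages k.+1).

Definition rkz (u : int) : nat := if u is Posz k then rkn k else 0%N.

(** Degrees are counted from [a] here; the resolution is zero before. *)
Definition Dz (u v : int) : 'M[R]_(rkz u, rkz v) :=
  match u, v return 'M[R]_(rkz u, rkz v) with
  | Posz k.+1, Posz l =>
    if k =P l is ReflectT e then ecast l 'M[R]_(rkn k.+1, rkn l) e (Dn k) else 0
  | _, _ => 0
  end.

Lemma DzS k : Dz (Posz k.+1) (Posz k) = Dn k.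
Proof. by rewrite /=; case: eqP => // e; rewrite (eq_axiomK e). Qed.

Lemma Dz_shape u v : u != v + 1 -> Dz u v = 0.
Proof.
case: u v => [[|k]|k] [l|l] //= ne; case: eqP => // e; case/eqP: ne.
by rewrite e; lia.
Qed.

Lemma Dn_Dn k : Dn k.+1 *m Dn k = 0.
Proof. by have [] := stages_step k.+1. Qed.

Lemma Dz_Dz u v w : Dz u v *m Dz v w = 0.
Proof.
have [e1|ne] := eqVneq u (v + 1); last by rewrite Dz_shape ?mul0mx.
have [e2|ne] := eqVneq v (w + 1); last by rewrite [X in _ *m X]Dz_shape ?mulmx0.
subst u v; case: w => [k|w]; last first.
  have [x|x] : (Negz w + 1 = 0) \/ exists k, Negz w + 1 = Negz k.
  - case: w => [|w]; [by left|by right; exists w; lia].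
  - by rewrite x [X in _ *m X](_ : _ = 0) ?mulmx0.
  - by case: x => k ->; rewrite [X in _ *m X](_ : _ = 0) ?mulmx0.
have -> : Posz k + 1 = Posz k.+1 by lia.
have -> : Posz k.+1 + 1 = Posz k.+2 by lia.
by rewrite !DzS Dn_Dn.
Qed.

Lemma res_shape i j : i != j + 1 -> Dz (i - a) (j - a) = 0.
Proof. by move=> ij; apply: Dz_shape; lia. Qed.

Lemma res_diff i j l : Dz (i - a) (j - a) *m Dz (j - a) (l - a) = 0.
Proof. exact: Dz_Dz. Qed.

Definition resmx : mxcx := Mxcx res_shape res_diff.

Definition fz (u : int) i : {linear 'rV[R]_(rkz u) -> X i} :=
  if u is Posz k then sfm (stages k) i else \0.

Lemma fz_diff u v i j (x : 'rV[R]_(rkz u)) : i = a + u -> j = a + v ->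
  fz v j (x *m Dz u v) = diff X i j (fz u i x).
Proof.
move=> iu jv; have [e|ne] := eqVneq u (v + 1); last first.
  by rewrite Dz_shape // mulmx0 linear0 diff_shape //; lia.
subst u; case: v jv x iu => [k|v] jv x iu.
  have e : Posz k + 1 = Posz k.+1 by lia.
  rewrite e in x iu *; rewrite DzS.
  have [_ h _ _ _] := stages_step k.
  have e' : i = a + Posz k + 1 by lia.
  by subst i j; rewrite e' [RHS]h.
have [x0|[k e]] : (Negz v + 1 = 0) \/ exists k, Negz v + 1 = Negz k.
- case: v {jv x iu} => [|w]; [by left|by right; exists w; lia].
- by rewrite x0 in x iu *; rewrite [x](_ : _ = 0) ?mul0mx ?linear0 //; apply/rowP => -[].
- by rewrite e in x iu *; rewrite [x](_ : _ = 0) ?mul0mx ?linear0 //; apply/rowP => -[].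
Qed.

Lemma resmap_diff i j (x : mxc resmx i) :
  fz (j - a) j (diff (mxc resmx) i j x) = diff X i j (fz (i - a) i x).
Proof. by apply: fz_diff; lia. Qed.

Definition resmap : chain_map (mxc resmx) X :=
  @ChainMap R (mxc resmx) X (fun i => fz (i - a) i) resmap_diff.

Lemma fz_surj u i (y : X i) : i = a + u -> cycle y ->
  exists c : 'rV[R]_(rkz u), (forall v, c *m Dz u v = 0) /\ boundary (fz u i c - y).
Proof.
move=> iu cy; case: u iu => [k|k] iu; last first.
  exists 0; split=> [v|]; first exact: mul0mx.
  by rewrite linear0 sub0r; apply: boundaryN; apply: X_below cy; lia.
have [+ _] := stages_good k; rewrite -iu => /(_ _ cy) [c [cD cy']].
exists c; split=> // v; have [e|ne] := eqVneq (Posz k) (v + 1); last first.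
  by rewrite Dz_shape // mulmx0.
case: k c cD {cy'} e iu => [|k] c cD e iu; first by rewrite [c](_ : _ = 0) ?mul0mx //;
  apply/rowP => -[].
have -> : v = Posz k by lia.
by rewrite DzS.
Qed.

Lemma fz_inj u i (c : 'rV[R]_(rkz u)) : i = a + u -> (forall v, c *m Dz u v = 0) ->
  boundary (fz u i c) -> exists u' (c' : 'rV[R]_(rkz u')), c = c' *m Dz u' u.
Proof.
case: u c => [k|k] c iu cD bc; last first.
  by exists 0, 0; rewrite mul0mx; apply/rowP => -[].
have [_ _ inj _ _] := stages_step k.
have [||c' cE] := inj c; last by exists (Posz k.+1), c'; rewrite DzS.
  case: k c iu cD bc {inj} => [|k] c _ cD _; first by apply/rowP => -[].
  by have := cD (Posz k); rewrite DzS.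
by rewrite -iu.
Qed.

Lemma resmap_qiso : quasi_iso resmap.
Proof.
move=> i; have iu : i = a + (i - a) by lia.
split=> [c /cycleP cD bc|y cy].
  have [v|u [c' cE]] := fz_inj iu _ bc.
    have /= := cD (a + v).
    by have -> : a + v - a = v by lia.
  apply/boundaryP; exists (a + u); rewrite cE.
  have e : u = a + u - a by lia.
  by rewrite /= -e; exists c'.
have [c [cD cy']] := fz_surj iu cy; exists c; split=> //.
exact: cD.
Qed.

Lemma resmx_minimal : minimal resmx.
Proof.
move=> i j s t; have [e|ne] := eqVneq (i - a) (j - a + 1); last first.
  by rewrite [Dmx _ _ _]Dz_shape // mxE unitr0.
rewrite /= in s t *; move: (i - a) (j - a) e s t => u v e s t; subst u.
case: v s t => [k|v] s t; last by case: t.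
have e : Posz k + 1 = Posz k.+1 by lia.
rewrite e in s t *; rewrite DzS.
by have [_ _ _ h _] := stages_step k; apply: h.
Qed.

Lemma resmx_bbelow : bbelow resmx (a + 1).
Proof.
move=> i ia; rewrite /=; case e : (i - a) => [[|k]|k] //; lia.
Qed.

End MinimalResolution.

Lemma minimal_resolution (R : comUnitRingType) (X : complex R) a :
  noetherian R -> (forall i, hfg X i) -> (forall i, i < a -> hvan X i) ->
  exists G (f : chain_map (mxc G) X), [/\ bbelow G a, minimal G & quasi_iso f].
Proof.
move=> nR fg below.
have below' i : i <= a - 1 -> hvan X i by move=> ia; apply: below; lia.
exists (resmx nR fg below'), (resmap nR fg below'); split.
- by have := resmx_bbelow nR fg below'; rewrite subrK.
- exact: resmx_minimal.
- exact: resmap_qiso.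
Qed.

(** * Betti numbers *)

Section Betti.
Context {R : comUnitRingType} {k : fieldType} { pi : {rmorphism R -> k}}.
Hypothesis k_residue : residue_map pi.

Implicit Types X Y : complex R.

Let k_residue2 := proj2 k_residue.

Lemma residue_nonunit (r : R) : r \isn't a GRing.unit -> pi r = 0.
Proof. by move=> /k_residue2. Qed.

Lemma homology_basis_hisoat_inv X Y i j (f : {linear X i -> Y j}) n (w : 'I_n -> Y j) :
  hisoat f -> homology_basis pi w -> exists v : 'I_n -> X i, homology_basis pi v.
Proof.
move=> [fc fb fi fs] [wc ws wf]; have /choice [v vP] s := fs _ (wc s).
have cv c : cycle (\sum_s c s *: v s).
  by apply: submodule_comb; [apply: cycle_submodule|move=> s; case: (vP s)].
have fv (c : 'I_n -> R) :
    boundary (f (\sum_s c s *: v s) - \sum_s c s *: w s).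
  rewrite linear_sum -sumrB; apply: submodule_sum => [|s].
    exact: boundary_submodule.
  rewrite linearZ -scalerBr; apply: submoduleZ; first exact: boundary_submodule.
  by case: (vP s).
exists v; split=> [s|x cx|c b].
- by case: (vP s).
- have [c cP] := ws _ (fc _ cx); exists c; apply: fi; first exact: cycleB.
  by rewrite linearB; apply: boundary_trans cP (boundaryBC (fv c)).
- apply: wf; apply: boundary_eq (boundaryBC (fv c)) _; exact: fb.
Qed.

(** Each family expands in the other one, and over the residue field the two
    matrices of coefficients are inverse to each other. *)
Lemma homology_basis_size X i n m (v : 'I_n -> X i) (w : 'I_m -> X i) :
  homology_basis pi v -> homology_basis pi w -> (n <= m)%N.
Proof.
move=> [vc vs vf] [wc ws wf].
have /choice [A AP] t := vs _ (wc t); have /choice [B BP] s := ws _ (vc s).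
pose MA : 'M[k]_(m, n) := \matrix_(t, s) pi (A t s).
pose MB : 'M[k]_(n, m) := \matrix_(s, t) pi (B s t).
suff e : MB *m MA = 1%:M by apply: mulmx1_min e.
apply/matrixP => s u; rewrite !mxE.
have b : boundary (\sum_u' ((s == u')%:R - \sum_t B s t * A t u') *: v u').
  have -> : \sum_u' ((s == u')%:R - \sum_t B s t * A t u') *: v u'
     = (v s - \sum_t B s t *: w t) + \sum_t B s t *: (w t - \sum_u' A t u' *: v u').
    have -> : \sum_u' ((s == u')%:R - \sum_t B s t * A t u') *: v u'
        = v s - \sum_u' \sum_t (B s t * A t u') *: v u'.
      rewrite -[in RHS](scale1r (v s)) (eq_bigr (fun u' =>
        (s == u')%:R *: v u' - \sum_t (B s t * A t u') *: v u')) => [|u' _].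
        rewrite sumrB; congr (_ - _).
        rewrite (bigD1 s) //= eqxx big1 ?addr0 // => u' /negPf.
        by rewrite eq_sym => ->; rewrite scale0r.
      by rewrite scalerBl scaler_suml.
    rewrite exchange_big /= -addrA; congr (_ + _).
    rewrite -sumrN -[in RHS]sumrN -big_split /=; apply: eq_bigr => t _.
    rewrite scalerBr addKr; congr (- _); rewrite scaler_sumr.
    by apply: eq_bigr => u' _; rewrite scalerA.
  apply: boundaryD; first exact: BP.
  by apply: submodule_comb => //; apply: boundary_submodule.
have := vf _ b u; rewrite rmorphB rmorph_nat rmorph_sum => /eqP.
rewrite subr_eq0 => /eqP ->; apply: eq_bigr => t _.
by rewrite !mxE rmorphM.
Qed.

Lemma homology_rankE X i n (v : 'I_n -> X i) :
  homology_basis pi v -> homology_rank pi X i = n.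
Proof.
move=> hv; rewrite /homology_rank; case: xgetP => [m _ [w hw]|no].
  by apply/eqP; rewrite eqn_leq (homology_basis_size hv hw) (homology_basis_size hw hv).
by case: (no n); exists v.
Qed.

Section MinimalRank.
Variables (G : @mxcx R) (mG : minimal G).
Let kk := stalk (residue_module pi).

Lemma residue_scaleE (r : R) (x : residue_module pi) : r *: x = (pi r * x : k).
Proof. by []. Qed.

(** Modulo the maximal ideal the differential of a minimal complex is zero. *)
Lemma minimal_Hom_diff n m (phi : Hom (mxc G) kk n) :
  diff (Hom (mxc G) kk) n m phi = 0.
Proof.
have [e|] := eqVneq n (m + 1); last exact: diff_shape.
apply: hom_ext => i j x; rewrite Hom_diffE // sub0r.
have [j0|jn] := eqVneq j 0; last exact: stalk_eq0.
subst j; have -> : phi (i - 1) 0 (diff (mxc G) i (i - 1) x) = 0; last first.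
  by rewrite scaler0 oppr0.
rewrite (linear_basis (V := kk 0) (phi (i - 1) 0)).
rewrite big1 // => s _; rewrite [LHS]residue_scaleE.
rewrite mxE rmorph_sum big1 ?mul0r // => t _.
by rewrite rmorphM (residue_nonunit (mG _ _)) mulr0.
Qed.

Lemma minimal_homology_basis i :
  exists v : 'I_(rk G i) -> Hom (mxc G) kk (- i), homology_basis pi v.
Proof.
have e : 0 = i + - i by rewrite subrr.
pose val (s : 'I_(rk G i)) (x : 'rV[R]_(rk G i)) : kk 0 := pi (x 0 s).
have val_linear s : linear (val s).
  by move=> r x y; rewrite /val !mxE rmorphD rmorphM.
pose v s : Hom (mxc G) kk (- i) :=
  @homat R (mxc G) kk (- i) i 0 e (lin_of (val_linear s)).
have vsE s (x : mxc G i) : (v s : hom _ _ _) i 0 x = val s x.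
  exact: (@homat_id R (mxc G) kk).
have vE (c : 'I_(rk G i) -> R) u :
    (\sum_s c s *: v s : hom _ _ _) i 0 (bs u) = pi (c u) :> k.
  have -> : (\sum_s c s *: v s : hom _ _ _) i 0 (bs u)
      = \sum_s c s *: (v s : hom _ _ _) i 0 (bs u).
    by elim/big_rec2: _ => //= s y1 y2 _ <-.
  rewrite (bigD1 u) // big1 => [|s su].
    by rewrite [LHS]addr0 vsE /val mxE !eqxx residue_scaleE rmorph1 mulr1.
  have {}su : s != u := su.
  by rewrite vsE /val mxE eqxx (negPf su) rmorph0 scaler0.
exists v; split=> [s|phi _|c [psi]].
- exact: minimal_Hom_diff.
- have /choice [c cP] u : exists r : R, pi r = (phi : hom _ _ _) i 0 (bs u).
    exact: (proj1 k_residue).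
  exists c; suff -> : phi = \sum_s c s *: v s by rewrite subrr; apply: boundary0.
  apply: hom_ext => j l x; have [l0|ne] := eqVneq l 0; last first.
    by rewrite [LHS](stalk_eq0 _ ne) [RHS](stalk_eq0 _ ne).
  subst l; have [ji|ji] := eqVneq j i; last first.
    by rewrite !Hom_ne //; apply: contraNneq ji; lia.
  subst j; apply: (eq_on_basis (V := kk 0) (f := phi i 0)
    (g := (\sum_s c s *: v s : hom _ _ _) i 0)) => u.
  by rewrite [RHS]vE cP.
- by rewrite minimal_Hom_diff => h s; rewrite -vE -h.
Qed.

End MinimalRank.

(** The complex of maps from a minimal complex to the residue field has zero
    differential, so that its homology is read off from the ranks. *)
Lemma betti_minimal G a X i : minimal G -> bbelow G a -> D_iso (mxc G) X ->
  betti pi X i = rk G i.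
Proof.
move=> mG bG GX; have pG := mxc_K_projective bG.
have [h [_ /quasi_isoP qh]] := RHom_qiso (stalk (residue_module pi)) pG GX.
have [w bw] := minimal_homology_basis mG i.
have [v bv] := homology_basis_hisoat_inv (qh (- i)) bw.
exact: homology_rankE bv.
Qed.

End Betti.

(** * Finiteness of homology of Hom complexes *)

Section HomFiltration.
Context {R : comUnitRingType}.
Variables (G : @mxcx R) (N : complex R) (n : int).
Let H := Hom (mxc G) N.
Variable Q : H n -> Prop.
Hypothesis subQ : submodule Q.

Definition cycle_at (phi : H n) i : Prop := forall j (x : mxc G i),
  diff N (j + 1) j (phi i (j + 1) x)
    = sign n *: phi (i - 1) j (diff (mxc G) i (i - 1) x).

(** The steps in which obstruction theory builds a primitive: degree by degree,
    and one basis element at a time within each degree. *)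
Definition filt i (s : nat) (phi : H n) : Prop :=
  Q phi /\ exists theta : H (n + 1),
    vanish_below (phi - diff H (n + 1) n theta : H n) i /\
    forall u : 'I_(rk G i), (u < s)%N ->
      boundary ((phi - diff H (n + 1) n theta : H n) i (i + n) (bs u)).

Lemma filt_submodule i s : submodule (filt i s).
Proof.
split=> [|c phi psi [Qphi [th [v b]]] [Qpsi [th' [v' b']]]].
  split; first by case: subQ.
  by exists 0; rewrite linear0 subr0; split=> // u _; apply: boundary0.
split; first by case: subQ => _; apply.
exists (c *: th + th').
have -> : c *: phi + psi - diff H (n + 1) n (c *: th + th')
  = c *: (phi - diff H (n + 1) n th) + (psi - diff H (n + 1) n th').
  by rewrite linearP opprD addrACA -scalerBr.
split=> [j l x ji|u us]; first by rewrite hom_addE hom_scaleE v // v' // scaler0 addr0.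
rewrite hom_addE hom_scaleE.
by case: (boundary_submodule N (i + n)) => _; apply; [apply: b|apply: b'].
Qed.

Lemma filt_dec i s s' phi : (s <= s')%N -> filt i s' phi -> filt i s phi.
Proof.
move=> ss [Qphi [th [v b]]]; split=> //; exists th; split=> // u us.
by apply: b; apply: leq_trans us ss.
Qed.

Lemma filt_dec1 i s phi : filt (i + 1) 0 phi -> filt i s phi.
Proof.
move=> [Qphi [th [v _]]]; split=> //; exists th; split=> [j l x ji|u _].
  by apply: v; lia.
by rewrite v; [apply: boundary0|lia].
Qed.

Lemma filt_next i phi : filt i (rk G i) phi -> filt (i + 1) 0 phi.
Proof.
move=> [Qphi [th [v b]]].
have [u|g [_ gv]] := cell_kill v; first exact/b/ltn_ord.
split=> //; exists (th + g); split=> //.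
by rewrite linearD opprD addrA.
Qed.

(** The value on the next basis element is a cycle of [N], and its class is the
    obstruction to entering the next step of the filtration. *)
Lemma filt_step i (s : 'I_(rk G i)) : (forall phi, Q phi -> cycle_at phi i) ->
  exists S : N (i + n) -> Prop,
    [/\ submodule S, forall x, S x -> cycle x &
        forall h, ngen h S (@boundary R N (i + n)) ->
          ngen h (filt i s) (filt i s.+1)].
Proof.
move=> Qc.
pose rel (phi : H n) (w : N (i + n)) := exists theta : H (n + 1),
  [/\ vanish_below (phi - diff H (n + 1) n theta : H n) i,
      forall u : 'I_(rk G i), (u < s)%N ->
        boundary ((phi - diff H (n + 1) n theta : H n) i (i + n) (bs u)) &
      w = (phi - diff H (n + 1) n theta : H n) i (i + n) (bs s)].
have rel0 : rel 0 0.
  exists 0; rewrite linear0 subr0; split=> // u _; exact: boundary0.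
have relL a phi psi w w' : rel phi w -> rel psi w' -> rel (a *: phi + psi) (a *: w + w').
  move=> [th [v b ->]] [th' [v' b' ->]]; exists (a *: th + th').
  have -> : a *: phi + psi - diff H (n + 1) n (a *: th + th')
    = a *: (phi - diff H (n + 1) n th) + (psi - diff H (n + 1) n th').
    by rewrite linearP opprD addrACA -scalerBr.
  split=> [j l x ji|u us|//].
    by rewrite hom_addE hom_scaleE v // v' // scaler0 addr0.
  rewrite hom_addE hom_scaleE.
  by case: (boundary_submodule N (i + n)) => _; apply; [apply: b|apply: b'].
exists (fun w => cycle w /\ exists phi, filt i s phi /\ rel phi w); split.
- split=> [|a w w' [cw [phi [Fphi rphi]]] [cw' [psi [Fpsi rpsi]]]].
    split; first exact: linear0.
    by exists 0; split=> //; case: (filt_submodule i s).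
  split; first by case: (cycle_submodule N (i + n)) => _; apply.
  exists (a *: phi + psi); split; last exact: relL.
  by case: (filt_submodule i s) => _; apply.
- by move=> x [].
move=> h; apply: (@ngen_rel _ _ _ _ _ (@cycle R N (i + n)) _ rel) => //.
- exact: filt_submodule.
- exact: cycle_submodule.
- move=> phi [Qphi [th [v b]]].
  exists ((phi - diff H (n + 1) n th : H n) i (i + n) (bs s)); split; last by exists th.
  have c1 := Qc phi Qphi (i + n - 1) (bs s).
  have /Hom_cycleP /(_ i (i + n - 1) (bs s)) c2 :
    cycle (diff H (n + 1) n th) by apply: cycle_diff.
  have e : i + n - 1 + 1 = i + n by rewrite subrK.
  rewrite e in c1 c2.
  have E p q (x : mxc G p) : (phi - diff H (n + 1) n th : H n) p q x
    = (phi p q x : N q) - (diff H (n + 1) n th : hom _ _ _) p q x by [].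
  rewrite /cycle E linearB /= c1 c2 -scalerBr -E v ?scaler0 //; lia.
- move=> phi w [Qphi _] [th [v b ->]] bw; split=> //; exists th; split=> // u.
  rewrite ltnS leq_eqVlt => /orP[/eqP us|]; last exact: b.
  by have -> : u = s by apply/val_inj.
Qed.

Lemma filt_chain (h : int -> nat -> nat) (a : int) (L : nat) :
  (forall i s, a <= i < a + Posz L -> (s < rk G i)%N ->
     ngen (h i s) (filt i s) (filt i s.+1)) ->
  ngen (\sum_(l < L) \sum_(s < rk G (a + Posz l)%R) h (a + Posz l)%R s)
    (filt a 0) (filt (a + Posz L) 0).
Proof.
move=> step; rewrite -[X in filt X 0](addr0 a).
apply: (@ngen_chain _ _ (fun l : nat => \sum_(s < rk G (a + Posz l)%R) h (a + Posz l)%R s)%N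
  (fun l => filt (a + Posz l) 0)).
- by move=> l; apply: filt_submodule.
- move=> l phi F; apply: filt_dec1.
  by have -> : a + Posz l + 1 = a + Posz l.+1 by lia.
move=> l lL; set i := a + Posz l.
apply: (@ngen_eq _ _ _ (filt i 0) _ (filt i (rk G i))) => //.
  move=> phi /filt_next.
  by have -> : i + 1 = a + Posz l.+1 by rewrite /i; lia.
apply: (@ngen_chain _ _ (h i) (fun s => filt i s)).
- by move=> s; apply: filt_submodule.
- by move=> s phi; apply: filt_dec.
- by move=> s sr; apply: step => //; rewrite /i; lia.
Qed.

End HomFiltration.

Section HomFinite.
Context {R : comUnitRingType}.
Hypothesis R_noetherian : noetherian R.
Variables (G : @mxcx R) (a : int) (bG : bbelow G a).
Variables (N : complex R) (t : int).
Hypothesis N_above : forall j, t < j -> hvan N j.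
Hypothesis N_fg : forall j, hfg N j.

(** The filtration is everything below the lowest degree of [G], and it
    consists of boundaries once the target degrees exceed [t]. *)
Lemma hfg_Hom n : hfg (Hom (mxc G) N) n.
Proof.
pose Q := @cycle R (Hom (mxc G) N) n.
have subQ : submodule Q by apply: cycle_submodule.
have Qc i phi : Q phi -> cycle_at phi i by move=> /Hom_cycleP h j x; apply: h.
have /choice [h hP] : forall i, exists h : nat -> nat, forall s, (s < rk G i)%N ->
    ngen (h s) (filt Q i s) (filt Q i s.+1).
  move=> i; suff /choice [h hP] : forall s, exists hs, (s < rk G i)%N ->
    ngen hs (filt Q i s) (filt Q i s.+1) by exists h.
  move=> s; have [sr|_] := ltnP s (rk G i); last by exists 0%N.
  have [S [subS Sc Sh]] := filt_step subQ (Ordinal sr) (Qc i).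
  have [hs /Sh] : fgmod S (@boundary R N (i + n)).
    exact: (fgmod_sub R_noetherian (boundary_submodule _ _) subS Sc (N_fg _)).
  by exists hs.
pose L := absz (Num.max 0 (t - n + 1 - a)).
have := @filt_chain _ _ _ _ _ subQ h a L (fun i s _ => hP i s).
set M := (X in ngen X _ _) => gen; exists M; apply: ngen_eq gen => phi.
  split=> [[]//|cphi]; split=> //; exists 0; rewrite linear0 subr0; split=> //.
  exact: bbelow_vanish.
move=> [cphi [th [v _]]].
have [||g [_ gP]] := cycle_kill _ v.
- by apply: cycleB => //; apply: cycle_diff.
- by move=> j jL; apply: N_above; rewrite /L in jL; lia.
by rewrite -[phi](subrK (diff (Hom (mxc G) N) (n + 1) n th)) -gP -linearD;
  apply: boundary_diff.
Qed.

End HomFinite.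

(** * Growth of the ranks of a minimal complex *)

Section RankBound.
Context {R : comUnitRingType} {k : fieldType} { pi : {rmorphism R -> k}}.
Hypothesis k_residue : residue_map pi.

(** Over the residue field the generators give a factorization of the identity
    matrix of size [p] through a space of dimension [N]. *)
Lemma ngen_residue p N :
  ngen N (fun _ : 'rV[R]_p => True) (fun x => forall s, x 0 s \isn't a GRing.unit) ->
  (p <= N)%N.
Proof.
move=> [g [_ gP]].
have /choice [c cP] s := gP (delta_mx 0 s) I.
pose A : 'M[k]_(p, N) := \matrix_(s, u) pi (c s u).
pose B : 'M[k]_(N, p) := \matrix_(u, s) pi (g u 0 s).
suff e : A *m B = 1%:M by apply: mulmx1_min e.
apply/matrixP => s s'; have /(residue_nonunit k_residue) := cP s s'.
rewrite !mxE rmorphB rmorph_nat summxE rmorph_sum /= => /eqP.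
rewrite subr_eq0 eq_sym => /eqP h.
transitivity ((s' == s)%:R : k); last by rewrite eq_sym.
by rewrite -h; apply: eq_bigr => u _; rewrite !mxE rmorphM.
Qed.

Variables (G : @mxcx R) (a : int) (bG : bbelow G a) (mG : minimal G).
Variables (N : complex R) (t : int) (h : int -> nat) (w : N t).
Hypothesis N_above : forall j, t < j -> hvan N j.
Hypothesis N_bgen : forall j, bgen (h j) (@cycle R N j) (@boundary R N j).
Hypothesis w_cycle : cycle w.
Hypothesis w_nonzero : ~ boundary w.
Hypothesis w_socle : forall r, r \isn't a GRing.unit -> boundary (r *: w).

(** Send the basis element [s] in degree [m] to [x_s w]. The defect from being
    a cycle starts in degree [m + 1], where it lies in the boundaries by
    minimality and the socle condition; beyond, [N] has no homology. *)
Lemma socle_cycle m n (x : 'rV[R]_(rk G m)) : t = m + (n + 1) ->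
  exists psi : Hom (mxc G) N (n + 1),
    [/\ cycle psi, vanish_below (psi : hom _ _ _) m &
        forall s, psi m t (bs s) = x 0 s *: w].
Proof.
move=> tE; set d := diff (Hom (mxc G) N) (n + 1) n.
pose f : {linear 'rV[R]_(rk G m) -> N t} := bmap (fun s => x 0 s *: w).
pose psi0 : Hom (mxc G) N (n + 1) := @homat R (mxc G) N (n + 1) m t tE f.
have psi0E y : psi0 m t y = f y by exact: (@homat_id R (mxc G) N).
have dpsi0 : vanish_below (d psi0 : hom _ _ _) (m + 1).
  move=> i j y im; rewrite Hom_diffE // [X in _ *: X]homat_ne ?scaler0 ?subr0; last by lia.
  have [im'|im'] := eqVneq i m; last by rewrite homat_ne // linear0.
  subst i; have [jt|jt] := eqVneq (j + 1) t; last by rewrite Hom_ne ?linear0 // -tE.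
  rewrite jt psi0E.
  apply: (eq_on_basis (f := diff N t j \o f : {linear _ -> _}) (g := \0)) => s.
  rewrite /= bmap_delta.
  by rewrite linearZ /= (proj1 (cycleP w)) ?scaler0.
have [s|g1 [g1v g1P]] := cell_kill dpsi0.
  rewrite Hom_diffE // homat_ne ?linear0 ?sub0r; last by lia.
  apply: boundaryN; apply: submoduleZ; first exact: boundary_submodule.
  have aux j : j = t ->
      boundary (psi0 (m + 1 - 1) j (diff (mxc G) (m + 1) (m + 1 - 1) (bs s))); last first.
    by apply: aux; lia.
  move=> ->; rewrite (addrK 1 m).
  rewrite psi0E bmapE; apply: submodule_sum => [|u].
    exact: boundary_submodule.
  rewrite scalerA mulrC -scalerA; apply: submoduleZ; first exact: boundary_submodule.
  apply: w_socle; rewrite mxE (bigD1 s) //= mxE !eqxx mul1r big1 ?addr0 // => v vs.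
  by rewrite mxE eqxx (negPf vs) mul0r.
have [||g2 [g2v g2P]] := cycle_kill _ g1P.
- by apply: cycleB; apply: cycle_diff.
- by move=> j jt; apply: N_above; lia.
exists (psi0 - g1 - g2); split.
- apply/cycleP => j; have [e|ne] := eqVneq j n; last first.
    by apply: diff_shape; apply: contraNneq ne => /addIr ->.
  by subst j; rewrite !linearB -/d g2P subrr.
- move=> i j y im; rewrite !hom_addE.
  rewrite homat_ne ?add0r; last by lia.
  transitivity (- (g1 : hom _ _ _) i j y - (g2 : hom _ _ _) i j y) => //.
  by rewrite g1v ?g2v ?oppr0 ?addr0 //; lia.
- move=> s; transitivity (psi0 m t (bs s) - (g1 : hom _ _ _) m t (bs s)
    - (g2 : hom _ _ _) m t (bs s)) => //.
  rewrite g1v ?g2v ?subr0; [|lia..].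
  by rewrite psi0E bmap_delta.
Qed.

(** The cycles of [socle_cycle] are boundaries. A primitive that lies in step [m]
    of the filtration realizes only rows with entries in the maximal ideal, so
    the generators of the steps before [m] bound the number of rows that are
    independent over the residue field. *)
Lemma rank_bound m n L : t = m + (n + 1) -> m = a + Posz L ->
  hvan (Hom (mxc G) N) (n + 1) ->
  (rk G m <= \sum_(l < L) rk G (a + Posz l)%R * h (a + Posz l + (n + 1 + 1))%R)%N.
Proof.
move=> tE mE van; apply: ngen_residue.
set d := diff (Hom (mxc G) N) (n + 1 + 1) (n + 1).
pose rel (x : 'rV[R]_(rk G m)) (phi : Hom (mxc G) N (n + 1 + 1)) :=
  vanish_below (d phi : hom _ _ _) m /\
  forall s, boundary ((d phi : hom _ _ _) m t (bs s) - x 0 s *: w).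
have rel0 : rel 0 0.
  rewrite /rel [d 0]linear0; split=> // s.
  by rewrite mxE scale0r subrr; apply: boundary0.
have relL c x x' phi phi' :
    rel x phi -> rel x' phi' -> rel (c *: x + x') (c *: phi + phi').
  move=> [v b] [v' b']; rewrite /rel [d (_ + _)]linearP; split=> [i j y im|s].
    by rewrite hom_addE hom_scaleE v // v' // scaler0 addr0.
  rewrite hom_addE hom_scaleE !mxE scalerDl -scalerA opprD addrACA -scalerBr.
  by case: (boundary_submodule N t) => _; apply.
pose Q phi := exists x, rel x phi.
have subQ : submodule Q.
  split=> [|c phi phi' [x hx] [x' hx']]; first by exists 0.
  by exists (c *: x + x'); apply: relL.
have Qc i phi : i < m -> Q phi -> cycle_at phi i.
  move=> im [x [v _]] j y; have := v i j y im.
  by rewrite Hom_diffE // => /eqP; rewrite subr_eq0 => /eqP.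
have gen : ngen (\sum_(l < L) rk G (a + Posz l)%R * h (a + Posz l + (n + 1 + 1))%R)%N
    (filt Q a 0) (filt Q m 0).
  have -> : (\sum_(l < L) rk G (a + Posz l)%R * h (a + Posz l + (n + 1 + 1))%R)%N
     = (\sum_(l < L) \sum_(s < rk G (a + Posz l)%R) h (a + Posz l + (n + 1 + 1))%R)%N.
    by apply: eq_bigr => l _; rewrite sum_nat_const card_ord.
  rewrite mE; apply: (@filt_chain _ _ _ _ _ subQ (fun i _ => h (i + (n + 1 + 1)))).
  move=> i s /andP[_ iL] sr.
  have im : i < m by rewrite mE.
  have [S [subS Sc]] := filt_step subQ (Ordinal sr) (fun phi => @Qc i phi im).
  by apply; apply: N_bgen.
have Qfilt phi : Q phi -> filt Q a 0 phi.
  move=> Qphi; split=> //; exists 0; rewrite linear0 subr0; split=> //.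
  exact: bbelow_vanish.
apply: (@ngen_rel _ _ _ _ _ (filt Q a 0) (filt Q m 0) rel) => //.
- exact: filt_submodule.
- move=> x _; have [psi [cpsi v psiE]] := socle_cycle x tE.
  have [phi phiE] := van _ cpsi; exists phi.
  split; first apply: Qfilt; [exists x|]; rewrite /rel [d phi]phiE;
    by split=> // s; rewrite psiE subrr; apply: boundary0.
- move=> x phi _ [_ b] [_ [th [v _]]] s; apply/negP => us.
  apply: w_nonzero; rewrite -[w]scale1r -(mulVr us) -scalerA.
  apply: submoduleZ; first exact: boundary_submodule.
  apply: boundary_eq (boundaryBC (b s)) _.
  pose phi' := phi - diff (Hom (mxc G) N) (n + 1 + 1 + 1) (n + 1 + 1) th.
  have -> : d phi = d phi' by rewrite [RHS]linearB [X in _ - X]diff_diff subr0.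
  rewrite Hom_diffE // [X in _ *: X](v) ?scaler0 ?subr0; last by lia.
  exact: boundary_diff.
apply: ngen_eq gen => // phi; split=> [F|[]//]; split=> //.
by have [[x hx] _] := F; exists x.
Qed.

End RankBound.

(** * Koszul-type cones and exponential growth *)

Section FiniteLength.
Context {R : comUnitRingType} {k : fieldType} { pi : {rmorphism R -> k}}.
Hypothesis k_residue : residue_map pi.
Hypothesis R_noetherian : noetherian R.

(** Modulo [U] the module [T] is a vector space over the residue field, so
    that no subspace needs more generators than [T]. *)
Lemma bgen_residue (V : lmodType R) (T U : V -> Prop) n : submodule U ->
  ngen n T U -> (forall r v, r \isn't a GRing.unit -> T v -> U (r *: v)) ->
  bgen n T U.
Proof.
move=> subU [g [Tg gP]] kill S subS ST.
have fgS : fgmod S U.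
  by apply: (fgmod_sub R_noetherian subU subS ST); exists n, g.
have [q [h [Sh hP hmin]]] := fgmod_minimal subU fgS.
have [qn|nq] := leqP q n; first by apply: ngen_le qn _; [case: subS|exists h].
have /choice [A AP] l := gP _ (ST _ (Sh l)).
pose MA : 'M[k]_(q, n) := \matrix_(l, u) pi (A l u).
have : kermx MA != 0.
  rewrite -mxrank_eq0 mxrank_ker -lt0n subn_gt0.
  exact: leq_ltn_trans (rank_leq_col MA) nq.
move=> /rowV0Pn [c /sub_kermxP cA /eqP c0].
have /choice [c' c'P] l := proj1 k_residue (c 0 l).
case: c0; apply/rowP => l; rewrite mxE -c'P; apply: (residue_nonunit k_residue).
apply: hmin.
have -> : \sum_s c' s *: h s = \sum_s c' s *: (h s - \sum_u A s u *: g u)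
    + \sum_u (\sum_s c' s * A s u) *: g u.
  have -> : \sum_u (\sum_s c' s * A s u) *: g u
      = \sum_s c' s *: \sum_u A s u *: g u.
    under eq_bigr do rewrite scaler_suml; rewrite exchange_big /=.
    apply: eq_bigr => s _; rewrite scaler_sumr; apply: eq_bigr => u _.
    by rewrite scalerA.
  rewrite -big_split /=; apply: eq_bigr => s _.
  by rewrite scalerBr subrK.
apply: submoduleD => //; first exact: submodule_comb.
apply: submodule_sum => // u; apply: kill => //.
apply/(proj2 k_residue); rewrite rmorph_sum.
have /rowP /(_ u) := cA; rewrite !mxE => h0; rewrite -[RHS]h0.
by apply: eq_bigr => s _; rewrite rmorphM c'P mxE.
Qed.

(** The last hypothesis says that the maximal ideal maps [T] into [U + xs T].
    The powers of the first element of [xs] filter [T] by finitely many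
    quotients, which that element kills. *)
Lemma bgen_nilpotent (xs : seq R) (V : lmodType R) (T U : V -> Prop) :
  submodule T -> submodule U -> (forall v, U v -> T v) -> fgmod T U ->
  (forall x, x \in xs -> exists e, forall v, T v -> U (x ^+ e *: v)) ->
  (forall r W, r \isn't a GRing.unit -> submodule W -> (forall v, U v -> W v) ->
     (forall x v, x \in xs -> T v -> W (x *: v)) ->
     forall v, T v -> W (r *: v)) ->
  exists n, bgen n T U.
Proof.
elim: xs T U => [|x xs IH] T U subT subU UT fgT nil gen.
  have [n hn] := fgT; exists n; apply: bgen_residue => // r v nr Tv.
  exact: (gen r U).
pose Tx i v := exists v' u, [/\ T v', U u & v = x ^+ i *: v' + u].
have subTx i : submodule (Tx i).
  split=> [|a v w [v1 [u1 [Tv1 Uu1 ->]]] [v2 [u2 [Tv2 Uu2 ->]]]].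
    by exists 0, 0; rewrite scaler0 addr0; case: subT subU => ? _ [? _].
  exists (a *: v1 + v2), (a *: u1 + u2); split; [by apply: (proj2 subT)|
    by apply: (proj2 subU)|].
  by rewrite !scalerDr !scalerA addrACA mulrC.
have TxT i v : Tx i v -> T v.
  move=> [v' [u [Tv' Uu ->]]]; apply: submoduleD => //; last exact: UT.
  exact: submoduleZ.
have UTx i v : U v -> Tx i v.
  by move=> Uv; exists 0, v; rewrite scaler0 add0r; case: subT.
have step i : exists n, bgen n (Tx i) (Tx i.+1).
  apply: IH => //.
  - move=> _ [v' [u [Tv' Uu ->]]]; exists (x *: v'), u.
    by rewrite scalerA -exprSr; split=> //; apply: submoduleZ.
  - apply: (fgmod_sub R_noetherian (subTx _) (subTx i) (TxT i)).
    have [n hn] := fgT; exists n; apply: ngen_eq hn => //; exact: UTx.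
  - move=> y yxs; have [|e eP] := nil y; first by rewrite inE yxs orbT.
    by exists e => v /TxT /eP; apply: UTx.
  move=> r W nr subW TxW xsW _ [v' [u [Tv' Uu ->]]].
  rewrite scalerDr scalerA mulrC -scalerA.
  apply: submoduleD => //; last by apply/TxW/UTx; apply: submoduleZ.
  apply: (gen r (fun v => W (x ^+ i *: v))) => //.
  - split=> [|a v w Wv Ww]; first by rewrite scaler0; case: subW.
    by rewrite scalerDr scalerA mulrC -scalerA; case: subW => _; apply.
  - by move=> v Uv; apply/TxW/UTx; apply: submoduleZ.
  move=> y v; rewrite inE => /orP[/eqP ->|yxs] Tv.
    by apply: TxW; exists v, 0; rewrite addr0 scalerA -exprSr; case: subU.
  rewrite scalerA mulrC -scalerA; apply: xsW => //.
  by exists v, 0; rewrite addr0; case: subU.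
have [|e eP] := nil x; first by rewrite inE eqxx.
have chain i : exists n, bgen n T (Tx i).
  elim: i => [|i [n hn]].
    exists 0%N => S subS ST; exists (fun=> 0); split=> [[]//|v Sv].
    exists (fun=> 0); rewrite big_ord0 subr0; exists v, 0.
    by rewrite scale1r addr0; split=> //; [apply: ST|case: subU].
  by have [m hm] := step i; exists (n + m)%N; apply: bgen_ext hn hm.
have [n hn] := chain e; exists n => S subS ST.
apply: ngen_eq (hn S subS ST) => // v [v' [u [Tv' Uu ->]]].
by apply: submoduleD => //; apply: eP.
Qed.

End FiniteLength.

Section LocalAlgebra.
Context {R : comUnitRingType}.
Hypothesis R_noetherian : noetherian R.
Hypothesis R_local : local_ring R.

Lemma nonunitM (x y : R) : x \isn't a GRing.unit -> x * y \isn't a GRing.unit.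
Proof. by move=> nx; rewrite unitrM negb_and nx. Qed.

(** If the first of finitely many minimal generators is [x] times a cycle, it
    satisfies a relation in which its own coefficient is a unit. *)
Lemma nakayama (X : complex R) i (x : R) : hfg X i -> x \isn't a GRing.unit ->
  (forall y : X i, cycle y -> exists z, cycle z /\ boundary (x *: z - y)) ->
  hvan X i.
Proof.
move=> fg nx surj.
have [n [g [gc gP gmin]]] := fgmod_minimal (boundary_submodule X i) fg.
case: n g gc gP gmin => [|n] g gc gP gmin.
  by move=> y /gP [c]; rewrite big_ord0 subr0.
have [z [cz zb]] := surj _ (gc ord0); have [c cP] := gP z cz.
have b : boundary (\sum_s (x * c s - (s == ord0)%:R) *: g s).
  have -> : \sum_s (x * c s - (s == ord0)%:R) *: g s
      = (x *: z - g ord0) - x *: (z - \sum_s c s *: g s).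
    have e : \sum_s (s == ord0)%:R *: g s = g ord0.
      rewrite (bigD1 ord0) // eqxx scale1r big1 => [|s /negPf ->]; first exact: addr0.
      by rewrite scale0r.
    rewrite -[in RHS]e scalerBr opprB [RHS]addrC addrA subrK scaler_sumr -sumrB.
    by apply: eq_bigr => s _; rewrite scalerBl scalerA.
  apply: boundaryB => //; apply: submoduleZ => //; exact: boundary_submodule.
have := gmin _ b ord0; rewrite eqxx => nu.
have := R_local (nonunitM (c ord0) nx) (_ : - (x * c ord0 - 1) \isn't a GRing.unit).
by rewrite unitrN opprB addrCA subrr addr0 unitr1 => /(_ nu).
Qed.

Section MulCone.
Variables (Y : complex R) (x : R).

Lemma mul_map_diff i j (y : Y i) :
  (x \*: idfun) (diff Y i j y) = diff Y i j ((x \*: idfun) y).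
Proof. by rewrite /= linearZ. Qed.

Definition mul_map : chain_map Y Y :=
  @ChainMap R Y Y (fun i => x \*: idfun : {linear _ -> _}) mul_map_diff.

Definition mul_cone : complex R := cone mul_map.

Definition kills (X : complex R) (z : R) : Prop :=
  exists e, forall j (y : X j), cycle y -> boundary (z ^+ e *: y).

(** The map [(z, y) |-> (0, z)] is a homotopy from multiplication by [x] to
    zero. *)
Lemma mul_cone_kills : kills mul_cone x.
Proof.
exists 1%N => j [z y] /cone_cycleP [_ e]; rewrite expr1.
exists (0, tr Y j (j + 1 - 1) z); rewrite cone_diffS linear0 add0r e opprK.
by [].
Qed.

(** The homology of the cone is an extension of two modules that are killed by
    a power of [z]. *)
Lemma kills_mul_cone z : kills Y z -> kills mul_cone z.
Proof.
move=> [e eP]; exists (e + e)%N => j u cu; rewrite exprD -scalerA.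
have cu2 : cycle u.2 by case: u cu => u1 u2 /cone_cycleP [].
have cv : cycle (z ^+ e *: u) by apply: submoduleZ cu; apply: cycle_submodule.
have [w [cw b]] := cone_reduce cv (eP _ _ cu2).
apply: (@boundary_eq _ _ _ _ (z ^+ e *: ((w, 0) : mul_cone j))).
  by rewrite -scalerBr; apply: submoduleZ b; apply: boundary_submodule.
rewrite (_ : z ^+ e *: _ = (z ^+ e *: w, 0)); last by congr pair; rewrite /= scaler0.
exact/cone_inl_boundary/eP.
Qed.

Lemma mul_cone_fg : (forall i, hfg Y i) -> forall i, hfg mul_cone i.
Proof.
move=> fg i; pose T (u : mul_cone i) := boundary u.2.
have subT : submodule T.
  split=> [|a u v Tu Tv]; first exact: boundary0.
  by case: (boundary_submodule Y (i - 1)) => _; apply.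
have subC := cycle_submodule mul_cone i.
have [n hn] : fgmod (@cycle R mul_cone i) T.
  pose rel (u : mul_cone i) y := u.2 = y.
  have fgS : fgmod (fun y => cycle y /\ exists u, cycle u /\ rel u y)
      (@boundary R Y (i - 1)).
    apply: (fgmod_sub R_noetherian (boundary_submodule _ _) _ _ (fg (i - 1))).
      split=> [|a y y' [cy [u [cu eu]]] [cy' [u' [cu' eu']]]].
        by split; [exact: linear0|exists 0; split=> //; case: subC].
      split; first by case: (cycle_submodule Y (i - 1)) => _; apply.
      exists (a *: u + u'); split; last by rewrite /rel /= eu eu'.
      by case: subC => _; apply.
    by move=> y [].
  have [n hn] := fgS; exists n; apply: ngen_rel hn => //.
  - exact: cycle_submodule.
  - by move=> a u u' y y' <- <-.
  - by move=> [z y] cu; exists y; split=> //; case/cone_cycleP: cu.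
  - by move=> u y _ <-.
have [m hm] : fgmod (fun u : mul_cone i => cycle u /\ T u) (@boundary R mul_cone i).
  pose rel (u : mul_cone i) (z : Y i) := boundary (u - ((z, 0) : mul_cone i)).
  have relE a (z z' : Y i) : ((a *: z + z', 0) : mul_cone i) = a *: ((z, 0) : mul_cone i) + (z', 0).
    by congr pair; rewrite /= scaler0 addr0.
  have rel0 : rel 0 0 by rewrite /rel subrr; apply: boundary0.
  have relL a u u' z z' : rel u z -> rel u' z' -> rel (a *: u + u') (a *: z + z').
    move=> h h'; rewrite /rel relE opprD addrACA -scalerBr.
    by case: (boundary_submodule mul_cone i) => _; apply.
  have fgS : fgmod (fun z => cycle z /\ exists u, (cycle u /\ T u) /\ rel u z)
      (@boundary R Y i).
    apply: (fgmod_sub R_noetherian (boundary_submodule _ _) _ _ (fg i)).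
      split=> [|a y y' [cy [u [Fu ru]]] [cy' [u' [Fu' ru']]]].
        split; first exact: linear0.
        by exists 0; split=> //; split; [case: subC|case: subT].
      split; first by case: (cycle_submodule Y i) => _; apply.
      exists (a *: u + u'); split; last exact: relL.
      by have [_ h] := submoduleI subC subT; apply: h.
    by move=> y [].
  have [m hm] := fgS; exists m; apply: ngen_rel hm => //.
  - exact: submoduleI.
  - exact: cycle_submodule.
  - by move=> u [cu Tu]; apply: cone_reduce.
  - by move=> u z _ b bz; apply: boundary_eq b _; apply: cone_inl_boundary.
by exists (n + m)%N; apply: ngen_ext hn hm.
Qed.

End MulCone.

(** Conditions that pass from [Y] to the cone of a nonunit on [Y]. *)
Definition testing (P Y : complex R) : Prop :=
  [/\ forall i, hfg Y i, exists t, forall j, t < j -> hvan Y j,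
      exists l, forall j, j < l -> hvan Y j, ~ acyclic Y &
      exists j0, forall j, j < j0 -> hvan (Hom P Y) j].

Lemma mul_cone_testing P Y x : x \isn't a GRing.unit ->
  testing P Y -> testing P (mul_cone Y x).
Proof.
move=> nx [fg [t above] [l below] nac [j0 hom_below]]; split.
- exact: mul_cone_fg.
- by exists (t + 1) => j jt; apply: cone_van; apply: above; lia.
- by exists l => j jl; apply: cone_van; apply: below; lia.
- move=> ac; apply: nac => i; apply: (nakayama (fg i) nx) => y cy.
  by have [_ surj] := acyclic_cone_qiso ac i; apply: surj.
- exists j0 => j jj; have /quasi_isoP h := hom_cone_qiso P (mul_map Y x).
  by apply/(hisoat_van (h j))/cone_van; apply: hom_below; lia.
Qed.

Lemma killed_testing P Y (xs : seq R) : (forall x, x \in xs -> x \isn't a GRing.unit) ->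
  testing P Y ->
  exists Y', testing P Y' /\ forall x, x \in xs -> kills Y' x.
Proof.
elim: xs => [|x xs IH] nxs tY; first by exists Y.
have [|Y' [tY' kY']] := IH _ tY.
  by move=> y yxs; apply: nxs; rewrite inE yxs orbT.
exists (mul_cone Y' x); split.
  by apply: mul_cone_testing tY'; apply: nxs; rewrite inE eqxx.
move=> y; rewrite inE => /orP[/eqP ->|/kY']; first exact: mul_cone_kills.
exact: kills_mul_cone.
Qed.

(** Multiply by the last power of each element of [xs] that does not turn [w]
    into a boundary. *)
Lemma socle_element (Y : complex R) t (xs : seq R) (w : Y t) : (forall x, x \in xs -> kills Y x) ->
  cycle w -> ~ boundary w ->
  exists w' : Y t, [/\ cycle w', ~ boundary w' &
    forall x, x \in xs -> boundary (x *: w')].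
Proof.
elim: xs => [|x xs IH] kxs cw nw; first by exists w.
have [|w1 [cw1 nw1 xw1]] := IH _ cw nw.
  by move=> y yxs; apply: kxs; rewrite inE yxs orbT.
have [|e eP] := kxs x; first by rewrite inE eqxx.
have ex : exists e, `[< boundary (x ^+ e *: w1) >] by exists e; apply/asboolP/eP.
have [e' /asboolP be' emin] := ex_minnP ex.
case: e' be' emin => [|e'] be' emin; first by case: nw1; rewrite scale1r in be'.
exists (x ^+ e' *: w1); split.
- by apply: submoduleZ cw1; apply: cycle_submodule.
- by move=> /asboolP /emin; rewrite ltnn.
move=> y; rewrite inE => /orP[/eqP ->|yxs]; first by rewrite scalerA -exprS.
rewrite scalerA mulrC -scalerA; apply: submoduleZ (xw1 _ yxs).
exact: boundary_submodule.
Qed.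

Lemma nonunits_fg : exists xs : seq R, (forall x, x \in xs -> x \isn't a GRing.unit) /\
  forall r, r \isn't a GRing.unit -> forall (V : lmodType R) (W : V -> Prop) v,
    submodule W -> (forall x, x \in xs -> W (x *: v)) -> W (r *: v).
Proof.
have [|||n [g gP]] := R_noetherian (I := fun r => r \isn't a GRing.unit).
- by rewrite unitr0.
- exact: R_local.
- by move=> a x nx; rewrite unitrM negb_and nx orbT.
exists [seq g s | s <- enum 'I_n]; split=> [x /mapP [s _ ->]|].
  apply/gP; exists (fun t => (t == s)%:R).
  by rewrite (bigD1 s) //= eqxx mul1r big1 ?addr0 // => t /negPf ->; rewrite mul0r.
move=> r /gP [c ->] V W v subW h; rewrite scaler_suml.
apply: submodule_sum => // s; rewrite -scalerA; apply: submoduleZ => //.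
by apply: h; apply: map_f; rewrite mem_enum.
Qed.

End LocalAlgebra.

(** The partial sums of [r] are multiplied by at most [h + 1] at each step
    from [L0] on. *)
Lemma exp_growth (r : nat -> nat) (h L0 : nat) :
  (forall L, (L0 <= L)%N -> (r L <= h * \sum_(l < L) r l)%N) ->
  exists A B : nat, forall L, (r L <= A * B ^ L)%N.
Proof.
move=> rec; pose s L := (\sum_(l < L) r l)%N.
have sS L : s L.+1 = (s L + r L)%N by rewrite /s big_ord_recr.
have s_mono L L' : (L <= L')%N -> (s L <= s L')%N.
  move=> /subnK <-; elim: (L' - L)%N => // d IH.
  by rewrite addSn sS; apply: leq_trans IH (leq_addr _ _).
have s_exp L : (s L <= s L0 * h.+1 ^ L)%N.
  elim: L => [|L IH]; first by rewrite /s big_ord0.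
  have [LL|LL] := leqP L0 L; last first.
    apply: leq_trans (s_mono _ _ LL) _; rewrite -[X in (X <= _)%N]muln1.
    by rewrite leq_mul2l expn_gt0 orbT.
  rewrite sS expnS mulnCA mulSn.
  apply: leq_add => //; apply: leq_trans (rec _ LL) _.
  by rewrite leq_mul2l IH orbT.
exists (s L0 * h.+1)%N, h.+1 => L; rewrite -mulnA -expnS.
by apply: leq_trans (s_exp L.+1); rewrite sS leq_addl.
Qed.

Section RankGrowth.
Context {R : comUnitRingType} {k : fieldType} { pi : {rmorphism R -> k}}.
Hypothesis k_residue : residue_map pi.
Hypothesis R_noetherian : noetherian R.
Hypothesis R_local : local_ring R.

(** The bound of [rank_bound] applies to the iterated cone of [Y] on generators
    of the maximal ideal, whose homology has finite length. *)
Lemma rank_growth (G : @mxcx R) a Y : bbelow G a -> minimal G ->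
  testing (mxc G) Y -> exists A B : nat, forall L : nat,
    (rk G (a + Posz L)%R <= A * B ^ L)%N.
Proof.
move=> bG mG tY.
have [xs [nxs gen_xs]] := nonunits_fg R_noetherian R_local.
have [N [[fg [t0 above0] [l below] nac [j0 hom_below]] kxs]] :=
  killed_testing R_noetherian R_local nxs tY.
have [t [above nvan]] : exists t, (forall j, t < j -> hvan N j) /\ ~ hvan N t.
  apply: contrapT => no; apply: nac.
  suff van d : forall j, t0 - Posz d < j -> hvan N j.
    by move=> i; apply: (van (absz (t0 - i)).+1); lia.
  elim: d => [|d IH] j jd; first by apply: above0; lia.
  have [e|ne] := eqVneq j (t0 - Posz d); last by apply: IH; lia.
  by apply: contrapT => nv; apply: no; exists j; split=> // i ji; apply: IH; lia.
have [w0 [cw0 nw0]] : exists w : N t, cycle w /\ ~ boundary w.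
  apply: contrapT => no; apply: nvan => w cw; apply: contrapT => nw.
  by apply: no; exists w.
have [w [cw nw xsw]] := socle_element kxs cw0 nw0.
have w_socle r : r \isn't a GRing.unit -> boundary (r *: w).
  by move=> nr; apply: gen_xs => //; apply: boundary_submodule.
have /choice [h0 h0P] j : exists n, bgen n (@cycle R N j) (@boundary R N j).
  apply: (bgen_nilpotent k_residue R_noetherian (xs := xs)).
  - exact: cycle_submodule.
  - exact: boundary_submodule.
  - by move=> v; apply: boundary_cycle.
  - exact: fg.
  - by move=> x /kxs [e eP]; exists e; apply: eP.
  - move=> r W nr subW _ xsW v cv; apply: gen_xs => // x xxs; exact: xsW.
pose h := (\sum_(d < (absz (t - l)).+1) h0 (l + Posz d)%R)%N.
have hP j : bgen h (@cycle R N j) (@boundary R N j).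
  move=> S subS ST; have S0 : S 0 by case: subS.
  have [jt|jt] := ltP t j; first last.
    have [jl|jl] := ltP j l; first last.
      apply: ngen_le (h0P j S subS ST) => //.
      have dlt : (absz (j - l) < (absz (t - l)).+1)%N by lia.
      rewrite /h (bigD1 (Ordinal dlt)) //=.
      have e : l + Posz (absz (j - l)) = j by lia.
      by rewrite e leq_addr.
    apply: (@ngen_le _ _ 0) => //; exists (fun=> 0); split=> [[]//|x /ST cx].
    by exists (fun=> 0); rewrite big_ord0 subr0; apply: below cx.
  apply: (@ngen_le _ _ 0) => //; exists (fun=> 0); split=> [[]//|x /ST cx].
  by exists (fun=> 0); rewrite big_ord0 subr0; apply: above cx.
apply: (@exp_growth (fun L => rk G (a + Posz L)%R) h (absz (t - a - j0)%R).+1) => L LL.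
have := @rank_bound _ _ _ k_residue _ _ bG mG _ _ (fun=> h) w above hP cw nw w_socle
  (a + Posz L) (t - (a + Posz L) - 1) L.
rewrite -big_distrl mulnC /=; apply => //; first by lia.
by apply: hom_below; lia.
Qed.

End RankGrowth.

(** * Semidualizing and reflexive complexes *)

Section Reflexivity.
Context {R : comUnitRingType}.
Implicit Types K L P Q X Y : complex R.

Lemma hfinite_hfg X : hfinite X -> forall i, hfg X i.
Proof.
move=> [n [z [zc zP]]] i; exists n, (fun s => z s i); split=> [s|x cx].
  by case: (zc s).
have [|c cP] := zP (fun j => tr X i j x).
  split=> [j|]; first exact: tr_cycle.
  by exists (absz i) => j ij; apply: tr_ne; apply: contraTneq ij => ->; rewrite ltnn.
by exists c; have := cP i; rewrite tr_id.
Qed.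

(** Outside the finitely many degrees where the generators of the total homology
    live, every cycle is a boundary. *)
Lemma hfinite_hbounded X : hfinite X -> hbounded X.
Proof.
move=> [n [z [zc zP]]].
have /choice [N NP] s : exists N : nat, forall i, (N < `|i|)%N -> z s i = 0.
  by case: (zc s).
exists (\max_s N s)%N => i x iN cx.
have [|c cP] := zP (fun j => tr X i j x).
  split=> [j|]; first exact: tr_cycle.
  by exists (absz i) => j ij; apply: tr_ne; apply: contraTneq ij => ->; rewrite ltnn.
have := cP i; rewrite tr_id big1 ?subr0 // => s _.
rewrite NP ?scaler0 //; apply: leq_ltn_trans iN; exact: leq_bigmax.
Qed.

Lemma hbounded_above X : hbounded X -> exists t : int, forall j, t < j -> hvan X j.
Proof. by move=> [N NP]; exists (Posz N) => j jN x; apply: NP; lia. Qed.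

Lemma hbounded_below X : hbounded X -> exists l : int, forall j, j < l -> hvan X j.
Proof. by move=> [N NP]; exists (- Posz N) => j jN x; apply: NP; lia. Qed.

Lemma hbounded_qiso X Y (f : chain_map X Y) :
  quasi_iso f -> hbounded X <-> hbounded Y.
Proof.
move=> /quasi_isoP hf; split=> -[N NP]; exists N => i x iN.
  by apply: (proj1 (hisoat_van (hf i))) => y; apply: NP.
by apply: (proj2 (hisoat_van (hf i))) => y; apply: NP.
Qed.

Lemma stalk_hgen : @hgen R (stalk R^o) 0 (1 : R).
Proof.
split=> [//|i i0 x _|r [x]|x _].
- by rewrite (stalk_eq0 x i0); apply: boundary0.
- by move=> h; rewrite -[r]mulr1; apply: (esym h).
- exists (x : R); rewrite [X in boundary X](_ : _ = 0); first exact: boundary0.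
  by apply/eqP; rewrite subr_eq0; apply/eqP; rewrite [LHS]mulr1.
Qed.

Lemma scalar_map_qiso X Y (f : chain_map X Y) :
  quasi_iso (scalar_map f) <-> hgen (hom0 f : Hom X Y 0).
Proof.
have e : scalar_map f 0 (1 : R) = hom0 f by rewrite /= scale1r.
rewrite -e; split=> [/hgen_qiso h|]; first by apply/h; [|exact: stalk_hgen].
exact/hgen_to_qiso/stalk_hgen.
Qed.

Lemma hom_pre_hom0 P Q Y (h : chain_map P Q) (f : chain_map Q Y) :
  hom_pre Y h 0 (hom0 f) = hom0 (comp_map f h).
Proof.
apply: hom_ext => i j x; have [e|ne] := eqVneq j i.
  by subst j; rewrite [RHS]hom0_id; exact: hom0_id.
by rewrite !Hom_ne // addr0.
Qed.

(** Two K-projective resolutions of [K] differ by a quasi-isomorphism that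
    commutes with the maps to [K] up to homotopy. *)
Lemma homothety_hgen P K (p : chain_map P K) : K_projective P -> quasi_iso p ->
  quasi_iso (homothety K) <-> hgen (hom0 p : Hom P K 0).
Proof.
move=> pP qp; have [pr qr] := resolutionP (is_resolutionI pP qp).
have [h hP] := K_projective_lift p pP qr.
have qh : quasi_iso h by apply: (qiso_cancel_r qr); apply: homotopic_qiso (homotopic_sym hP) qp.
rewrite scalar_map_qiso (hgen_qiso (hom_pre_qiso K pP pr qh) (hom0_cycle' _)).
rewrite hom_pre_hom0; split; apply: hgen_eq.
- exact: hP.
- exact: hom0_cycle'.
- exact: homotopic_sym hP.
- exact: hom0_cycle'.
Qed.

(** ** Biduality for arbitrary resolutions *)

Definition bidual_map P Q K (q : chain_map Q (Hom P K)) : chain_map P (Hom Q K) :=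
  comp_map (hom_pre K q) (bidual P K).

(** The square formed by the two biduality maps commutes up to homotopy, and its
    other two sides are quasi-isomorphisms. *)
Lemma biduality_change X K P Q (h : chain_map P (res_obj X))
    (q : chain_map Q (Hom P K)) :
  K_projective P -> K_projective (res_obj X) -> quasi_iso h ->
  K_projective Q -> quasi_iso q ->
  quasi_iso (biduality X K) <-> quasi_iso (bidual_map q).
Proof.
move=> pP pX qh pQ qq.
have qhK := hom_pre_qiso K pP pX qh.
have [f qf] : exists f : chain_map Q (RHom X K), quasi_iso f.
  apply: (res_transfer pQ (quasi_iso_D qq)).
  exact/D_iso_sym/quasi_iso_D/qhK.
have [pr qr] := resolutionP (is_resolutionI pQ qf).
set r := res_map (RHom X K) in qr.
pose hr := comp_map (hom_pre K h) r.
have qhr : quasi_iso hr by apply: qiso_comp.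
have [u uP] := K_projective_lift q pQ qhr.
have qu : quasi_iso u by apply: (qiso_cancel_r qhr); apply: homotopic_qiso (homotopic_sym uP) qq.
have quK := hom_pre_qiso K pQ pr qu.
have heq i (x : P i) : cycle x ->
    boundary (comp_map (hom_pre K u) (comp_map (biduality X K) h) i x - bidual_map q i x).
  move=> cx.
  have := hom_pre_homotopic uP (cmap_cycle (bidual P K) cx).
  rewrite (_ : hom_pre K (comp_map hr u) i _
    = comp_map (hom_pre K u) (comp_map (biduality X K) h) i x) //.
  exact: hom_ext.
split=> [qb|qb].
  by apply: qiso_heq heq _; apply: qiso_comp quK; apply: qiso_comp qb.
apply: (qiso_cancel_l qh); apply: (qiso_cancel_r quK).
by apply: qiso_heq qb => i x cx; apply: boundaryBC; apply: heq.
Qed.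

Lemma hfinite_stalk : hfinite (stalk R^o).
Proof.
exists 1%N, (fun _ i => tr (stalk R^o) 0 i (1 : R)); split=> [_|x cx].
  split=> // ; exists 0%N => i i0; apply: tr_ne; lia.
exists (fun=> x 0) => i; rewrite big_ord1.
have [i0|i0] := eqVneq i 0; last first.
  by rewrite [X in boundary X](stalk_eq0 _ i0); apply: boundary0.
subst i; rewrite tr_id [X in boundary X](_ : _ = 0); first exact: boundary0.
by apply/eqP; rewrite subr_eq0; apply/eqP; rewrite [RHS]mulr1.
Qed.

Lemma sphere_stalk G : sphere G 0 -> exists s : chain_map (mxc G) (stalk R^o),
  quasi_iso s /\ s 0 (gene G 0) = (1 : R).
Proof. by move=> sG; apply: (sphere_map_qiso sG stalk_hgen). Qed.

Lemma semidualizing_stalk : semidualizing (stalk R^o).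
Proof.
split; first exact: hfinite_stalk.
have [s [qs sE]] := sphere_stalk (sphere0P 0).
apply/(homothety_hgen (sphere_K_projective (sphere0P 0)) qs).
apply/(@hgen_hisoat _ _ _ 0 0 (sphere_ev (sphere0 0) 0 (stalk R^o) 0 0)).
- move=> i _; apply: hisoat_van (sphere_ev_hisoat (sphere0P 0) _ _); lia.
- exact: sphere_ev_hisoat.
- exact: hom0_cycle'.
rewrite (_ : sphere_ev _ _ _ _ _ _ = s 0 (gene (sphere0 0) 0)); last exact: hom0_id.
by rewrite sE; apply: stalk_hgen.
Qed.

Section Semidualizing.
Hypothesis R_noetherian : noetherian R.

Lemma hfinite_resolution X : hfinite X -> exists G a (f : chain_map (mxc G) X),
  [/\ bbelow G a, minimal G & quasi_iso f].
Proof.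
move=> fX; have [l below] := hbounded_below (hfinite_hbounded fX).
have [G [f h]] := minimal_resolution R_noetherian (hfinite_hfg fX) below.
by exists G, l, f.
Qed.

Lemma hfinite_resolutionP X : hfinite X ->
  K_projective (res_obj X) /\ quasi_iso (res_map X).
Proof.
move=> /hfinite_resolution [G [a [f [bG _ qf]]]].
exact: resolutionP (is_resolutionI (mxc_K_projective bG) qf).
Qed.

Variables (K : complex R) (sK : semidualizing K).

Lemma semidualizing_hbounded : hbounded (RHom K K).
Proof. exact/(hbounded_qiso sK.2)/hfinite_hbounded/hfinite_stalk. Qed.

(** The ring resolves RHom(K, K). With this resolution, biduality followed by
    evaluation at the unit is the resolution of [K] itself. *)
Lemma semidualizing_reflexive : reflexive K K.
Proof.
have [fK qK] := sK; split; [exact: fK|exact: semidualizing_hbounded|].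
have [pK qr] := hfinite_resolutionP fK.
have s0 := @sphere0P R 0.
have [s [qs sE]] := sphere_stalk s0.
have qq := qiso_comp qs qK.
apply/(biduality_change pK pK (id_qiso _) (sphere_K_projective s0) qq).
apply/quasi_isoP => i.
have e : i = 0 + i by rewrite add0r.
have ev := sphere_ev_hisoat s0 K e.
move/quasi_isoP: qr => /(_ i) qr.
apply: (hisoat_cancel_r _ _ ev).
- exact: cmap_cycle.
- exact: cmap_boundary.
apply: hisoat_eq qr => [x cx|x cx]; last first.
  by have [h _ _ _] := ev; apply: h; apply: cmap_cycle.
rewrite [X in _ - X](_ : _ = res_map K i x); first by rewrite subrr; apply: boundary0.
have qE : comp_map (homothety K) s 0 (gene (sphere0 0) 0) = hom0 (res_map K).
  rewrite -[LHS]/(homothety K 0 (s 0 (gene (sphere0 0) 0))) sE.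
  exact: scale1r.
transitivity (sign (i * 0) *:
  (comp_map (homothety K) s 0 (gene (sphere0 0) 0) : hom _ _ _) i i x) => //.
by rewrite qE hom0_id mulr0 /sign expr0z scale1r.
Qed.

End Semidualizing.
End Reflexivity.

(** * Shifts of the ring, and the growth of semidualizing complexes *)

Section ShiftedRing.
Context {R : comUnitRingType}.
Hypothesis R_noetherian : noetherian R.
Variables (K : complex R) (sK : semidualizing K).

Section Sphere.
Variables (F : @mxcx R) (b : int) (bF : bbelow F b).
Variables (p : chain_map (mxc F) K) (qp : quasi_iso p) (a : int).
Let S := @sphere0 R a.
Let spS : sphere S a := sphere0P a.
Let F' := mshift F (- a).

Let eK (n : int) : n - - a = a + n. Proof. by rewrite opprK addrC. Qed.

(** The shift of a resolution of [K] resolves [Hom(S, K)], where [S] is the ring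
    in degree [a]. *)
Lemma shifted_linear n : linear (fun y : mxc F' n =>
  sphere_hom S (eK n) (sign (a * n) *: p (n - - a) y)).
Proof.
move=> c x y; apply: (sphere_hom_ext spS (eK n)).
rewrite -[LHS]/(sphere_ev S a K n _ _) -[RHS]/(sphere_ev S a K n (n - - a) _).
rewrite [RHS]linearP !(sphere_homE spS).
have -> : p (n - - a) (c *: x + y) = c *: p (n - - a) x + p (n - - a) y by exact: linearP.
rewrite /= scalerDr !scalerA.
by rewrite [sign _ * c]mulrC.
Qed.

Lemma shifted_diff n m (y : mxc F' n) :
  lin_of (@shifted_linear m) (diff (mxc F') n m y) =
  diff (Hom (mxc S) K) n m (lin_of (@shifted_linear n) y).
Proof.
have [e|ne] := eqVneq n (m + 1); last by rewrite !diff_shape // linear0.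
apply: (sphere_hom_ext spS (eK m)).
transitivity (sphere_ev S a K m (m - - a) (sphere_hom S (eK m)
  (sign (a * m) *: p (m - - a) (diff (mxc F') n m y)))) => //.
transitivity (sphere_ev S a K m (m - - a) (diff (Hom (mxc S) K) n m
  (sphere_hom S (eK n) (sign (a * n) *: p (n - - a) y)))) => //.
rewrite (@sphere_ev_diff _ S a spS K n m (n - - a)) //; last by lia.
rewrite !(sphere_homE spS).
have -> : diff (mxc F') n m y = sign (- a) *: diff (mxc F) (n - - a) (m - - a) y.
  exact: mshift_diffE.
rewrite !linearZ /= (cmap_diff p (m - - a) y) scalerA; congr (_ *: _).
by rewrite signN e mulrDr mulr1 signD mulrC.
Qed.

Definition shifted_map : chain_map (mxc F') (Hom (mxc S) K) :=
  @ChainMap R (mxc F') (Hom (mxc S) K) (fun n => lin_of (@shifted_linear n))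
    shifted_diff.

Lemma shifted_mapE n (y : mxc F' n) j : j = n - - a ->
  (shifted_map n y : hom _ _ _) a j (gene S a)
  = sign (a * n) *: tr K (n - - a) j (p (n - - a) y).
Proof. by move=> e; subst j; rewrite tr_id; apply: (sphere_homE spS (eK n)). Qed.

Lemma shifted_map_qiso : quasi_iso shifted_map.
Proof.
apply/quasi_isoP => n; have ev := sphere_ev_hisoat spS K (eK n).
have [h1 h2 _ _] := ev.
apply: (hisoat_cancel_r _ _ ev) => [y|y|]; [exact: cmap_cycle|exact: cmap_boundary|].
move/quasi_isoP: qp => /(_ (n - - a)) qpn.
have qn : hisoat (unshift (mxc F) (- a) n \o mshift_map F (- a) n : {linear _ -> _}).
  move/quasi_isoP: (@mshift_map_qiso R F (- a)) => q.
  exact: hisoat_comp (q n) (unshift_hisoat _ _ _).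
apply: (hisoat_sign (m := a * n)) (hisoat_comp qn qpn) => y.
exact: (sphere_homE spS (eK n)).
Qed.

Lemma shifted_K_projective : K_projective (mxc F').
Proof. exact: mxc_K_projective (mshift_bbelow (b := - a) bF). Qed.

(** The two signs, one from the biduality map and one from the resolution of
    [Hom(S, K)], cancel. *)
Lemma shifted_bidual_gene :
  bidual_map shifted_map a (gene S a)
  = @unshift_hom R F (- a) K 0 a (esym (subrr a : a + - a = 0)) (hom0 p).
Proof.
apply: hom_ext => n j y; have [e|ne] := eqVneq j (n - - a); last first.
  by rewrite !Hom_ne //; lia.
transitivity (sign (a * n) *: (shifted_map n y : hom _ _ _) a j (gene S a)) => //.
rewrite shifted_mapE // scalerA sign_sqr scale1r.
by rewrite -[RHS]/(hom0 p (n - - a) j y) hom0_tr.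
Qed.

Lemma resolution_hgen : hgen (hom0 p : Hom (mxc F) K 0).
Proof.
have [_ h] := sK.
exact/(homothety_hgen (mxc_K_projective bF) qp).
Qed.

Lemma shifted_bidual_qiso : quasi_iso (bidual_map shifted_map).
Proof.
apply: (hgen_to_qiso (sphere_hgen spS)); rewrite shifted_bidual_gene.
apply/(hgen_hisoat (X := Hom (mxc F) K)); last exact: resolution_hgen.
- move=> i _; have e : i = i - 0 + a + - a by lia.
  exact: hisoat_van (@unshift_hom_hisoat R F (- a) K _ _ e).
- exact: unshift_hom_hisoat.
- exact: hom0_cycle'.
Qed.

Section ShiftOfRing.
Variables (L : complex R) (fL : hfinite L) (SL : D_iso (mxc S) L).

Lemma shifted_ring_reflexive : reflexive K L.
Proof.
have pS := sphere_K_projective spS.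
have [h [qh qhK]] := RHom_qiso K pS SL.
have [pL _] := hfinite_resolutionP R_noetherian fL.
split=> //; last first.
  apply/(biduality_change pS pL qh shifted_K_projective shifted_map_qiso).
  exact: shifted_bidual_qiso.
apply/(hbounded_qiso qhK); have [N NP] := hfinite_hbounded sK.1.
exists (N + absz a)%N => i x iN.
apply: (proj2 (hisoat_van (sphere_ev_hisoat spS K (erefl (a + i))))) => y.
by apply: NP; lia.
Qed.

Lemma shifted_ring_RHom : D_iso (mxc F') (RHom L K).
Proof.
have [h [_ qhK]] := RHom_qiso K (sphere_K_projective spS) SL.
apply: D_iso_trans (quasi_iso_D shifted_map_qiso) _.
exact/D_iso_sym/quasi_iso_D/qhK.
Qed.

End ShiftOfRing.
End Sphere.
Lemma semidualizing_testing F b (p : chain_map (mxc F) K) :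
  bbelow F b -> quasi_iso p -> testing (mxc F) K.
Proof.
move=> bF qp; have [fK _] := sK; have hK := hfinite_hbounded fK.
have [_ van free _] := resolution_hgen bF qp.
split.
- exact: hfinite_hfg.
- exact: hbounded_above.
- exact: hbounded_below.
- move=> acK; have acH := mxc_K_projective bF acK.
  have := free 1; rewrite scale1r => h.
  have /eqP := h (acH _ _ (hom0_cycle' p)); by rewrite oner_eq0.
- by exists 0 => j j0; apply: van; rewrite lt_eqF.
Qed.

End ShiftedRing.

(** * Perfect derived Hom complexes *)

Section Swap.
Context {R : comUnitRingType}.
Variables X Y Z : complex R.

(** The adjunction isomorphism Hom(X, Hom(Y, Z)) -> Hom(Y, Hom(X, Z)), which
    exchanges the two arguments with the usual sign. *)
Definition swap_fun n (phi : hom X (Hom Y Z) n) u v (y : Y u) i j (x : X i) : Z j :=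
  if v == u + n then
    sign (i * u) *: (phi i (i + n) x : hom Y Z (i + n)) u j y
  else 0.

Lemma swap_linear1 n phi u v y i j : linear (@swap_fun n phi u v y i j).
Proof.
move=> a x x'; rewrite /swap_fun; case: ifP => _; last by rewrite scaler0 addr0.
by rewrite linearP hom_addE hom_scaleE scalerDr !scalerA [sign _ * a]mulrC.
Qed.

Lemma swap_shape1 n phi u v y i j (x : X i) : j != i + v ->
  lin_of (@swap_linear1 n phi u v y i j) x = 0.
Proof.
move=> ij; rewrite /= /swap_fun; case: eqP => // e.
by rewrite Hom_ne ?scaler0 //; lia.
Qed.

Definition swap1 n phi u v (y : Y u) : hom X Z v := HomElt (@swap_shape1 n phi u v y).

Lemma swap_linear2 n phi u v : linear (@swap1 n phi u v).
Proof.
move=> a y y'; apply: hom_ext => i j x; rewrite hom_addE hom_scaleE /= /swap_fun.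
case: ifP => _; last by rewrite scaler0 addr0.
by rewrite linearP scalerDr !scalerA [sign _ * a]mulrC.
Qed.

Lemma swap_shape2 n phi u v (y : Y u) : v != u + n ->
  lin_of (@swap_linear2 n phi u v) y = 0.
Proof.
by move=> ne; apply: hom_ext => i j x; rewrite /= /swap_fun (negPf ne).
Qed.

Definition swap2 n (phi : hom X (Hom Y Z) n) : hom Y (Hom X Z) n :=
  @HomElt R Y (Hom X Z) n (fun u v => lin_of (@swap_linear2 n phi u v))
    (@swap_shape2 n phi).

Lemma swap2E n phi u v i l j (y : Y u) (x : X i) : v = u + n -> l = i + n ->
  (@swap2 n phi u v y : hom X Z v) i j x
  = sign (i * u) *: (phi i l x : hom Y Z l) u j y.
Proof. by move=> vE lE; subst l; rewrite /= /swap_fun vE eqxx. Qed.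

Lemma swap_linear3 n : linear (@swap2 n).
Proof.
move=> a phi psi; apply: hom_ext => u v y; apply: hom_ext => i j x.
rewrite /= /swap_fun; case: ifP => _; last by rewrite scaler0 addr0.
rewrite [in RHS]scalerA [a * _]mulrC -scalerA -scalerDr.
by congr (_ *: _).
Qed.

Lemma swap_diff n m (phi : Hom X (Hom Y Z) n) :
  lin_of (@swap_linear3 m) (diff (Hom X (Hom Y Z)) n m phi) =
  diff (Hom Y (Hom X Z)) n m (lin_of (@swap_linear3 n) phi).
Proof.
have [e|ne] := eqVneq n (m + 1); last by rewrite !diff_shape // linear0.
subst n; apply: hom_ext => u v y.
have [e|ne] := eqVneq v (u + m); last by rewrite !Hom_ne.
subst v; apply: hom_ext => i j x.
transitivity (sign (i * u) *:
   (diff Z (j + 1) j ((phi i (i + m + 1) x : hom Y Z _) u (j + 1) y)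
    - sign (i + m + 1) *: (phi i (i + m + 1) x : hom Y Z _) (u - 1) j (diff Y u (u - 1) y)
    - sign (m + 1) *: (phi (i - 1) (i + m) (diff X i (i - 1) x) : hom Y Z _) u j y)).
  rewrite [LHS](@swap2E _ _ _ _ _ (i + m)) // Hom_diffE //; congr (_ *: _).
  transitivity ((diff (Hom Y Z) (i + m + 1) (i + m) (phi i (i + m + 1) x) : hom _ _ _) u j y
    - sign (m + 1) *: (phi (i - 1) (i + m) (diff X i (i - 1) x) : hom Y Z _) u j y) => //.
  by rewrite Hom_diffE.
set sphi := lin_of _ _.
symmetry; transitivity ((diff (Hom X Z) (u + m + 1) (u + m)
    ((sphi : hom _ _ _) u (u + m + 1) y) : hom _ _ _) i j x
  - sign (m + 1) *: ((sphi : hom _ _ _) (u - 1) (u + m) (diff Y u (u - 1) y)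
      : hom X Z _) i j x).
  by rewrite Hom_diffE.
rewrite Hom_diffE //.
rewrite (@swap2E _ _ _ _ _ (i + m + 1)); [|lia..].
rewrite (@swap2E _ _ _ _ _ (i + m)); [|lia..].
rewrite (@swap2E _ _ _ _ _ (i + m + 1)); [|lia..].
rewrite !scalerBr linearZ /= !scalerA -!signD; have sgn2 p : sign (p + (- i - i)) = sign p :> R.
  by rewrite signD [sign (- i - i)]signD sign_sqr mulr1.
rewrite addrAC.
have -> : m + 1 + i * (u - 1) = i * u + (i + m + 1) + (- i - i) by ring.
have -> : u + m + 1 + (i - 1) * u = i * u + (m + 1) by ring.
by rewrite sgn2.
Qed.

Definition swap : chain_map (Hom X (Hom Y Z)) (Hom Y (Hom X Z)) :=
  @ChainMap R (Hom X (Hom Y Z)) (Hom Y (Hom X Z))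
    (fun n => lin_of (@swap_linear3 n)) swap_diff.

Lemma swapE n (phi : Hom X (Hom Y Z) n) u v i l j (y : Y u) (x : X i) :
  v = u + n -> l = i + n ->
  ((swap n phi : hom Y (Hom X Z) n) u v y : hom X Z v) i j x
  = sign (i * u) *: ((phi : hom X (Hom Y Z) n) i l x : hom Y Z l) u j y.
Proof. exact: swap2E. Qed.
End Swap.

Section Adjunction.
Context {R : comUnitRingType}.
Implicit Types X Y Z : complex R.

Lemma swapK X Y Z n (phi : Hom X (Hom Y Z) n) :
  swap Y X Z n (swap X Y Z n phi) = phi.
Proof.
apply: hom_ext => i l x; have [e|ne] := eqVneq l (i + n); last by rewrite !Hom_ne.
subst l; apply: hom_ext => u j y.
have [e|ne] := eqVneq j (u + (i + n)); last by rewrite !Hom_ne.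
rewrite (@swapE R Y X Z n _ i (i + n) u (u + n)) //.
rewrite (@swapE R X Y Z n _ u (u + n) i (i + n)) //.
by rewrite scalerA [u * i]mulrC sign_sqr scale1r.
Qed.

Lemma swap_qiso X Y Z : quasi_iso (swap X Y Z).
Proof.
apply: bij_qiso => n phi; last by exists (swap Y X Z n phi); apply: swapK.
by move=> e; rewrite -[phi]swapK e linear0.
Qed.

Lemma hgen_qiso_inv X Y (f : chain_map X Y) a (y : Y a) : quasi_iso f ->
  hgen y -> exists x : X a, hgen x.
Proof.
move=> qf hy; have [cy _ _ _] := hy.
have [x [cx xy]] := proj2 (qf a) _ cy; exists x.
apply/(hgen_qiso qf cx); apply: hgen_eq hy; first exact: boundaryBC.
exact: cmap_cycle.
Qed.

End Adjunction.

(** ** Minimal complexes whose endomorphism complex is the ring *)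

Section EndoSphere.
Context {R : comUnitRingType} {k : fieldType} { pi : {rmorphism R -> k}}.
Hypothesis k_residue : residue_map pi.
Variables (G : @mxcx R) (mG : minimal G).

Lemma residue_linear n m (f : {linear 'rV[R]_n -> 'rV[R]_m}) (x : 'rV[R]_n) t :
  (forall u, pi (x 0 u) = 0) -> pi (f x 0 t) = 0.
Proof.
move=> x0; rewrite linear_basis summxE rmorph_sum big1 // => u _.
by rewrite mxE rmorphM x0 mul0r.
Qed.

Lemma residue_diff i j (x : mxc G i) t :
  pi ((diff (mxc G) i j x : 'rV_(rk G j)) 0 t) = 0.
Proof.
rewrite mxE rmorph_sum big1 // => u _.
by rewrite rmorphM (residue_nonunit k_residue (mG _ _)) mulr0.
Qed.

Lemma residue_Hom_diff n m (phi : Hom (mxc G) (mxc G) n) i j (x : mxc G i) t :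
  pi (((diff (Hom (mxc G) (mxc G)) n m phi : hom _ _ _) i j x : 'rV_(rk G j)) 0 t) = 0.
Proof.
have [e|ne] := eqVneq n (m + 1); last first.
  by rewrite diff_shape // [X in pi X]mxE rmorph0.
have piB (A B : 'rV[R]_(rk G j)) c : pi ((A - c *: B) 0 t)
    = pi (A 0 t) - pi c * pi (B 0 t) by rewrite !mxE rmorphB rmorphM.
rewrite Hom_diffE // [LHS]piB [X in X - _]residue_diff sub0r.
rewrite (residue_linear (phi (i - 1) j)) ?mulr0 ?oppr0 // => u.
exact: residue_diff.
Qed.

(** No differential leaves the bottom degree or enters the top degree of [G], so
    an elementary map from the top to the bottom is a cycle. *)
Lemma corner_cycle a b (s : 'I_(rk G b)) (t : 'I_(rk G a)) :
  (forall i, i < a -> rk G i = 0%N) -> (forall i, b < i -> rk G i = 0%N) ->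
  exists phi : Hom (mxc G) (mxc G) (a - b),
    cycle phi /\ phi b a (bs s) = bs t.
Proof.
move=> below above; have e : a = b + (a - b) by rewrite addrC subrK.
pose f : {linear 'rV[R]_(rk G b) -> 'rV[R]_(rk G a)} :=
  bmap (fun u => if u == s then bs t else 0).
exists (@homat R (mxc G) (mxc G) (a - b) b a e f); split; last first.
  rewrite [LHS](@homat_id R (mxc G) (mxc G)).
  by rewrite [LHS]bmap_delta eqxx.
apply/Hom_cycleP => i j x; have [ib|ib] := eqVneq (i - 1) b.
  have i0 : rk G i = 0%N by apply: above; lia.
  by rewrite (rk0 x i0) !linear0 ?scaler0.
rewrite [X in _ *: X]homat_ne // scaler0.
have [ja|ja] := eqVneq (j + 1) a; first by apply: rk0; apply: below; lia.
have [ib'|ib'] := eqVneq i b; last by rewrite homat_ne // linear0.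
by rewrite Hom_ne ?linear0 //; apply: contraNneq ja; lia.
Qed.

(** If the lowest degree [a] and the highest degree [b] of [G] differ, an
    elementary map from degree [b] to degree [a] is a cycle in degree [a - b] of
    the endomorphism complex, and it is not a boundary, since boundaries vanish
    modulo the maximal ideal. In a single degree of rank at least two, the
    elementary matrices with entries at the places (1, 1) and (1, 2) are not
    multiples of one matrix over the residue field. *)
Lemma endo_sphere b0 b1 (z : Hom (mxc G) (mxc G) 0) :
  (forall i, i < b0 -> rk G i = 0%N) -> (forall i, b1 < i -> rk G i = 0%N) ->
  hgen z -> exists a, sphere G a.
Proof.
move=> below above [cz van free gen].
have [i0 ri0] : exists i, rk G i != 0%N.
  apply: contrapT => no.
  have r0 i : rk G i = 0%N by apply: contrapT => /eqP ri; apply: no; exists i.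
  have z0 : z = 0 by apply: hom_ext => i j x; rewrite (rk0 x (r0 i)) !linear0.
  have /eqP : (1 : R) = 0 by apply: free; rewrite z0 scaler0; apply: boundary0.
  by rewrite oner_eq0.
have [a [ra below']] : exists a, rk G a != 0%N /\ forall i, i < a -> rk G i = 0%N.
  have ex : exists n, rk G (b0 + Posz n) != 0%N.
    exists (absz (i0 - b0)); have [ib|ib] := ltP i0 b0.
      by rewrite below // in ri0.
    by have -> : b0 + Posz (absz (i0 - b0)) = i0 by lia.
  have [n rn nmin] := ex_minnP ex; exists (b0 + Posz n); split=> // i ia.
  have [ib|ib] := ltP i b0; first exact: below.
  apply: contrapT => /eqP ri; have := nmin (absz (i - b0)).
  have -> : b0 + Posz (absz (i - b0)) = i by lia.
  by move=> /(_ ri); lia.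
have [b [rb above']] : exists b, rk G b != 0%N /\ forall i, b < i -> rk G i = 0%N.
  have ex : exists n, rk G (b1 - Posz n) != 0%N.
    exists (absz (b1 - i0)); have [ib|ib] := ltP b1 i0.
      by rewrite above // in ri0.
    by have -> : b1 - Posz (absz (b1 - i0)) = i0 by lia.
  have [n rn nmin] := ex_minnP ex; exists (b1 - Posz n); split=> // i ia.
  have [ib|ib] := ltP b1 i; first exact: above.
  apply: contrapT => /eqP ri; have := nmin (absz (b1 - i)).
  have -> : b1 - Posz (absz (b1 - i)) = i by lia.
  by move=> /(_ ri); lia.
have bs1 i (t u : 'I_(rk G i)) : (bs t : 'rV_(rk G i)) 0 u = (u == t)%:R.
  by rewrite mxE eqxx.
have ab : a = b.
  have ra' : (0 < rk G a)%N by rewrite lt0n.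
  have rb' : (0 < rk G b)%N by rewrite lt0n.
  have [phi [cphi phiE]] := corner_cycle (Ordinal rb') (Ordinal ra') below' above'.
  apply: contrapT => ne; have [|psi psiE] := van (a - b) _ _ cphi.
    by rewrite subr_eq0; apply/eqP.
  have := @residue_Hom_diff _ (a - b) psi b a (bs (Ordinal rb')) (Ordinal ra').
  by rewrite psiE phiE bs1 eqxx rmorph1 => /eqP; rewrite oner_eq0.
subst b; exists a => i.
have [ia|ia] := eqVneq i a; last first.
  by have [lt|lt|e] := ltgtP i a; [exact: below'|exact: above'|case/eqP: ia].
subst i; apply/eqP; rewrite eqn_leq lt0n ra andbT leqNgt; apply/negP => r2.
have r1 : (0 < rk G a)%N by rewrite lt0n.
have e0 : a - a = 0 by rewrite subrr.
have corner t : exists phi : Hom (mxc G) (mxc G) 0,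
    cycle phi /\ phi a a (bs (Ordinal r1)) = bs t.
  by rewrite -e0; apply: corner_cycle.
have entry t : exists r : R, forall u,
    pi r * pi ((z a a (bs (Ordinal r1)) : 'rV_(rk G a)) 0 u) = (u == t)%:R.
  have [phi [cphi phiE]] := corner t.
  have [r [psi psiE]] := gen _ cphi; exists r => u.
  have piB (A B : 'rV[R]_(rk G a)) : pi ((r *: A - B) 0 u)
      = pi r * pi (A 0 u) - pi (B 0 u) by rewrite !mxE rmorphB rmorphM.
  have h := @residue_Hom_diff _ 0 psi a a (bs (Ordinal r1)) u.
  rewrite psiE in h; have /eqP := etrans (esym (piB (z a a (bs (Ordinal r1))) (phi a a _))) h.
  by rewrite phiE bs1 rmorph_nat subr_eq0 => /eqP.
have [r rE] := entry (Ordinal r1); have [r' rE'] := entry (Ordinal r2).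
have := rE (Ordinal r1); have := rE (Ordinal r2); have := rE' (Ordinal r2).
rewrite !eqxx [Ordinal r2 == _](_ : _ = false) // => h1 /eqP.
rewrite mulf_eq0 => /orP[/eqP h|/eqP h] h2.
  by move/eqP: h2; rewrite h mul0r eq_sym oner_eq0.
by move/eqP: h1; rewrite h mulr0 eq_sym oner_eq0.
Qed.

End EndoSphere.

(** * Shift-isomorphism *)

Section ShiftIso.
Context {R : comUnitRingType}.
Implicit Types X Y Z K L : complex R.

Section ShiftMap.
Variables (X Y : complex R) (f : chain_map X Y) (n : int).

Lemma shift_map_diff i j (x : shift X n i) :
  f (j - n) (diff (shift X n) i j x) = diff (shift Y n) i j (f (i - n) x).
Proof. by rewrite /= linearZ /= cmap_diff. Qed.

Definition shift_map : chain_map (shift X n) (shift Y n) :=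
  @ChainMap R (shift X n) (shift Y n) (fun i => f (i - n)) shift_map_diff.

Lemma shift_map_qiso : quasi_iso f -> quasi_iso shift_map.
Proof.
move=> /quasi_isoP qf; apply/quasi_isoP => i.
apply: (hisoat_cancel_r _ _ (unshift_hisoat Y n i)) => [y|y|].
- exact: cmap_cycle.
- exact: cmap_boundary.
exact: hisoat_comp (unshift_hisoat X n i) (qf _).
Qed.
End ShiftMap.

Lemma D_iso_shift X Y n : D_iso X Y -> D_iso (shift X n) (shift Y n).
Proof.
elim=> {X Y} [X Y [f qf]|X|X Y _|X Y Z _ h1 _ h2].
- exact: quasi_iso_D (shift_map_qiso n qf).
- exact: rst_refl.
- exact: D_iso_sym.
- exact: D_iso_trans h1 h2.
Qed.

Lemma tr_map_diff X m n p (e : p = n + m) i j (x : shift (shift X m) n i) :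
  tr X (j - n - m) (j - p) (diff (shift (shift X m) n) i j x)
  = diff (shift X p) i j (tr X (i - n - m) (i - p) x).
Proof.
rewrite /= !linearZ /= scalerA -signD -e; congr (_ *: _).
by rewrite tr_diff ?diff_tr //; lia.
Qed.

Lemma shift_shift X m n p : p = n + m -> D_iso (shift (shift X m) n) (shift X p).
Proof.
move=> e; apply: (@quasi_iso_D _ _ _ (@ChainMap R (shift (shift X m) n) (shift X p)
  (fun i => tr X (i - n - m) (i - p)) (tr_map_diff e))).
have e' i : i - n - m = i - p by lia.
apply: bij_qiso => i; first by move=> x h; apply: (tr_inj (e' i) h).
move=> y; exists (tr X (i - p) (i - n - m) y).
by rewrite [LHS](tr_tr _ _ (esym (e' i))) tr_id.
Qed.

Lemma shift0_diff X i j (x : shift X 0 i) :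
  tr X (j - 0) j (diff (shift X 0) i j x) = diff X i j (tr X (i - 0) i x).
Proof.
rewrite /= /sign expr0z scale1r.
by rewrite tr_diff ?diff_tr ?subr0.
Qed.

Lemma shift_0 X : D_iso (shift X 0) X.
Proof.
apply: (@quasi_iso_D _ _ _ (@ChainMap R (shift X 0) X
  (fun i => tr X (i - 0) i) (@shift0_diff X))).
apply: bij_qiso => i; first by move=> x h; apply: (tr_inj (subr0 i) h).
by move=> y; exists (tr X i (i - 0) y); rewrite [LHS]tr_tr ?subr0 // tr_id.
Qed.

Lemma shift_iso_refl X : shift_iso X X.
Proof. by exists 0; apply/D_iso_sym/shift_0. Qed.

Lemma shift_iso_trans X Y Z : shift_iso X Y -> shift_iso Y Z -> shift_iso X Z.
Proof.
move=> [n XY] [m YZ]; exists (n + m).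
exact: D_iso_trans XY (D_iso_trans (D_iso_shift n YZ) (shift_shift Z (erefl _))).
Qed.

Lemma shift_iso_sym X Y : shift_iso X Y -> shift_iso Y X.
Proof.
move=> [n XY]; exists (- n); apply: D_iso_sym.
apply: D_iso_trans (D_iso_shift (- n) XY) _.
apply: D_iso_trans (shift_0 Y); apply: shift_shift; lia.
Qed.

Lemma shift_class_eq K L : shift_iso K L -> shift_class K = shift_class L.
Proof.
move=> KL; apply/funext => X; apply/propext; split=> h.
  exact: shift_iso_trans h KL.
exact: shift_iso_trans h (shift_iso_sym KL).
Qed.

Lemma sphere_shift_stalk n : D_iso (mxc (sphere0 n)) (shift (stalk R^o) n).
Proof.
suff [z hz] : exists z : shift (stalk R^o) n n, hgen z.
  have [f [qf _]] := sphere_map_qiso (sphere0P n) hz.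
  exact: quasi_iso_D qf.
have e : 0 = n - n by rewrite subrr.
have c1 : @cycle R (stalk R^o) 0 (1 : R) by [].
have h1 : hgen (tr (stalk R^o) 0 (n - n) (1 : R)).
  apply/(hgen_hisoat _ (tr_hisoat _ e) c1); last exact: stalk_hgen.
  by move=> i _; rewrite subr0 -e addr0.
exists (tr (stalk R^o) 0 (n - n) (1 : R)).
apply/(hgen_hisoat (f := unshift (stalk R^o) n n)) => //.
- move=> i _; rewrite -e addr0; exact: hisoat_van (unshift_hisoat _ _ _).
- exact: unshift_hisoat.
- by rewrite /cycle /= scaler0.
Qed.

(** With the sign [(-1)^(a n)], evaluation at the generator is a chain map to the
    shift. *)
Section SphereShift.
Variables (G : @mxcx R) (a : int) (spG : sphere G a) (K : complex R).

Lemma sphere_shift_linear n : linear (fun phi : Hom (mxc G) K n =>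
  sign (a * n) *: (phi a (n - - a) (gene G a) : K (n - - a)) : shift K (- a) n).
Proof.
move=> c phi psi; rewrite hom_addE hom_scaleE scalerDr !scalerA.
by rewrite [sign _ * c]mulrC.
Qed.

Lemma sphere_shift_diff n m (phi : Hom (mxc G) K n) :
  lin_of (@sphere_shift_linear m) (diff (Hom (mxc G) K) n m phi) =
  diff (shift K (- a)) n m (lin_of (@sphere_shift_linear n) phi).
Proof.
have [e|ne] := eqVneq n (m + 1); last by rewrite !diff_shape // linear0.
transitivity (sign (a * m) *: sphere_ev G a K m (m - - a) (diff (Hom (mxc G) K) n m phi)) => //.
rewrite (@sphere_ev_diff _ G a spG K n m (n - - a)) //; last by lia.
rewrite /= linearZ /= scalerA signN; congr (_ *: _).
by rewrite e mulrDr mulr1 signD mulrCA sign_sqr mulr1.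
Qed.

Lemma sphere_Hom_shift : D_iso (Hom (mxc G) K) (shift K (- a)).
Proof.
apply: (@quasi_iso_D _ _ _ (@ChainMap R (Hom (mxc G) K) (shift K (- a))
  (fun n => lin_of (@sphere_shift_linear n)) sphere_shift_diff)).
apply/quasi_isoP => n.
have eK : n - - a = a + n by rewrite opprK addrC.
have us := unshift_hisoat K (- a) n.
apply: (hisoat_cancel_r _ _ us) => [y|y|].
- exact: cmap_cycle.
- exact: cmap_boundary.
by apply: hisoat_sign (sphere_ev_hisoat spG K eK) => phi.
Qed.
End SphereShift.

Section Separation.
Context {k : fieldType} { pi : {rmorphism R -> k}}.
Hypothesis k_residue : residue_map pi.
Hypothesis R_noetherian : noetherian R.

(** If [G] is a bounded minimal resolution of [M := RHom(L, K)], biduality turns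
    [L] into [Hom(G, K)], and then Hom(L, L), which is the ring, into [Hom(G, M)]
    and [Hom(G, G)]. Hence [G] is a shift of the ring. *)
Lemma separation K L n0 : semidualizing K -> semidualizing L -> reflexive K L ->
  (forall n : int, n0 < n -> betti pi (RHom L K) n = 0%N) -> shift_iso L K.
Proof.
move=> sK [fL hL] [_ hbM qb] betti0.
have [pL qL] := hfinite_resolutionP R_noetherian fL.
have fK := sK.1.
have M_fg i : hfg (RHom L K) i.
  have [F [l [f [bF _ qf]]]] := hfinite_resolution R_noetherian fL.
  have [h [_ /quasi_isoP qh]] := RHom_qiso K (mxc_K_projective bF) (quasi_iso_D qf).
  have [t above] := hbounded_above (hfinite_hbounded fK).
  apply/(hisoat_fg (qh i)).
  exact: (hfg_Hom R_noetherian bF above (hfinite_hfg fK)).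
have [l below] := hbounded_below hbM.
have [G [g [bG mG qg]]] := minimal_resolution R_noetherian M_fg below.
have pG := mxc_K_projective bG.
have rk_above i : n0 < i -> rk G i = 0%N.
  by move=> /betti0; rewrite (betti_minimal k_residue i mG bG (quasi_iso_D qg)).
have qbd : quasi_iso (bidual_map g).
  exact/(biduality_change pL pL (id_qiso _) pG qg).
(* Hom(L, L) is the ring; its generator is carried to Hom(G, G). *)
have h1 : hgen (hom0 (res_map L) : Hom (res_obj L) L 0).
  exact/(homothety_hgen pL qL).
have [y2 h2] := hgen_qiso_inv (hom_post_qiso pL qL) h1.
have [c2 _ _ _] := h2.
have /(hgen_qiso (hom_post_qiso pL qbd) c2) h3 := h2.
have [c3 _ _ _] := h3.
have /(hgen_qiso (swap_qiso _ _ _) c3) h4 := h3.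
have [z hz] := hgen_qiso_inv (hom_post_qiso pG qg) h4.
have [a spG] := endo_sphere k_residue mG bG rk_above hz.
exists (- a).
apply: D_iso_trans (D_iso_sym (quasi_iso_D qL)) _.
exact: D_iso_trans (quasi_iso_D qbd) (sphere_Hom_shift spG K).
Qed.

End Separation.
End ShiftIso.

(** * Curvature *)

Section LimSup.
Context {RR : realType}.
Local Open Scope ereal_scope.

Lemma limn_esup_le (u : nat -> \bar RR) (c : \bar RR) n0 :
  (forall n, (n0 <= n)%N -> u n <= c) -> limn_esup u <= c.
Proof.
move=> uc; rewrite /limn_esup limf_esupE.
apply: le_trans (ereal_inf_lbound _) _.
  by exists [set n | (n0 <= n)%N]; [exact: nbhs_infty_ge|reflexivity].
by apply: ge_ereal_sup => _ [n n0n <-]; apply: uc.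
Qed.

Lemma limn_esup_lt (u : nat -> \bar RR) (c : \bar RR) :
  limn_esup u < c -> exists n0, forall n, (n0 <= n)%N -> u n < c.
Proof.
rewrite /limn_esup limf_esupE => /ereal_inf_lt [_ [V [N _ NV] <-] Vc].
exists N => n Nn; apply: le_lt_trans Vc; apply: ereal_sup_ubound.
by exists n => //; apply: NV.
Qed.

End LimSup.

Section Curvature.
Context {RR : realType} {R : comUnitRingType} {k : fieldType}.
Context { pi : {rmorphism R -> k}}.
Implicit Types X : complex R.

Lemma curv_ge0 X : (0 <= curv RR pi X)%E.
Proof.
apply: limf_esup_ge0 => [|n]; last by rewrite lee_fin powR_ge0.
by move=> [N _ NV]; apply: (NV N) => /=.
Qed.

Lemma curv_le X (N n0 : nat) :
  (forall n, (n0 <= n)%N -> (betti pi X n%:Z <= N ^ n)%N) ->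
  (curv RR pi X <= N%:R%:E)%E.
Proof.
move=> bN; apply: (@limn_esup_le _ _ _ (maxn n0 1)) => n.
rewrite geq_max => /andP[/bN bn n1]; rewrite lee_fin.
have -> : (N%:R : RR) = ((N ^ n)%:R) `^ n%:R^-1.
  rewrite natrX -powR_mulrn ?ler0n // -powRrM mulfV ?powRr1 ?ler0n //.
  by rewrite pnatr_eq0 -lt0n.
by apply: ge0_ler_powR; rewrite ?nnegrE ?invr_ge0 ?ler0n // ler_nat.
Qed.

(** A nonzero Betti number is at least one, and so is each of its roots. *)
Lemma curv_lt1 X : (curv RR pi X < 1)%E ->
  exists n0 : int, forall n, n0 < n -> betti pi X n = 0%N.
Proof.
move=> /limn_esup_lt [n0 h]; exists (Posz n0) => n n0n.
have [m nm] : exists m : nat, n = m%:Z by exists (absz n); lia.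
subst n; have := h m ltac:(lia); rewrite lte_fin => lt1.
apply/eqP; apply: contraTT lt1 => b0; rewrite -leNgt.
have e : (1 : RR) `^ m%:R^-1 = 1 by rewrite powR1.
rewrite -[X in X <= _]e.
apply: ge0_ler_powR; rewrite ?nnegrE ?invr_ge0 ?ler0n ?ler01 //.
by rewrite ler1n lt0n.
Qed.

End Curvature.

(** * Routes and the distance *)

Section Metric.
Variables (RR : realType) (R : comUnitRingType) (k : fieldType).
Variable pi : {rmorphism R -> k}.
Hypothesis R_noetherian : noetherian R.
Hypothesis R_local : local_ring R.
Hypothesis k_residue : residue_map pi.
Implicit Types A B C D : SD R.
Local Notation sigma := (@sigma RR R k pi).
Local Notation dist := (@dist RR R k pi).

Lemma SD_repr_semidualizing C : semidualizing (SD_repr C).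
Proof. exact: s2valP (cid2 (svalP C)). Qed.

Lemma SD_reprE C : sval C = shift_class (SD_repr C).
Proof. exact: s2valP' (cid2 (svalP C)). Qed.

Lemma SD_eq C D : shift_iso (SD_repr C) (SD_repr D) -> C = D.
Proof.
move=> /shift_class_eq; rewrite -!SD_reprE.
case: C D => [c pc] [d pd] /= e; subst d.
by rewrite (Prop_irrelevance pc pd).
Qed.

Definition SD_ring : SD R :=
  exist _ (shift_class (stalk R^o)) (ex_intro2 _ _ _ semidualizing_stalk erefl).

Lemma sigma_ge0 C D : (0 <= sigma C D)%E.
Proof. exact: curv_ge0. Qed.

Lemma SD_le_refl C : SD_le C C.
Proof. exact/semidualizing_reflexive/SD_repr_semidualizing. Qed.

Lemma sigma_refl C : (sigma C C <= 0)%E.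
Proof.
have [_ hom_qiso] := SD_repr_semidualizing C.
apply: (@curv_le _ _ _ _ _ 0 1) => n n1.
have [s [qs _]] := sphere_stalk (@sphere0P R 0).
rewrite (betti_minimal k_residue _ (@sphere0_minimal R 0) (sphere_bbelow (sphere0P 0))
  (quasi_iso_D (qiso_comp qs hom_qiso))) /=.
by case: n n1.
Qed.

Lemma SD_ring_sphere : exists a, D_iso (mxc (@sphere0 R a)) (SD_repr SD_ring).
Proof.
have : shift_class (stalk R^o) (SD_repr SD_ring).
  by rewrite -[shift_class _]/(sval SD_ring) SD_reprE; apply: shift_iso_refl.
move=> [a h]; exists a; exact: D_iso_trans (sphere_shift_stalk a) (D_iso_sym h).
Qed.

Lemma SD_le_ring C : SD_le C SD_ring.
Proof.
have [a aP] := SD_ring_sphere.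
have sC := SD_repr_semidualizing C.
have [F [b [p [bF _ qp]]]] := hfinite_resolution R_noetherian sC.1.
apply: (shifted_ring_reflexive R_noetherian sC bF qp) aP.
by case: (SD_repr_semidualizing SD_ring).
Qed.

(** Here RHom(L, K) is a shift of [K], whose Betti numbers grow at most
    exponentially. *)
Lemma sigma_ring_fin C : (sigma C SD_ring < +oo)%E.
Proof.
have [a aP] := SD_ring_sphere.
have sC := SD_repr_semidualizing C.
have [F [b [p [bF mF qp]]]] := hfinite_resolution R_noetherian sC.1.
have FM := shifted_ring_RHom qp aP.
have bettiE n : betti pi (RHom (SD_repr SD_ring) (SD_repr C)) n = rk F (n - - a).
  exact: (betti_minimal k_residue n (mshift_minimal mF) (mshift_bbelow (b := - a) bF) FM).
have [A [B rkF]] := rank_growth k_residue R_noetherian R_local bF mF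
  (semidualizing_testing sC bF qp).
(* The constant [A B^c] is absorbed into the base, since [n] is positive. *)
pose c := absz (a - b); pose N := ((A * B.+1 ^ c).+1 * B.+1)%N.
apply: le_lt_trans (ltry N%:R).
apply: (@curv_le _ _ _ _ _ N c.+1) => n nc; rewrite bettiE.
have -> : (n%:Z - - a = b + Posz (absz (n%:Z + a - b)%R))%R by lia.
apply: leq_trans (rkF _) _.
set L := absz _; have Lc : (L <= n + c)%N by rewrite /L; lia.
apply: (@leq_trans (A * B.+1 ^ (n + c))).
  rewrite leq_mul2l; apply/orP; right.
  apply: (@leq_trans (B.+1 ^ L)); last by rewrite leq_pexp2l.
  by case: L {Lc} => // L; rewrite leq_exp2r.
rewrite /N expnMn expnD mulnA mulnAC leq_mul2r; apply/orP; right.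
apply: leq_trans (leqnSn _) _; rewrite -[X in (X <= _)%N]expn1 leq_pexp2l //.
lia.
Qed.

Lemma sigma_lt1 C D : SD_le C D -> (sigma C D < 1)%E -> C = D.
Proof.
move=> CD /curv_lt1 [n0 b0]; apply/esym/SD_eq.
exact: (separation k_residue R_noetherian (SD_repr_semidualizing C)
  (SD_repr_semidualizing D) CD b0).
Qed.

Lemma route_length_ge0 A B (g : route A B) : (0 <= route_length RR pi g)%E.
Proof. by apply: sume_ge0 => j _; apply: adde_ge0; apply: sigma_ge0. Qed.

Lemma dist_ge0 A B : (0 <= dist A B)%E.
Proof. by apply: le_ereal_inf_tmp => _ [g <-]; apply: route_length_ge0. Qed.

Lemma dist_le A B (g : route A B) : (dist A B <= route_length RR pi g)%E.
Proof. by apply: ereal_inf_lbound; exists g. Qed.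

Section OneStep.
Variables (A B L : SD R) (AL : SD_le A L) (BL : SD_le B L).

Lemma one_step_le j : (j < 1)%N ->
  SD_le (if j is 0 then A else B) L /\ SD_le (if j.+1 is 0 then A else B) L.
Proof. by case: j. Qed.

Definition one_step : route A B :=
  @Route R A B 1 (fun j => if j is 0 then A else B) (fun=> L) isT erefl erefl one_step_le.

Lemma one_step_length : route_length RR pi one_step = (sigma A L + sigma B L)%E.
Proof. by rewrite /route_length big_ord1. Qed.
End OneStep.

Lemma dist_fin A B : (dist A B < +oo)%E.
Proof.
apply: le_lt_trans (dist_le (one_step (SD_le_ring A) (SD_le_ring B))) _.
by rewrite one_step_length; apply: lte_add_pinfty; apply: sigma_ring_fin.
Qed.

Lemma dist_refl A : dist A A = 0%E.
Proof.
apply/eqP; rewrite eq_le dist_ge0 andbT.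
apply: le_trans (dist_le (one_step (SD_le_refl A) (SD_le_refl A))) _.
by rewrite one_step_length; apply: adde_le0; apply: sigma_refl.
Qed.

(** A short route is constant, since each of its terms is less than one. *)
Lemma dist_eq0 A B : dist A B = 0%E -> A = B.
Proof.
move=> d0; have : (dist A B < 1)%E by rewrite d0 lte01.
move=> /ereal_inf_lt [_ [[n K L n0 KA KB le] <-] lt1].
rewrite -KA -KB.
have step j : (j < n)%N -> K j = K j.+1.
  move=> jn; have [le1 le2] := le j jn.
  have lt_sum : (sigma (K j) (L j) + sigma (K j.+1) (L j) < 1)%E.
    apply: le_lt_trans lt1; rewrite /route_length /=.
    rewrite (bigD1 (Ordinal jn)) //= leeDl // sume_ge0 // => i _.
    by apply: adde_ge0; apply: sigma_ge0.
  rewrite (sigma_lt1 le1); last by apply: le_lt_trans lt_sum; rewrite leeDl ?sigma_ge0.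
  rewrite (sigma_lt1 le2) //.
  by apply: le_lt_trans lt_sum; rewrite leeDr ?sigma_ge0.
clear le lt1 n0 KA KB; elim: n step => [//|n IH step].
apply: etrans (IH _) (step n (ltnSn n)) => j jn.
by apply: step; apply: leqW.
Qed.

Section Reverse.
Variables (A B : SD R) (g : route A B).

Lemma rev_start : Kr g (rlen g - 0) = B.
Proof. by rewrite subn0 route_end. Qed.

Lemma rev_end : Kr g (rlen g - rlen g) = A.
Proof. by rewrite subnn route_start. Qed.

Lemma rev_le j : (j < rlen g)%N ->
  SD_le (Kr g (rlen g - j)) (Lr g (rlen g - j.+1)) /\
  SD_le (Kr g (rlen g - j.+1)) (Lr g (rlen g - j.+1)).
Proof.
move=> jn; have [] := route_le (r := g) (_ : (rlen g - j.+1 < rlen g)%N).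
  by rewrite ltn_subrL route_pos.
by rewrite -subSn // subSS.
Qed.

Definition rev_route : route B A :=
  @Route R B A (rlen g) (fun j => Kr g (rlen g - j)) (fun j => Lr g (rlen g - j.+1))
    (route_pos g) rev_start rev_end rev_le.

Lemma rev_route_length : route_length RR pi rev_route = route_length RR pi g.
Proof.
rewrite /route_length; move: (@Defs.sigma RR R k pi) => s.
pose F j := (s (Kr g j) (Lr g j) + s (Kr g j.+1) (Lr g j))%E.
transitivity (\sum_(j < rlen g) F (rlen g - j.+1)%N)%E.
  apply: eq_bigr => j _; rewrite /F /= addeC.
  by rewrite -subSn // subSS.
rewrite -(big_mkord xpredT (fun j => F (rlen g - j.+1)%N)) big_nat_rev /= big_mkord.
apply: eq_bigr => j _; congr F.
by have jn := ltn_ord j; lia.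
Qed.
End Reverse.

Lemma dist_sym_le A B : (dist A B <= dist B A)%E.
Proof.
apply: le_ereal_inf_tmp => _ [g <-].
by rewrite -(rev_route_length g); apply: dist_le.
Qed.

Section Concatenation.
Variables (A B C : SD R) (g : route A B) (h : route B C).

Definition cat_K j : SD R := if (j <= rlen g)%N then Kr g j else Kr h (j - rlen g).
Definition cat_L j : SD R := if (j < rlen g)%N then Lr g j else Lr h (j - rlen g).

Lemma cat_K_ge j : (rlen g <= j)%N -> cat_K j = Kr h (j - rlen g).
Proof.
rewrite /cat_K leq_eqVlt => /orP[/eqP <-|]; last by rewrite ltnNge => /negPf ->.
by rewrite leqnn subnn route_end route_start.
Qed.

Lemma cat_pos : (0 < rlen g + rlen h)%N.
Proof. by rewrite addn_gt0 route_pos. Qed.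

Lemma cat_start : cat_K 0 = A.
Proof. exact: route_start. Qed.

Lemma cat_end : cat_K (rlen g + rlen h) = C.
Proof. by rewrite cat_K_ge ?leq_addr // addKn route_end. Qed.

Lemma cat_le j : (j < rlen g + rlen h)%N ->
  SD_le (cat_K j) (cat_L j) /\ SD_le (cat_K j.+1) (cat_L j).
Proof.
move=> jn; have [jg|gj] := ltnP j (rlen g).
  by rewrite /cat_K /cat_L (ltnW jg) jg; apply: route_le.
rewrite !cat_K_ge ?(leqW gj) // /cat_L ltnNge gj subSn //.
by apply: route_le; rewrite ltn_subLR.
Qed.

Definition cat_route : route A C :=
  @Route R A C _ cat_K cat_L cat_pos cat_start cat_end cat_le.

Lemma cat_route_length : route_length RR pi cat_route =
  (route_length RR pi g + route_length RR pi h)%E.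
Proof.
rewrite /route_length; move: (@Defs.sigma RR R k pi) => s.
rewrite /= big_split_ord /=; congr (_ + _)%E; apply: eq_bigr => j _.
  by rewrite /cat_K /cat_L ltn_ord (ltnW (ltn_ord j)).
rewrite !cat_K_ge ?leqW ?leq_addr // /cat_L ltnNge leq_addr /= -addnS.
by rewrite !addKn.
Qed.
End Concatenation.

Lemma dist_fin_num A B : dist A B \is a fin_num.
Proof. by rewrite ge0_fin_numE ?dist_fin ?dist_ge0. Qed.

Lemma dist_triangle A B C : (dist A C <= dist A B + dist B C)%E.
Proof.
apply/lee_addgt0Pr => e e0.
have e2 : 0 < e / 2 by rewrite divr_gt0.
have [_ [g <-] gP] := lb_ereal_inf_adherent e2 (dist_fin_num A B).
have [_ [h <-] hP] := lb_ereal_inf_adherent e2 (dist_fin_num B C).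
apply: le_trans (dist_le (cat_route g h)) _; rewrite cat_route_length.
apply: le_trans (leeD (ltW gP) (ltW hP)) _.
by rewrite addeACA -EFinD -splitr.
Qed.

End Metric.

Theorem theoremA (RR : realType) (R : comUnitRingType) (k : fieldType)
    (pi : {rmorphism R -> k}) (R_noetherian : noetherian R)
    (R_local : local_ring R) (k_residue : residue_map pi) :
  is_metric (@dist RR R k pi).
Proof.
have fin A B := dist_fin_num RR R_noetherian R_local k_residue A B.
exists (fun A B => fine (dist RR pi A B)); split=> [A B|]; first by rewrite fineK.
split=> [A B|A B|A B|A B C].
- by rewrite fine_ge0 // dist_ge0.
- split=> [d0|->]; last by rewrite dist_refl.
  apply: (dist_eq0 R_noetherian k_residue (RR := RR)).
  by rewrite -[LHS]fineK // d0.
- by congr fine; apply/eqP; rewrite eq_le !dist_sym_le.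
- rewrite -fineD // fine_le // ?fin_numD ?fin //.
  exact: dist_triangle.
Qed.
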